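(* Let $p:\mathcal E\to\mathcal B$ be a graph bundle such that, for some $\delta\ge0$, $\mathcal B$ is $\delta$-hyperbolic and every fiber $\mathcal E_v$ ($v$ a vertex of $\mathcal B$) is $\delta$-hyperbolic in its own path metric (fibers are not assumed properly embedded in $\mathcal E$). If there is a collection $\mathcal S$ of sections of $p$ for which $p:\mathcal E\to\mathcal B$ is an externally flaring graph bundle, then the total space $\mathcal E$ is hyperbolic. In other words, externally flaring graph bundles are hyperbolic.
   Context: All graphs are simplicial with the path metric in which edges have length 1. For a subset $A$ of a metric space $X$, a closest point projection of $x$ to $A$ is a point $a\in A$ with $d(x,a)\le d(x,A)+1$. A graph bundle is a surjective simplicial map $p:\mathcal E\to\mathcal B$ between connected graphs such that the subgraph $\mathcal E_v=p^{-1}(v)$ (the fiber) is connected for each vertex $v\in\mathcal B$. A section is a simplicial embedding $\Sigma:\mathcal B\to\mathcal E$ with $p\circ\Sigma(v)=v$ for all vertices $v$. $[x,y]_v$ denotes a geodesic of the graph $\mathcal E_v$ between $x,y\in\mathcal E_v$; $d_{\mathcal E}$ is the metric of the whole graph $\mathcal E$. The bundle together with a family $\mathcal S$ of sections (called tight sections) is an externally flaring graph bundle if: (1) (Hyperbolicity) $\mathcal B$ and all fibers $\mathcal E_v$ are uniformly hyperbolic. (2) (Full sections) For each vertex $x\in\mathcal E$ there is a tight section through $x$. (3) (Robust sections) For every $\Sigma_1,\Sigma_2\in\mathcal S$ and any choice of geodesics $[\Sigma_1(u),\Sigma_2(u)]_u$ for each vertex $u\in\mathcal B$, if $x$ is a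 vertex of $[\Sigma_1(v),\Sigma_2(v)]_v$ for some $v$, then there is a tight section $\Sigma_x$ through $x$ with $\Sigma_x(u)\in[\Sigma_1(u),\Sigma_2(u)]_u$ for all vertices $u\in\mathcal B$. (4) (Fiberwise retraction) There is $\kappa\ge1$ such that: if vertices $x,y,z$ in a fiber $\mathcal E_v$ are respectively adjacent to vertices $x',y',z'$ in a fiber $\mathcal E_{v'}$, $q$ is a closest point projection of $z$ to a geodesic $[x,y]_v$ in $\mathcal E_v$, and $q'$ is a closest point projection of $z'$ to a geodesic $[x',y']_{v'}$ in $\mathcal E_{v'}$, then $d_{\mathcal E}(q,q')\le\kappa$. (5) (Flaring in $\mathcal E$) There is $\sigma>0$ such that for all $B\ge\sigma$ there is a function $\lambda=\lambda(B):\mathbb R^+\to\mathbb R^+$ with $\lambda(t)\to\infty$ as $t\to\infty$ such that for any $\Sigma_1,\Sigma_2\in\mathcal S$ and any geodesic $\gamma=[u,v]\subset\mathcal B$: if $d_{\mathcal E}(\Sigma_1(v),\Sigma_2(v))\le B$ but $d_{\mathcal E}(\Sigma_1(w),\Sigma_2(w))\ge\sigma$ for all vertices $w\in\gamma-\{v\}$, then $d_{\mathcal E}(\Sigma_1(u),\Sigma_2(u))\ge\lambda(d_{\mathcal B}(v,u))$. *)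

(* Defs.v *)
From Stdlib Require Import Reals ClassicalEpsilon.
From Coquelicot Require Import Coquelicot.

Set Implicit Arguments.
Unset Strict Implicit.

Open Scope R_scope.

(* The least element of a set of naturals; unspecified on the empty set. *)
Definition least (P : nat -> Prop) : nat :=
  epsilon (inhabits 0%nat)
    (fun n => P n /\ forall m, P m -> (n <= m)%nat).

(* A simplicial graph is represented by its vertex set, of arbitrary
   cardinality, and the adjacency relation. Points, geodesics and distances
   are those of the vertex set. *)
Record graph : Type := Graph {
  vertex :> Type;
  adj : vertex -> vertex -> Prop;
  adj_sym : forall x y, adj x y -> adj y x;
  adj_irrefl : forall x, ~ adj x x
}.

Inductive walk (G : graph) : nat -> G -> G -> Prop :=
| walk_nil (x : G) : walk 0 x x
| walk_cons (n : nat) (x y z : G) : adj x y -> walk n y z -> walk (S n) x z.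

Definition connected (G : graph) : Prop :=
  forall x y : G, exists n, walk n x y.

Definition dist (G : graph) (x y : G) : nat := least (fun n => walk n x y).

Definition dist_set (G : graph) (x : G) (A : G -> Prop) : nat :=
  least (fun n => exists a, A a /\ dist x a = n).

Definition closest_point_projection (G : graph) (A : G -> Prop) (x a : G)
  : Prop := A a /\ (dist x a <= dist_set x A + 1)%nat.

(* [c], restricted to 0, ..., dist x y, is an isometric embedding; its other
   values are irrelevant. *)
Definition geodesic (G : graph) (x y : G) (c : nat -> G) : Prop :=
  c 0%nat = x /\ c (dist x y) = y /\
  forall i j, (i <= j)%nat -> (j <= dist x y)%nat -> dist (c i) (c j) = (j - i)%nat.

Definition on_geodesic (G : graph) (x y : G) (c : nat -> G) (z : G) : Prop :=
  exists i, (i <= dist x y)%nat /\ c i = z.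

(* Every side of a geodesic triangle lies in the delta-neighbourhood of the
   union of the other two; it suffices to say so for the side [a] because the
   three corners are arbitrary. *)
Definition delta_hyperbolic (delta : R) (G : graph) : Prop :=
  forall (x y z : G) (a b c : nat -> G),
    geodesic x y a -> geodesic y z b -> geodesic z x c ->
    forall s, on_geodesic x y a s ->
    exists t, (on_geodesic y z b t \/ on_geodesic z x c t) /\
              INR (dist s t) <= delta.

Definition hyperbolic (G : graph) : Prop :=
  exists delta, 0 <= delta /\ delta_hyperbolic delta G.

(* A simplicial map may collapse an edge to a vertex. *)
Definition simplicial_map (G H : graph) (f : G -> H) : Prop :=
  forall x y, adj x y -> f x = f y \/ adj (f x) (f y).

(* Surjectivity on the underlying complexes: on vertices and on edges. *)
Definition simplicial_surjective (G H : graph) (f : G -> H) : Prop :=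
  (forall v, exists x, f x = v) /\
  (forall u v, adj u v -> exists x y, adj x y /\ f x = u /\ f y = v).

Section Bundle.

Variables (E B : graph) (p : E -> B).

(* An edge of [E] is mapped to the vertex [v] exactly when both its endpoints
   are, so the preimage of [v] is an induced subgraph. *)
Definition fiber (v : B) : graph :=
  @Graph {x : E | p x = v}
    (fun x y => adj (proj1_sig x) (proj1_sig y))
    (fun x y => @adj_sym E (proj1_sig x) (proj1_sig y))
    (fun x => @adj_irrefl E (proj1_sig x)).

Definition in_total (v : B) (x : fiber v) : E := proj1_sig x.

Record graph_bundle : Prop := {
  bundle_total_connected : connected E;
  bundle_base_connected : connected B;
  bundle_simplicial : simplicial_map p;
  bundle_surjective : simplicial_surjective p;
  bundle_fiber_connected : forall v, connected (fiber v)
}.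

(* Injectivity of a section follows from [sec_proj]; hence a simplicial
   embedding is one which maps edges to edges. *)
Record bundle_section : Type := BundleSection {
  sec :> B -> E;
  sec_adj : forall u v, adj u v -> adj (sec u) (sec v);
  sec_proj : forall v, p (sec v) = v
}.

Definition sec_fiber (Sigma : bundle_section) (v : B) : fiber v :=
  exist _ (Sigma v) (sec_proj Sigma v).

Definition uniformly_hyperbolic (delta : R) : Prop :=
  delta_hyperbolic delta B /\ forall v, delta_hyperbolic delta (fiber v).

Definition full_sections (S : bundle_section -> Prop) : Prop :=
  forall x : E, exists Sigma, S Sigma /\ exists v, Sigma v = x.

Definition robust_sections (S : bundle_section -> Prop) : Prop :=
  forall Sigma1 Sigma2, S Sigma1 -> S Sigma2 ->
  forall c : forall u, nat -> fiber u,
    (forall u, geodesic (sec_fiber Sigma1 u) (sec_fiber Sigma2 u) (c u)) ->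
  forall (v : B) (x : fiber v),
    on_geodesic (sec_fiber Sigma1 v) (sec_fiber Sigma2 v) (c v) x ->
  exists Sigmax, S Sigmax /\ Sigmax v = in_total x /\
    forall u, on_geodesic (sec_fiber Sigma1 u) (sec_fiber Sigma2 u) (c u)
                (sec_fiber Sigmax u).

Definition fiberwise_retraction : Prop :=
  exists kappa : R, 1 <= kappa /\
  forall (v v' : B) (x y z : fiber v) (x' y' z' : fiber v'),
    adj (in_total x) (in_total x') ->
    adj (in_total y) (in_total y') ->
    adj (in_total z) (in_total z') ->
  forall (c : nat -> fiber v) (c' : nat -> fiber v'),
    geodesic x y c -> geodesic x' y' c' ->
  forall (q : fiber v) (q' : fiber v'),
    closest_point_projection (on_geodesic x y c) z q ->
    closest_point_projection (on_geodesic x' y' c') z' q' ->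
    INR (dist (in_total q) (in_total q')) <= kappa.

(* [lambda] is a function from [0, oo) to [0, oo), extended arbitrarily to
   negative arguments. Zero is a possible value since [u = v] is allowed. *)
Definition flaring (S : bundle_section -> Prop) : Prop :=
  exists sigma : R, 0 < sigma /\
  forall D : R, sigma <= D ->
  exists lambda : R -> R,
    (forall t, 0 <= t -> 0 <= lambda t) /\
    is_lim lambda p_infty p_infty /\
    forall Sigma1 Sigma2, S Sigma1 -> S Sigma2 ->
    forall (u v : B) (c : nat -> B), geodesic u v c ->
      INR (dist (Sigma1 v) (Sigma2 v)) <= D ->
      (forall w, on_geodesic u v c w -> w <> v ->
         sigma <= INR (dist (Sigma1 w) (Sigma2 w))) ->
      lambda (INR (dist v u)) <= INR (dist (Sigma1 u) (Sigma2 u)).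

Record externally_flaring (S : bundle_section -> Prop) : Prop := {
  ef_bundle : graph_bundle;
  ef_hyperbolic : exists delta, 0 <= delta /\ uniformly_hyperbolic delta;
  ef_full : full_sections S;
  ef_robust : robust_sections S;
  ef_retraction : fiberwise_retraction;
  ef_flaring : flaring S
}.

End Bundle.

(* Main.v *)
(* Every tight section is an isometric copy of the base, and the points between two tight
   sections in all fibers form a ladder, on which the total space retracts. The points of
   finitely many paths in a ladder lie on a chain of tight sections, linearly ordered and
   consecutively adjacent over one vertex. Let two sections of a chain be close somewhere:
   by flaring they are close on a quasiconvex set of the base, and the nearest point
   projection to this set gives a map from the upper section to the lower one. If they are
   close nowhere, all the sections beyond the first far one are sent to a single point. Far
   from the section the resulting map of the chain moves points by a constant only,
   whatever the length of the step, so that quasi-geodesics of the chain are Morse along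
   sections. Hence quasi-geodesic triangles in ladders are slim: a quasi-geodesic is
   pinned, on each section which it crosses, by the projections of its ends. Three ladders
   spanned by three sections meet in the coarse section of fiberwise barycenters, so that
   quasi-geodesics in ladders form slim triangles in the whole space, and Bowditch's
   criterion for guessed geodesics applies. *)
From Stdlib Require Import Reals Lra Lia Arith List Classical ClassicalEpsilon.
From Coquelicot Require Import Coquelicot.
Require Import Defs.
Local Open Scope nat_scope.
Set Implicit Arguments.
Unset Strict Implicit.

(** Fibers need not be properly embedded, so a bound in [E] gives none inside a fiber. Sections are
    therefore compared by their distance in [E], and what a fiber contributes is only its coarse
    projections to geodesics and the barycenters of its triangles. A chain can be arbitrarily long,
    so an argument passing from each section to the next would lose a constant every time. The order
    of quantifiers avoids this: the map of the chain to one of its sections moves far points by at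
    most [C], chosen before the step length [n], and only the threshold [R n] for being far depends
    on [n]. When [q] steps of a path are grouped into one, with [q] large compared with [C] and the
    quasi-geodesic constant, the image moves too slowly for a quasi-geodesic, so an excursion away
    from the section is short, however many sections it crosses. A ladder may carry infinitely many
    sections, but each comparison of paths involves finitely many points; a finite chain through
    them suffices because no constant depends on its length. *)

(** * Extremal indices and growth of powers of two *)

Lemma least_spec (P : nat -> Prop) :
  (exists n, P n) -> P (least P) /\ forall m, P m -> least P <= m.
Proof.
intros [n Hn].
assert (H : exists n, P n /\ forall m, P m -> n <= m).
{ revert Hn; induction n as [n IH] using lt_wf_ind; intros Hn.
  destruct (classic (exists m, m < n /\ P m)) as [[m [Hm HPm]]|H].
  - exact (IH m Hm HPm).
  - exists n; split; auto. intros m Hm.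
    destruct (le_lt_dec n m); auto. exfalso; eauto. }
exact (epsilon_spec (inhabits 0) _ H).
Qed.

Lemma bound_function (P : nat -> nat -> Prop) :
  (forall n, exists m, P n m) -> exists f, forall n, P n (f n).
Proof.
intros H. exists (fun n => epsilon (inhabits 0) (P n)). intros n; apply epsilon_spec, H.
Qed.

Lemma argmax_upto (f : nat -> nat) (N : nat) :
  exists i, i <= N /\ forall j, j <= N -> f j <= f i.
Proof.
induction N as [|N [i [Hi H]]].
- exists 0; split; auto. intros j Hj; replace j with 0 by lia; auto.
- destruct (le_lt_dec (f (S N)) (f i)).
  + exists i; split; [lia|]. intros j Hj.
    destruct (Nat.eq_dec j (S N)); [subst; auto|apply H; lia].
  + exists (S N); split; auto. intros j Hj.
    destruct (Nat.eq_dec j (S N)); [subst; auto|]. specialize (H j); lia.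
Qed.

Lemma last_before (P : nat -> Prop) (a b : nat) :
  a <= b -> P a -> ~ P b ->
  exists i, a <= i < b /\ P i /\ forall j, i < j <= b -> ~ P j.
Proof.
intros Hab Ha. induction Hab as [|b Hab IH]; intros Hb; [contradiction|].
destruct (classic (P b)) as [H|H].
- exists b; repeat split; auto; try lia.
  intros j Hj; replace j with (S b) by lia; auto.
- destruct (IH H) as [i [Hi [HPi Hj]]]. exists i; repeat split; auto; try lia.
  intros j Hjj. destruct (Nat.eq_dec j (S b)); [subst; auto|apply Hj; lia].
Qed.

Lemma first_after (P : nat -> Prop) (a b : nat) :
  a <= b -> ~ P a -> P b ->
  exists i, a < i <= b /\ P i /\ forall j, a <= j < i -> ~ P j.
Proof.
intros Hab Ha Hb.
destruct (least_spec (P := fun n => a <= n /\ P n)) as [[H1 H2] H3]; [eauto|].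
set (i := least _) in *. clearbody i. exists i. split; [split|split; auto].
- destruct (Nat.eq_dec a i); [congruence|lia].
- apply H3; auto.
- intros j Hj HP. enough (i <= j) by lia. apply H3; split; [lia|auto].
Qed.

Lemma last_upto (P : nat -> Prop) (a b : nat) :
  a <= b -> P a -> exists i, a <= i <= b /\ P i /\ forall j, i < j <= b -> ~ P j.
Proof.
intros Hab Ha. destruct (classic (P b)).
- exists b; repeat split; auto. intros; lia.
- destruct (last_before Hab Ha H) as [i [? [? ?]]]. exists i; repeat split; auto; lia.
Qed.

Lemma first_from (P : nat -> Prop) (a b : nat) :
  a <= b -> P b -> exists i, a <= i <= b /\ P i /\ forall j, a <= j < i -> ~ P j.
Proof.
intros Hab Hb. destruct (classic (P a)).
- exists a; repeat split; auto. intros; lia.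
- destruct (first_after Hab H Hb) as [i [? [? ?]]]. exists i; repeat split; auto; lia.
Qed.

Lemma pow2_dominates_linear (A B : nat) :
  exists m0, forall m, m0 <= m -> A * m + B <= 2 ^ m.
Proof.
assert (Hm : forall m, m < 2 ^ m) by (intro m; apply Nat.pow_gt_lin_r; lia).
exists (2 * (2 * A + B + 2)). intros m Hmm.
(* Halving the exponent makes [2 ^ m] at least the square of [2 ^ h], hence of [h + 1], which
   outgrows a linear function. *)
set (h := m / 2). assert (m = 2 * h \/ m = 2 * h + 1) as Hh.
{ pose proof (Nat.div_mod m 2). pose proof (Nat.mod_upper_bound m 2). unfold h; lia. }
assert (2 ^ h * 2 ^ h <= 2 ^ m).
{ rewrite <- Nat.pow_add_r. apply Nat.pow_le_mono_r; lia. }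
assert (2 * A + B + 2 <= h) by lia.
pose proof (Hm h).
assert (A * m <= A * (2 * h + 1)) by (apply Nat.mul_le_mono_l; lia).
assert ((h + 1) * (2 * A + B + 2) <= (h + 1) * (h + 1)) by (apply Nat.mul_le_mono_l; lia).
assert ((h + 1) * (h + 1) <= 2 ^ h * 2 ^ h) by (apply Nat.mul_le_mono; lia).
nia.
Qed.

(** This ends the exponential divergence argument: [x] is the largest distance from a path,
    [A * x + A] bounds the length of a detour around the ball of that radius, and [m] is the number
    of bisections. *)
Lemma below_logarithm_bounded (A D C : nat) : exists X, forall x,
  (forall m, A * x + A <= 2 ^ m -> x <= D * m + C) -> x <= X.
Proof.
destruct (pow2_dominates_linear (A * S D) (A * (S D + C) + A)) as [m0 H0].
exists (S D * m0 + C). intros x Hx.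
destruct (le_lt_dec x (S D * m0 + C)) as [|Hlt]; auto. exfalso.
(* For this [m] one has [D * m + C < x], whereas [x] is at most linear in [m], so that [2 ^ m]
   exceeds [A * x + A] once [m0 <= m]. *)
set (m := (x - C - 1) / S D).
pose proof (Nat.div_mod (x - C - 1) (S D) ltac:(lia)) as E1.
pose proof (Nat.mod_upper_bound (x - C - 1) (S D) ltac:(lia)) as E2.
fold m in E1. set (r := (x - C - 1) mod S D) in *.
assert (m0 <= m) by nia.
specialize (H0 m H). specialize (Hx m). nia.
Qed.

(** * Distances and geodesics in a connected graph *)

Section Graph.

Variable G : graph.
Hypothesis conn : connected G.

Lemma dist_walk (x y : G) : walk (dist x y) x y.
Proof. exact (proj1 (least_spec (conn x y))). Qed.

Lemma dist_le_walk (x y : G) (n : nat) : walk n x y -> dist x y <= n.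
Proof. exact (proj2 (least_spec (conn x y)) n). Qed.

Lemma walk_app (n m : nat) (x y z : G) :
  walk n x y -> walk m y z -> walk (n + m) x z.
Proof. induction 1; simpl; auto. intros; econstructor; eauto. Qed.

Lemma walk_rev (n : nat) (x y : G) : walk n x y -> walk n y x.
Proof.
induction 1; [constructor|]. replace (S n) with (n + 1) by lia.
eapply walk_app; eauto. econstructor; [apply adj_sym; eauto|constructor].
Qed.

Lemma dist_refl (x : G) : dist x x = 0.
Proof. pose proof (dist_le_walk (walk_nil x)); lia. Qed.

Lemma dist_sym (x y : G) : dist x y = dist y x.
Proof.
apply Nat.le_antisymm; apply dist_le_walk; apply walk_rev; apply dist_walk.
Qed.

Lemma dist_tri (x y z : G) : dist x z <= dist x y + dist y z.
Proof. apply dist_le_walk. eapply walk_app; apply dist_walk. Qed.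

Lemma dist_eq0 (x y : G) : dist x y = 0 -> x = y.
Proof. intros H. pose proof (dist_walk x y) as W. rewrite H in W. now inversion W. Qed.

Lemma dist_adj (x y : G) : adj x y -> dist x y <= 1.
Proof. intros; apply dist_le_walk; econstructor; eauto; constructor. Qed.

Lemma dist_le1 (x y : G) : dist x y <= 1 -> x = y \/ adj x y.
Proof.
intros H. pose proof (dist_walk x y) as W.
inversion W as [|n ? z ? Hz W']; subst; auto.
right. assert (n = 0) by lia. subst. now inversion W'; subst.
Qed.

Definition steps (k N : nat) (a : nat -> G) : Prop :=
  forall i, i < N -> dist (a i) (a (S i)) <= k.

Lemma steps_dist (k N : nat) (a : nat -> G) : steps k N a ->
  forall i j, i <= j -> j <= N -> dist (a i) (a j) <= k * (j - i).
Proof.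
intros H i j Hij. induction Hij as [|j Hij IH]; intros Hj.
- rewrite dist_refl; lia.
- pose proof (dist_tri (a i) (a j) (a (S j))). specialize (H j ltac:(lia)).
  specialize (IH ltac:(lia)). replace (S j - i) with (S (j - i)) by lia. lia.
Qed.

Lemma walk_path (n : nat) (x y : G) : walk n x y ->
  exists c, c 0 = x /\ c n = y /\ steps 1 n c.
Proof.
induction 1 as [x|n x y z Ha W [c [H0 [Hn Hs]]]].
- exists (fun _ => x); repeat split; auto. intros i Hi; lia.
- exists (fun i => match i with 0 => x | S i => c i end); repeat split; auto.
  intros [|i] Hi; [rewrite H0; now apply dist_adj|apply Hs; lia].
Qed.

Lemma geodesic_of_steps (x y : G) (c : nat -> G) :
  c 0 = x -> c (dist x y) = y -> steps 1 (dist x y) c -> geodesic x y c.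
Proof.
intros H0 Hn Hs; repeat split; auto. intros i j Hij Hj.
pose proof (steps_dist Hs Hij Hj).
pose proof (steps_dist Hs (Nat.le_0_l i) ltac:(lia)).
pose proof (steps_dist Hs Hj ltac:(lia)).
rewrite H0 in *; rewrite Hn in *.
pose proof (dist_tri x (c i) y). pose proof (dist_tri (c i) (c j) y). lia.
Qed.

Lemma geodesic_exists (x y : G) : exists c, geodesic x y c.
Proof.
destruct (walk_path (dist_walk x y)) as [c [H0 [Hn Hs]]].
exists c; now apply geodesic_of_steps.
Qed.

(** By [geodesic_through] and [geodesic_btw] this means that [s] lies on some geodesic from [x] to
    [y], so that no geodesic has to be named. *)
Definition btw (x s y : G) : Prop := dist x s + dist s y = dist x y.

Lemma btw_sym (x s y : G) : btw x s y -> btw y s x.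
Proof. unfold btw. rewrite (dist_sym x s), (dist_sym s y), (dist_sym x y); lia. Qed.

Lemma geodesic_btw (x y : G) c i : geodesic x y c -> i <= dist x y ->
  dist x (c i) = i /\ btw x (c i) y.
Proof.
intros [H0 [Hn H]] Hi.
pose proof (H 0 i ltac:(lia) Hi). pose proof (H i _ Hi (le_n _)).
rewrite H0 in *; rewrite Hn in *. unfold btw; lia.
Qed.

Lemma btw_right (x y : G) : btw x y y.
Proof. unfold btw; rewrite dist_refl; lia. Qed.

Lemma geodesic_through (x s y : G) : btw x s y ->
  exists c, geodesic x y c /\ c (dist x s) = s.
Proof.
intros H. destruct (walk_path (dist_walk x s)) as [a [A0 [An As]]].
destruct (walk_path (dist_walk s y)) as [b [B0 [Bn Bs]]].
set (c := fun i => if le_lt_dec i (dist x s) then a i else b (i - dist x s)).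
assert (c (dist x s) = s) by (unfold c; destruct le_lt_dec; [auto|lia]).
exists c; split; auto. unfold btw in H. apply geodesic_of_steps.
- unfold c; destruct le_lt_dec; [auto|lia].
- unfold c; destruct le_lt_dec.
  + assert (dist s y = 0) by lia. apply dist_eq0 in H1. subst y.
    rewrite dist_refl in H. rewrite <- H, Nat.add_0_r. auto.
  + replace (dist x y - dist x s) with (dist s y) by lia; auto.
- intros i Hi. unfold c. destruct (le_lt_dec i (dist x s)), (le_lt_dec (S i) (dist x s)).
  + apply As; lia.
  + assert (i = dist x s) by lia. subst i. pose proof (Bs 0 ltac:(lia)) as Hb.
    rewrite B0 in Hb. rewrite An. now replace (S (dist x s) - dist x s) with 1 by lia.
  + lia.
  + replace (S i - dist x s) with (S (i - dist x s)) by lia. apply Bs; lia.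
Qed.

Lemma btw_at (x y : G) (i : nat) : i <= dist x y -> exists s, btw x s y /\ dist x s = i.
Proof.
intros Hi. destruct (geodesic_exists x y) as [c Hc].
exists (c i). destruct (geodesic_btw Hc Hi); auto.
Qed.

Lemma geodesic_sub (x y : G) (c : nat -> G) (i j : nat) :
  geodesic x y c -> i <= j -> j <= dist x y ->
  geodesic (c i) (c j) (fun l => c (i + l)).
Proof.
intros [H0 [Hn H]] Hij Hj. pose proof (H i j Hij Hj) as E.
repeat split.
- now rewrite Nat.add_0_r.
- rewrite E; f_equal; lia.
- rewrite E; intros. rewrite H; lia.
Qed.

Lemma geodesic_rev (x y : G) (c : nat -> G) :
  geodesic x y c -> geodesic y x (fun l => c (dist x y - l)).
Proof.
intros [H0 [Hn H]]. repeat split.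
- now rewrite Nat.sub_0_r.
- now rewrite (dist_sym y x), Nat.sub_diag.
- rewrite (dist_sym y x). intros. rewrite dist_sym, H; lia.
Qed.

Lemma nearest_exists (x : G) (A : G -> Prop) : (exists a, A a) ->
  exists a, A a /\ forall b, A b -> dist x a <= dist x b.
Proof.
intros [a0 Ha0].
destruct (least_spec (P := fun n => exists a, A a /\ dist x a = n)) as [[a [Ha E]] H].
{ eauto. }
exists a; split; auto. intros b Hb. rewrite E; apply H; eauto.
Qed.

Lemma nearest_projection (x a : G) (A : G -> Prop) :
  A a -> (forall b, A b -> dist x a <= dist x b + 1) -> closest_point_projection A x a.
Proof.
intros Ha H; split; auto. unfold dist_set.
destruct (least_spec (P := fun n => exists a, A a /\ dist x a = n)) as [[b [Hb E]] _].
{ eauto. }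
rewrite <- E. specialize (H b Hb). lia.
Qed.

(** * Quasi-geodesics and guessed geodesics *)

(** One constant serves as multiplicative and as additive error. The upper bound on distances
    follows from the bound on single steps. *)
Definition qgeo (k N : nat) (a : nat -> G) : Prop :=
  steps k N a /\ forall i j, i <= j -> j <= N -> j - i <= k * dist (a i) (a j) + k.

Lemma qgeo_mono k k' N a : k <= k' -> qgeo k N a -> qgeo k' N a.
Proof.
intros Hk [H1 H2]; split.
- intros i Hi; specialize (H1 i Hi); lia.
- intros i j Hi Hj. specialize (H2 i j Hi Hj). nia.
Qed.

Lemma qgeo_sub k N a i j : qgeo k N a -> i <= j -> j <= N ->
  qgeo k (j - i) (fun l => a (i + l)).
Proof.
intros [H1 H2] Hij Hj; split.
- intros l Hl. rewrite Nat.add_succ_r. apply H1; lia.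
- intros l m Hl Hm. specialize (H2 (i + l) (i + m) ltac:(lia) ltac:(lia)). lia.
Qed.

Lemma qgeo_rev k N a : qgeo k N a -> qgeo k N (fun l => a (N - l)).
Proof.
intros [H1 H2]; split.
- intros i Hi. rewrite dist_sym. replace (N - i) with (S (N - S i)) by lia. apply H1; lia.
- intros i j Hi Hj. rewrite dist_sym. specialize (H2 (N - j) (N - i) ltac:(lia) ltac:(lia)). lia.
Qed.

Definition path_in (k n : nat) (Q : G -> Prop) (x y : G) : Prop :=
  exists b, b 0 = x /\ b n = y /\ steps k n b /\ forall i, i <= n -> Q (b i).

Lemma path_in_app k n m Q x y z :
  path_in k n Q x y -> path_in k m Q y z -> path_in k (n + m) Q x z.
Proof.
intros [a [A0 [An [As AQ]]]] [b [B0 [Bn [Bs BQ]]]].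
exists (fun i => if le_lt_dec i n then a i else b (i - n)).
repeat split.
- destruct le_lt_dec; [auto|lia].
- destruct le_lt_dec.
  + assert (m = 0) by lia. subst m. rewrite Nat.add_0_r. congruence.
  + replace (n + m - n) with m by lia; auto.
- intros i Hi. destruct (le_lt_dec i n), (le_lt_dec (S i) n); try lia.
  + apply As; lia.
  + assert (i = n) by lia; subst i. rewrite An, <- B0.
    replace (S n - n) with 1 by lia. apply Bs; lia.
  + replace (S i - n) with (S (i - n)) by lia. apply Bs; lia.
- intros i Hi. destruct le_lt_dec; [apply AQ|apply BQ]; lia.
Qed.

Lemma path_in_rev k n Q x y : path_in k n Q x y -> path_in k n Q y x.
Proof.
intros [b [B0 [Bn [Bs BQ]]]]. exists (fun i => b (n - i)). repeat split.
- now rewrite Nat.sub_0_r.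
- now rewrite Nat.sub_diag.
- intros i Hi. rewrite dist_sym. replace (n - i) with (S (n - S i)) by lia. apply Bs; lia.
- intros i Hi; apply BQ; lia.
Qed.

Lemma path_in_geodesic k Q x y : 1 <= k -> (forall r, btw x r y -> Q r) ->
  path_in k (dist x y) Q x y.
Proof.
intros Hk HQ. destruct (geodesic_exists x y) as [c Hc].
pose proof Hc as [H0 [Hn H]]. exists c; repeat split; auto.
- intros i Hi. rewrite H; lia.
- intros i Hi. apply HQ. apply (geodesic_btw Hc Hi).
Qed.

(** With truncated subtraction [i - j + (j - i)] is the absolute difference, so the two indices need
    not be ordered. *)
Lemma path_in_segment k N b Q i j : steps k N b -> i <= N -> j <= N ->
  (forall l, l <= N -> Q (b l)) -> exists n, n = i - j + (j - i) /\ path_in k n Q (b i) (b j).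
Proof.
assert (Hw : steps k N b -> (forall l, l <= N -> Q (b l)) -> forall i j, i <= j -> j <= N ->
  path_in k (j - i) Q (b i) (b j)).
{ intros Hs HQ i' j' Hij Hj. exists (fun l => b (i' + l)). repeat split.
  - now rewrite Nat.add_0_r.
  - f_equal; lia.
  - intros l Hl. rewrite Nat.add_succ_r. apply Hs; lia.
  - intros l Hl; apply HQ; lia. }
intros Hs Hi Hj HQ. eexists; split; [reflexivity|].
destruct (le_lt_dec i j).
- replace (i - j + (j - i)) with (j - i) by lia. auto.
- replace (i - j + (j - i)) with (i - j) by lia. apply path_in_rev. apply Hw; auto; lia.
Qed.

Definition nearp (C N : nat) (a : nat -> G) (z : G) : Prop :=
  exists i, i <= N /\ dist z (a i) <= C.

(** The image under [rho] of an ambient geodesic competes with a shortest [k]-path inside [A]; this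
    makes the shortest path quasi-geodesic in the whole graph. The same comparison with geodesics to
    points of [M] shows that the path heads straight for [M]. *)
Lemma shortest_path (A M : G -> Prop) (rho : G -> G) (k : nat) (x : G) :
  (forall z, A (rho z)) -> (forall z, A z -> rho z = z) ->
  (forall z z', dist z z' <= 1 -> dist (rho z) (rho z') <= k) ->
  A x -> (exists m, M m) -> (forall m, M m -> A m) ->
  exists N a, a 0 = x /\ M (a N) /\ (forall i, i <= N -> A (a i)) /\ steps k N a /\
    (forall i j, i <= j -> j <= N -> j - i <= dist (a i) (a j)) /\
    (forall i m, i <= N -> M m -> N - i <= dist (a i) m).
Proof.
intros HA Hid Hlip Hx HM HMA.
assert (link : forall y z, A y -> A z -> path_in k (dist y z) A y z).
{ intros y z Hy Hz. destruct (geodesic_exists y z) as [c Hc]. pose proof Hc as [H0 [Hn Hd]].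
  exists (fun i => rho (c i)). repeat split.
  - rewrite H0; auto.
  - rewrite Hn; auto.
  - intros i Hi. apply Hlip. rewrite Hd; lia.
  - auto. }
destruct (least_spec (P := fun n => exists m, M m /\ path_in k n A x m))
  as [[m [Hm [a [A0 [AN [As AA]]]]]] Hmin].
{ destruct HM as [m Hm]. exists (dist x m), m; auto. }
set (N := least _) in *. clearbody N.
assert (part : forall i j, i <= j -> j <= N -> path_in k (j - i) A (a i) (a j)).
{ intros i j Hij Hj. destruct (@path_in_segment k N a A i j) as [n [En Hn]]; auto; try lia.
  replace (j - i) with n by lia. auto. }
exists N, a. repeat split; auto.
- rewrite AN; auto.
- intros i j Hij Hj. pose proof (part 0 i ltac:(lia) ltac:(lia)) as P1.
  pose proof (part j N Hj (le_n _)) as P2.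
  pose proof (path_in_app (path_in_app P1 (link (a i) (a j) (AA i ltac:(lia)) (AA j Hj))) P2) as P3.
  rewrite A0, AN in P3. pose proof (Hmin _ (ex_intro _ m (conj Hm P3))). lia.
- intros i m' Hi Hm'. pose proof (part 0 i ltac:(lia) ltac:(lia)) as P1.
  pose proof (path_in_app P1 (link (a i) m' (AA i Hi) (HMA m' Hm'))) as P3.
  rewrite A0 in P3. pose proof (Hmin _ (ex_intro _ m' (conj Hm' P3))). lia.
Qed.

(* Bowditch's criterion: bisecting a path shows that it has to be exponentially long in
   order to stay far from a guessed geodesic with the same ends. *)
Section Guess.

Variable L : nat -> (nat -> G) -> Prop.
Variables k D : nat.
Hypothesis L_qgeo : forall N a, L N a -> qgeo k N a.
Hypothesis L_sub : forall N a i j, L N a -> i <= j -> j <= N ->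
  L (j - i) (fun l => a (i + l)).
Hypothesis L_exists : forall x y, exists N a, L N a /\ a 0 = x /\ a N = y.
Hypothesis L_slim : forall N a M b P c, L N a -> L M b -> L P c ->
  a 0 = b 0 -> b M = c 0 -> c P = a N ->
  forall i, i <= N -> nearp D M b (a i) \/ nearp D P c (a i).

Lemma guess_log (k' m : nat) : forall N b M a,
  steps k' N b -> N <= 2 ^ m -> L M a -> a 0 = b 0 -> a M = b N ->
  forall i, i <= M -> nearp (D * m + k * (k * k' + k)) N b (a i).
Proof.
induction m as [|m IH]; intros N b M a Hb HN Ha E0 EN i Hi.
(* A single step: the ends are at most [k'] apart, so the guessed path has at most [k * k' + k]
   steps and stays near its start. *)
- simpl in HN. destruct (L_qgeo Ha) as [Hs Hq].
  assert (dist (a 0) (a M) <= k').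
  { rewrite E0, EN. pose proof (steps_dist Hb (Nat.le_0_l N) (le_n _)). nia. }
  specialize (Hq 0 M ltac:(lia) ltac:(lia)).
  pose proof (steps_dist Hs (Nat.le_0_l i) Hi).
  exists 0; split; [lia|]. rewrite <- E0, dist_sym.
  assert (k * (i - 0) <= k * (k * k' + k)) by (apply Nat.mul_le_mono_l; nia). lia.
- set (h := N / 2).
  assert (Hh : h <= N /\ h <= 2 ^ m /\ N - h <= 2 ^ m).
  { pose proof (Nat.div_mod N 2). pose proof (Nat.mod_upper_bound N 2).
    fold h in H. simpl in HN. lia. }
  destruct Hh as [Hh1 [Hh2 Hh3]].
  destruct (L_exists (b 0) (b h)) as [M1 [a1 [L1 [S1 T1]]]].
  destruct (L_exists (b h) (b N)) as [M2 [a2 [L2 [S2 T2]]]].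
  destruct (@L_slim M a M1 a1 M2 a2 Ha L1 L2) with (i := i) as [[j [Hj Hd]]|[j [Hj Hd]]];
    try congruence; auto.
  + destruct (IH h b M1 a1) with (i := j) as [l [Hl Hdl]]; auto.
    { intros q Hq; apply Hb; lia. }
    exists l; split; [lia|]. pose proof (dist_tri (a i) (a1 j) (b l)). nia.
  + destruct (IH (N - h) (fun l => b (h + l)) M2 a2) with (i := j) as [l [Hl Hdl]]; auto.
    { intros q Hq. rewrite Nat.add_succ_r. apply Hb; lia. }
    { rewrite Nat.add_0_r; auto. }
    { rewrite T2; f_equal; lia. }
    exists (h + l); split; [lia|]. pose proof (dist_tri (a i) (a2 j) (b (h + l))). nia.
Qed.

(** Let [p] be the point of the guessed path farthest from [b], at distance [D0]. Leaving the path
    on both sides of [p], going down to [b] by geodesics and following [b] gives a detour that never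
    comes closer to [p] than [D0]. Its length is linear in [D0], while [guess_log] makes it
    exponential. *)
Lemma guess_in_nbhd (k' : nat) : exists C, forall N b M a,
  qgeo k' N b -> L M a -> a 0 = b 0 -> a M = b N ->
  forall i, i <= M -> nearp C N b (a i).
Proof.
set (K := k' + 1).
set (C0 := k * (k * K + k)).
set (c1 := 2 + k' * 2 + k' * (k * (2 * (k * 2)))).
set (c2 := k' * (k * (2 * k + 2)) + k').
set (A := c1 + c2).
destruct (below_logarithm_bounded A D C0) as [X HX].
exists X. intros N b M a Hb Ha E0 EN.
set (rho := fun i => least (fun n => exists j, j <= N /\ dist (a i) (b j) = n)).
assert (Hrho : forall i, (exists j, j <= N /\ dist (a i) (b j) = rho i) /\
   forall j, j <= N -> rho i <= dist (a i) (b j)).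
{ intros i. destruct (least_spec (P := fun n => exists j, j <= N /\ dist (a i) (b j) = n)).
  - exists (dist (a i) (b 0)), 0; split; auto; lia.
  - split; [exact H|]. intros; apply H0; eauto. }
destruct (argmax_upto rho M) as [i0 [Hi0 Hmax]].
set (D0 := rho i0) in *.
assert (Hnear : forall i, i <= M -> nearp D0 N b (a i)).
{ intros i Hi. destruct (proj1 (Hrho i)) as [j [Hj E]]. exists j; split; auto.
  rewrite E; apply Hmax; auto. }
intros i Hi. enough (D0 <= X).
{ destruct (Hnear i Hi) as [j [Hj Hd]]. exists j; split; auto; lia. }
apply HX. intros m Hm. clear HX.
destruct (L_qgeo Ha) as [Hs Hq]. destruct Hb as [Hbs Hbq].
(* Points whose index differs from [i0] by more than [s] are at distance at least [2 * D0] from [p];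
   a geodesic of length at most [D0] from such a point stays outside the ball. *)
set (s := k * (2 * D0) + k).
set (p := a i0).
assert (HpN : forall j, j <= N -> D0 <= dist p (b j)) by (intros; apply Hrho; auto).
assert (Hend : forall e, e <= M -> (e = 0 \/ e = M \/ s < i0 - e + (e - i0)) ->
  exists j, j <= N /\ dist (a e) (b j) <= D0 /\
    forall r, btw (a e) r (b j) -> D0 <= dist p r).
{ intros e He [->|[->|Hfar]].
  - exists 0; split; [lia|]. rewrite E0, dist_refl. split; [lia|]. intros r Hr.
    unfold btw in Hr. rewrite dist_refl in Hr. assert (b 0 = r) by (apply dist_eq0; lia).
    subst r; apply HpN; lia.
  - exists N; split; [lia|]. rewrite EN, dist_refl. split; [lia|]. intros r Hr.
    unfold btw in Hr. rewrite dist_refl in Hr. assert (b N = r) by (apply dist_eq0; lia).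
    subst r; apply HpN; lia.
  - destruct (Hnear e He) as [j [Hj Hd]]. exists j; repeat split; auto.
    intros r Hr. unfold btw in Hr.
    assert (2 * D0 <= dist p (a e)).
    { destruct (le_lt_dec i0 e).
      - specialize (Hq i0 e ltac:(lia) ltac:(lia)). fold p in Hq. unfold s in Hfar. nia.
      - specialize (Hq e i0 ltac:(lia) ltac:(lia)). fold p in Hq. rewrite dist_sym in Hq.
        unfold s in Hfar. nia. }
    pose proof (dist_tri p r (a e)). rewrite (dist_sym r) in *. lia. }
set (e1 := i0 - S s). set (e2 := Nat.min (i0 + S s) M).
destruct (Hend e1) as [j1 [Hj1 [Hd1 Hr1]]]; [lia| |].
{ destruct (le_lt_dec i0 (S s)); [left|right; right]; lia. }
destruct (Hend e2) as [j2 [Hj2 [Hd2 Hr2]]]; [lia| |].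
{ destruct (le_lt_dec M (i0 + S s)); [right; left|right; right]; lia. }
assert (P1 : path_in K (dist (a e1) (b j1)) (fun r => D0 <= dist p r) (a e1) (b j1)).
{ apply path_in_geodesic; auto. unfold K; lia. }
assert (P2 : path_in K (dist (a e2) (b j2)) (fun r => D0 <= dist p r) (b j2) (a e2)).
{ apply path_in_rev, path_in_geodesic; auto. unfold K; lia. }
destruct (@path_in_segment K N b (fun r => D0 <= dist p r) j1 j2) as [n [En P3]]; auto.
{ intros q Hqq; specialize (Hbs q Hqq); unfold K; lia. }
pose proof (path_in_app (path_in_app P1 P3) P2) as [w [W0 [Wn [Ws WQ]]]].
assert (Hlen : dist (a e1) (b j1) + n + dist (a e2) (b j2) <= A * D0 + A).
{ pose proof (steps_dist Hs (i := e1) (j := e2) ltac:(lia) ltac:(lia)) as Hae.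
  assert (n <= k' * dist (b j1) (b j2) + k').
  { destruct (le_lt_dec j1 j2).
    - specialize (Hbq j1 j2 ltac:(lia) ltac:(lia)). lia.
    - specialize (Hbq j2 j1 ltac:(lia) ltac:(lia)). rewrite (dist_sym (b j1)). lia. }
  pose proof (dist_tri (b j1) (a e1) (b j2)). pose proof (dist_tri (a e1) (a e2) (b j2)).
  rewrite (dist_sym (b j1) (a e1)) in *.
  assert (e2 - e1 <= 2 * s + 2) by lia.
  assert (k * (e2 - e1) <= k * (2 * s + 2)) by (apply Nat.mul_le_mono_l; lia).
  assert (k' * dist (b j1) (b j2) <= k' * (2 * D0 + k * (2 * s + 2))).
  { apply Nat.mul_le_mono_l; lia. }
  assert (n <= k' * (2 * D0 + k * (2 * s + 2)) + k') by lia.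
  enough (2 * D0 + (k' * (2 * D0 + k * (2 * s + 2)) + k') <= A * D0 + A) by lia.
  replace (2 * D0 + (k' * (2 * D0 + k * (2 * s + 2)) + k')) with (c1 * D0 + c2)
    by (unfold c1, c2, s; ring).
  unfold A; clearbody c1 c2; nia. }
destruct (@guess_log K m _ w (e2 - e1) (fun l => a (e1 + l)) Ws) with (i := i0 - e1)
  as [j [Hj Hd]]; try lia.
- apply (L_sub Ha); lia.
- now rewrite Nat.add_0_r, W0.
- rewrite Wn. f_equal; lia.
- replace (e1 + (i0 - e1)) with i0 in Hd by lia. fold p in Hd.
  specialize (WQ j Hj). fold C0 in Hd. simpl in WQ. lia.
Qed.

(** Connectedness: the last point of the guessed path that is close to the part of [b] up to [q] is
    followed by one close to the part after [q]. Hence [q] lies in a short piece of [b] that begins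
    near the guessed path. *)
Lemma guess_nbhd_of (k' : nat) : exists C, forall N b M a,
  qgeo k' N b -> L M a -> a 0 = b 0 -> a M = b N ->
  forall i, i <= N -> nearp C M a (b i).
Proof.
destruct (guess_in_nbhd k') as [C HC].
set (J := k' * (2 * C + k) + k').
exists (k' * J + C). intros N b M a Hb Ha E0 EN q Hq.
assert (Hnear := fun i Hi => HC N b M a Hb Ha E0 EN i Hi).
destruct (L_qgeo Ha) as [Hs _]. destruct Hb as [Hbs Hbq].
set (P := fun i => exists j, j <= q /\ dist (a i) (b j) <= C).
assert (H : exists i j j', i <= M /\ j <= q /\ q <= j' /\ j' <= N /\
  dist (a i) (b j) <= C /\ dist (b j) (b j') <= 2 * C + k).
{ destruct (classic (P M)) as [[j [Hj Hd]]|HM].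
  - exists M, j, N. repeat split; auto. rewrite <- EN, dist_sym. lia.
  - destruct (@last_before P 0 M) as [i [Hi [[j [Hj Hd]] Hlast]]]; try lia; auto.
    { exists 0. rewrite E0, dist_refl. lia. }
    destruct (Hnear (S i) ltac:(lia)) as [j' [Hj' Hd']].
    destruct (le_lt_dec j' q).
    { exfalso. apply (Hlast (S i)); [lia|]. exists j'; auto. }
    exists i, j, j'. repeat split; auto; try lia.
    specialize (Hs i ltac:(lia)).
    pose proof (dist_tri (b j) (a i) (b j')). pose proof (dist_tri (a i) (a (S i)) (b j')).
    rewrite (dist_sym (b j) (a i)) in *. lia. }
destruct H as [i [j [j' [Hi [Hj [Hqj [Hj' [Hd Hdd]]]]]]]].
exists i; split; auto.
specialize (Hbq j j' ltac:(lia) Hj').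
pose proof (steps_dist Hbs Hj Hq).
assert (k' * dist (b j) (b j') <= k' * (2 * C + k)) by (apply Nat.mul_le_mono_l; auto).
assert (q - j <= J) by (unfold J; lia).
assert (k' * (q - j) <= k' * J) by (apply Nat.mul_le_mono_l; auto).
pose proof (dist_tri (b q) (b j) (a i)) as Ht. rewrite (dist_sym (b q) (b j)) in Ht.
rewrite (dist_sym (b j) (a i)) in Ht. lia.
Qed.

End Guess.

End Graph.

(** * Hyperbolic graphs *)

Section Hyperbolic.

Variable G : graph.
Hypothesis conn : connected G.
Variable d : nat.
Hypothesis hyp : delta_hyperbolic (INR d) G.

Lemma slim_triangle (x y z : G) (a b c : nat -> G) :
  geodesic x y a -> geodesic x z b -> geodesic z y c ->
  forall i, i <= dist x y -> nearp d (dist x z) b (a i) \/ nearp d (dist z y) c (a i).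
Proof.
intros Ha Hb Hc i Hi.
destruct (hyp Ha (geodesic_rev conn Hc) (geodesic_rev conn Hb) (s := a i)) as [t [Ht Hd]].
{ exists i; auto. }
apply INR_le in Hd. destruct Ht as [[j [Hj <-]]|[j [Hj <-]]].
- right. exists (dist z y - j); split; [lia|auto].
- left. exists (dist x z - j); split; [lia|auto].
Qed.

Lemma slim_btw (x y z s : G) : btw x s y ->
  exists t, (btw x t z \/ btw z t y) /\ dist s t <= d.
Proof.
intros Hs. destruct (geodesic_through conn Hs) as [a [Ha E]].
destruct (geodesic_exists conn x z) as [b Hb]. destruct (geodesic_exists conn z y) as [c Hc].
assert (Hi : dist x s <= dist x y) by (unfold btw in Hs; lia).
destruct (slim_triangle Ha Hb Hc Hi) as [[j [Hj Hd]]|[j [Hj Hd]]]; rewrite E in Hd.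
- exists (b j); split; auto. left; apply (geodesic_btw Hb Hj).
- exists (c j); split; auto. right; apply (geodesic_btw Hc Hj).
Qed.

(** A point [y] of [A] halfway between the projections is close to the side from [q] to [z] or from
    [z] to [q']. If [q] and [q'] were far apart, [y] would be nearer to [z] or [z'] than the slack
    of 1 allows. *)
Lemma projection_lipschitz (A : G -> Prop) (z z' q q' : G) :
  dist z z' <= 1 -> (forall y, A y -> dist z q <= dist z y + 1) ->
  (forall y, A y -> dist z' q' <= dist z' y + 1) ->
  (forall i, i <= dist q q' -> exists y, A y /\ btw q y q' /\ dist q y = i) ->
  dist q q' <= 4 * d + 7.
Proof.
intros Hz Hq Hq' HA. set (n := dist q q') in *.
destruct (HA (n / 2)) as [y [Hy [Hb Ey]]].
{ apply Nat.Div0.div_le_upper_bound. lia. }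
assert (Hn : n = 2 * (n / 2) \/ n = 2 * (n / 2) + 1).
{ pose proof (Nat.div_mod n 2). pose proof (Nat.mod_upper_bound n 2). lia. }
specialize (Hq y Hy). specialize (Hq' y Hy).
assert (Hyn : dist y q' = n - n / 2) by (unfold btw in Hb; fold n in Hb; lia).
destruct (slim_btw z Hb) as [t [[Ht|Ht] Hd]]; unfold btw in Ht.
- pose proof (dist_tri conn z t y). pose proof (dist_tri conn q t y).
  rewrite (dist_sym conn t y), (dist_sym conn q z), (dist_sym conn t z) in *. lia.
- pose proof (dist_tri conn z t y). pose proof (dist_tri conn y t q').
  pose proof (dist_tri conn z z' q'). pose proof (dist_tri conn z' z y).
  rewrite (dist_sym conn t y), (dist_sym conn z' z) in *. lia.
Qed.

(** A point more than [2 * d] before [c h] cannot be [d]-close to the side from [z] to [c h], else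
    it would be nearer to [z] than [c h]; so it is close to the side [b]. The remaining points are
    moved back by [2 * d + 1] steps, or to [x]. *)
Lemma slim_side (x y z : G) (c b : nat -> G) (h : nat) :
  geodesic x y c -> geodesic x z b -> h <= dist x y ->
  (forall i, i <= dist x y -> dist z (c h) <= dist z (c i)) ->
  forall i, i <= h -> nearp (3 * d + 1) (dist x z) b (c i).
Proof.
intros Hc Hb Hh Hn i Hi.
assert (Hfar : forall i, i + 2 * d < h -> nearp d (dist x z) b (c i)).
{ intros j Hj. destruct (geodesic_exists conn z (c h)) as [e He].
  pose proof Hc as [C0 [_ Hcd]].
  assert (Hs : geodesic x (c h) c).
  { pose proof (geodesic_sub Hc (Nat.le_0_l h) Hh) as Hs. rewrite C0 in Hs. exact Hs. }
  assert (Exh : dist x (c h) = h) by (rewrite <- C0, Hcd; lia).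
  destruct (slim_triangle Hs Hb He (i := j)) as [|[l [Hl Hd]]]; auto; [lia|].
  exfalso. destruct (geodesic_btw He Hl) as [_ Hbt]. unfold btw in Hbt.
  specialize (Hn j ltac:(lia)). pose proof (dist_tri conn z (e l) (c j)).
  pose proof (dist_tri conn (c j) (e l) (c h)). rewrite (dist_sym conn (e l) (c j)) in *.
  rewrite Hcd in *; lia. }
destruct (le_lt_dec (2 * d + 1) i) as [Hi2|Hi2].
- destruct (Hfar (i - (2 * d + 1)) ltac:(lia)) as [l [Hl Hd]]. exists l. split; auto.
  pose proof Hc as [_ [_ Hcd]].
  pose proof (dist_tri conn (c i) (c (i - (2 * d + 1))) (b l)) as Ht.
  rewrite (dist_sym conn (c i) (c (i - (2 * d + 1)))), Hcd in Ht; lia.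
- exists 0. split; [lia|]. pose proof Hc as [C0 [_ Hcd]]. pose proof Hb as [B0 _].
  rewrite B0, <- C0, (dist_sym conn), Hcd; lia.
Qed.

Lemma slim_flap (x y q : G) (c b : nat -> G) (h r : nat) :
  geodesic x y c -> geodesic x q b -> h <= dist x y -> dist q (c h) <= r ->
  forall i, i <= h -> nearp (d + r) (dist x q) b (c i).
Proof.
intros Hc Hb Hh Hr i Hi. destruct (geodesic_exists conn q (c h)) as [e He].
pose proof Hc as [C0 [_ Hcd]].
assert (Hs : geodesic x (c h) c).
{ pose proof (geodesic_sub Hc (Nat.le_0_l h) Hh) as Hs. rewrite C0 in Hs. exact Hs. }
assert (Exh : dist x (c h) = h) by (rewrite <- C0, Hcd; lia).
destruct (slim_triangle Hs Hb He (i := i)) as [[l [Hl Hd]]|[l [Hl Hd]]]; [lia| |].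
- exists l; split; auto; lia.
- exists (dist x q). split; auto. pose proof Hb as [_ [Bq _]]. rewrite Bq.
  destruct (geodesic_btw He Hl) as [E1 _].
  pose proof (dist_tri conn (c i) (e l) q). rewrite (dist_sym conn (e l) q) in *. lia.
Qed.

Lemma nearp_reverse C N (a : nat -> G) z : nearp C N (fun l => a (N - l)) z -> nearp C N a z.
Proof. intros [l [Hl Hd]]. exists (N - l); split; [lia|auto]. Qed.

Lemma nearp_mono C C' N (a : nat -> G) z : C <= C' -> nearp C N a z -> nearp C' N a z.
Proof. intros HC [l [Hl Hd]]. exists l; split; auto; lia. Qed.

(** The center is the projection of [z] to the side [c1], since [fiberwise_retraction] controls such
    projections. It is [3 * d + 1]-close to both other sides by [slim_side]; hence [c2 h2] and
    [c3 h3] are [6 * d + 2] apart, and a triangle with that short side gives [7 * d + 2]. The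
    initial part of each side follows the preceding side. *)
Lemma triangle_center (x y z : G) (c1 c2 c3 : nat -> G) (h1 : nat) :
  geodesic x y c1 -> geodesic y z c2 -> geodesic z x c3 -> h1 <= dist x y ->
  (forall i, i <= dist x y -> dist z (c1 h1) <= dist z (c1 i)) ->
  exists h2 h3, h2 <= dist y z /\ h3 <= dist z x /\
    dist (c1 h1) (c2 h2) <= 7 * d + 2 /\ dist (c1 h1) (c3 h3) <= 7 * d + 2 /\
    (forall i, i <= h1 -> nearp (7 * d + 2) (dist z x) c3 (c1 i)) /\
    (forall i, i <= h2 -> nearp (7 * d + 2) (dist x y) c1 (c2 i)) /\
    (forall i, i <= h3 -> nearp (7 * d + 2) (dist y z) c2 (c3 i)).
Proof.
intros H1 H2 H3 Hh Hn.
assert (N3 : forall i, i <= h1 -> nearp (3 * d + 1) (dist z x) c3 (c1 i)).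
{ intros i Hi. pose proof (slim_side H1 (geodesic_rev conn H3) Hh Hn Hi) as H.
  rewrite (dist_sym conn x z) in H. apply nearp_reverse; auto. }
destruct (N3 h1 (le_n _)) as [h3 [Hh3 D3]].
pose proof (geodesic_rev conn H1) as R1.
destruct (@slim_side y x z (fun l => c1 (dist x y - l)) c2 (dist x y - h1)) with (i := dist x y - h1)
  as [h2 [Hh2 D2]]; auto.
{ rewrite (dist_sym conn y x); lia. }
{ intros i Hi. replace (dist x y - (dist x y - h1)) with h1 by lia. apply Hn.
  rewrite (dist_sym conn y x) in Hi; lia. }
replace (dist x y - (dist x y - h1)) with h1 in D2 by lia.
exists h2, h3. repeat split; auto; try lia.
- intros i Hi. apply nearp_mono with (C := 3 * d + 1); auto. lia.
- intros i Hi. pose proof (geodesic_sub R1 (i := 0) (j := dist x y - h1) ltac:(lia)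
    ltac:(rewrite (dist_sym conn y x); lia)) as Hs. simpl in Hs.
  rewrite Nat.sub_0_r in Hs. replace (dist x y - (dist x y - h1)) with h1 in Hs by lia.
  destruct H1 as [_ [E1 _]]. rewrite E1 in Hs.
  destruct (slim_flap H2 Hs Hh2 D2 Hi) as [l [Hl Hd]].
  exists (dist x y - l). split; [lia|]. lia.
- intros i Hi. pose proof (geodesic_rev conn H2) as R2.
  pose proof (geodesic_sub R2 (i := 0) (j := dist y z - h2) ltac:(lia)
    ltac:(rewrite (dist_sym conn z y); lia)) as Hs. simpl in Hs.
  rewrite Nat.sub_0_r in Hs. replace (dist y z - (dist y z - h2)) with h2 in Hs by lia.
  destruct H2 as [_ [E2 _]]. rewrite E2 in Hs.
  assert (D : dist (c2 h2) (c3 h3) <= 6 * d + 2).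
  { pose proof (dist_tri conn (c2 h2) (c1 h1) (c3 h3)).
    rewrite (dist_sym conn (c2 h2) (c1 h1)) in *. lia. }
  destruct (slim_flap H3 Hs Hh3 D Hi) as [l [Hl Hd]].
  exists (dist y z - l). split; [lia|]. lia.
Qed.

Lemma geodesic_qgeo (x y : G) c : geodesic x y c -> qgeo 1 (dist x y) c.
Proof.
intros [_ [_ H]]. split.
- intros i Hi. rewrite H; lia.
- intros i j Hi Hj. rewrite H; lia.
Qed.

Definition geodesic_path (N : nat) (a : nat -> G) : Prop :=
  N = dist (a 0) (a N) /\ geodesic (a 0) (a N) a.

Lemma geodesic_path_of (x y : G) a : geodesic x y a -> geodesic_path (dist x y) a.
Proof.
intros H. pose proof H as [H0 [Hn _]]. unfold geodesic_path. rewrite H0, Hn; auto.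
Qed.

(** Stability of quasi-geodesics is the criterion for guessed geodesics applied to the geodesics
    themselves. *)
Lemma morse (k : nat) : exists C, forall N (b : nat -> G), qgeo k N b ->
  (forall t, btw (b 0) t (b N) -> nearp C N b t) /\
  (forall i, i <= N -> exists t, btw (b 0) t (b N) /\ dist (b i) t <= C).
Proof.
assert (Lq : forall N a, geodesic_path N a -> qgeo 1 N a).
{ intros N a [HN Ha]. apply geodesic_qgeo in Ha. rewrite <- HN in Ha. exact Ha. }
assert (Lsub : forall N a i j, geodesic_path N a -> i <= j -> j <= N ->
  geodesic_path (j - i) (fun l => a (i + l))).
{ intros N a i j [HN Hg] Hij Hj. rewrite HN in Hj.
  pose proof Hg as [_ [_ H]]. specialize (H i j Hij Hj). rewrite <- H.
  apply geodesic_path_of, (geodesic_sub Hg); auto. }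
assert (Lex : forall x y, exists N a, geodesic_path N a /\ a 0 = x /\ a N = y).
{ intros x y. destruct (geodesic_exists conn x y) as [c Hc].
  exists (dist x y), c. pose proof Hc as [H0 [Hn _]]. split; auto.
  apply (geodesic_path_of Hc). }
assert (Lslim : forall N a M b P c, geodesic_path N a -> geodesic_path M b ->
  geodesic_path P c -> a 0 = b 0 -> b M = c 0 -> c P = a N ->
  forall i, i <= N -> nearp d M b (a i) \/ nearp d P c (a i)).
{ intros N a M b P c [HN Ha] [HM Hb] [HP Hc] E1 E2 E3 i Hi.
  rewrite HM, HP. rewrite E1 in *. rewrite <- E2, E3 in *. rewrite HN in Hi.
  apply (slim_triangle Ha Hb Hc Hi). }
destruct (guess_in_nbhd conn Lq Lsub Lex Lslim k) as [C1 H1].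
destruct (guess_nbhd_of conn Lq Lsub Lex Lslim k) as [C2 H2].
exists (C1 + C2). intros N b Hb. split.
- intros t Ht. destruct (geodesic_through conn Ht) as [a [Ha E]].
  pose proof Ha as [A0 [An _]].
  destruct (H1 N b _ a Hb (geodesic_path_of Ha) A0 An (dist (b 0) t)) as [j [Hj Hd]].
  { unfold btw in Ht; lia. }
  rewrite E in Hd. exists j; split; [auto|lia].
- intros i Hi. destruct (geodesic_exists conn (b 0) (b N)) as [a Ha].
  pose proof Ha as [A0 [An _]].
  destruct (H2 N b _ a Hb (geodesic_path_of Ha) A0 An i Hi) as [j [Hj Hd]].
  exists (a j). split; [apply (geodesic_btw Ha Hj)|lia].
Qed.

(** The index [Nat.min (i - 1) N] visits each end of [b] twice, which leaves the indices [0] and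
    [N + 2] free for prescribed nearby endpoints, as in [extend]. *)
Lemma qgeo_shadow (k r N : nat) (b a : nat -> G) : qgeo k N b ->
  (forall i, i <= N + 2 -> dist (a i) (b (Nat.min (i - 1) N)) <= r) ->
  qgeo (k + 2 * k * r + 2 + 2 * r) (N + 2) a.
Proof.
intros [Hs Hq] H. split.
- intros i Hi. pose proof (H i ltac:(lia)). pose proof (H (S i) ltac:(lia)).
  pose proof (steps_dist conn Hs (i := Nat.min (i - 1) N) (j := Nat.min (S i - 1) N)
    ltac:(lia) ltac:(lia)) as H2.
  assert (k * (Nat.min (S i - 1) N - Nat.min (i - 1) N) <= k * 1).
  { apply Nat.mul_le_mono_l; lia. }
  set (u := b (Nat.min (i - 1) N)) in *. set (v := b (Nat.min (S i - 1) N)) in *.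
  pose proof (dist_tri conn (a i) u (a (S i))). pose proof (dist_tri conn u v (a (S i))).
  rewrite (dist_sym conn (a (S i)) v) in *. lia.
- intros i j Hi Hj. pose proof (H i ltac:(lia)). pose proof (H j ltac:(lia)).
  specialize (Hq (Nat.min (i - 1) N) (Nat.min (j - 1) N) ltac:(lia) ltac:(lia)).
  set (u := b (Nat.min (i - 1) N)) in *. set (v := b (Nat.min (j - 1) N)) in *.
  pose proof (dist_tri conn u (a i) v). pose proof (dist_tri conn (a i) (a j) v).
  rewrite (dist_sym conn u (a i)) in *.
  assert (k * dist u v <= k * (dist (a i) (a j) + 2 * r)) by (apply Nat.mul_le_mono_l; lia).
  nia.
Qed.

Definition extend (N : nat) (x y : G) (b : nat -> G) (i : nat) : G :=
  match i with 0 => x | S j => if le_lt_dec j N then b j else y end.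

Lemma extend_mid (N : nat) (x y : G) b j : j <= N -> extend N x y b (S j) = b j.
Proof. intros; unfold extend; destruct (le_lt_dec j N); [auto|lia]. Qed.

Lemma extend_end (N : nat) (x y : G) b : extend N x y b (N + 2) = y.
Proof.
replace (N + 2) with (S (S N)) by lia; unfold extend.
destruct (le_lt_dec (S N) N); [lia|auto].
Qed.

Lemma extend_shadow_of (N r : nat) (x y : G) b b' :
  (forall i, i <= N -> dist (b' i) (b i) <= r) -> dist x (b 0) <= r -> dist (b N) y <= r ->
  forall i, i <= N + 2 -> dist (extend N x y b' i) (b (Nat.min (i - 1) N)) <= r.
Proof.
intros Hb Hx Hy [|i] Hi; [auto|]. replace (S i - 1) with i by lia.
unfold extend; destruct (le_lt_dec i N).
- rewrite Nat.min_l; auto.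
- rewrite Nat.min_r, (dist_sym conn); [auto|lia].
Qed.

Lemma extend_shadow (N r : nat) (x y : G) b : dist x (b 0) <= r -> dist (b N) y <= r ->
  forall i, i <= N + 2 -> dist (extend N x y b i) (b (Nat.min (i - 1) N)) <= r.
Proof.
intros Hx Hy. apply extend_shadow_of; auto. intros; rewrite (dist_refl conn); lia.
Qed.

Lemma morse_ends (k r : nat) : exists C, forall N b (x y : G), qgeo k N b ->
  dist x (b 0) <= r -> dist (b N) y <= r ->
  (forall t, btw x t y -> nearp C N b t) /\
  (forall i, i <= N -> exists t, btw x t y /\ dist (b i) t <= C).
Proof.
destruct (morse (k + 2 * k * r + 2 + 2 * r)) as [C HC].
exists (C + r). intros N b x y Hb Hx Hy.
destruct (HC _ _ (qgeo_shadow Hb (extend_shadow Hx Hy))) as [H1 H2].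
rewrite extend_end in *. change (extend N x y b 0) with x in *. split.
- intros t Ht. destruct (H1 t Ht) as [i [Hi Hd]].
  exists (Nat.min (i - 1) N); split; [lia|].
  pose proof (extend_shadow Hx Hy Hi).
  pose proof (dist_tri conn t (extend N x y b i) (b (Nat.min (i - 1) N))). lia.
- intros i Hi. destruct (H2 (S i) ltac:(lia)) as [t [Ht Hd]].
  rewrite extend_mid in Hd by auto. exists t; split; [auto|lia].
Qed.

End Hyperbolic.

(** * Flaring of tight sections *)

Section Bundle.

Variables (E B : graph) (p : E -> B).
Hypothesis bun : graph_bundle p.
Let connE : connected E := bundle_total_connected bun.
Let connB : connected B := bundle_base_connected bun.
Let connF (v : B) : connected (fiber p v) := bundle_fiber_connected bun (v:=v).

Lemma proj_lipschitz (x y : E) : dist (p x) (p y) <= dist x y.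
Proof.
assert (H : forall n (x y : E), walk n x y -> dist (p x) (p y) <= n).
{ induction 1 as [x'|n x' y' z' Ha W IH]; [now rewrite (dist_refl connB)|].
  pose proof (dist_tri connB (p x') (p y') (p z')).
  destruct (bundle_simplicial bun Ha) as [Eq|Hadj].
  - rewrite Eq in *. lia.
  - pose proof (dist_adj connB Hadj). lia. }
apply H, dist_walk, connE.
Qed.

Lemma fiber_dist (v : B) (x y : fiber p v) :
  dist (in_total x) (in_total y) <= dist x y.
Proof.
assert (H : forall n (x y : fiber p v), walk n x y -> walk n (in_total x) (in_total y)).
{ induction 1; [constructor|econstructor; [|eauto]]. exact H. }
apply (dist_le_walk connE), H, dist_walk, connF.
Qed.

Lemma sec_dist (T : bundle_section p) (u v : B) : dist (T u) (T v) = dist u v.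
Proof.
apply Nat.le_antisymm.
- assert (H : forall n (x y : B), walk n x y -> walk n (T x) (T y)).
  { induction 1; [constructor|econstructor; [|eauto]]. now apply sec_adj. }
  apply (dist_le_walk connE), H, dist_walk, connB.
- pose proof (proj_lipschitz (T u) (T v)). now rewrite !sec_proj in H.
Qed.

(** The distance is that of the total space; the distance in the fiber can be much larger. *)
Definition gap (T1 T2 : bundle_section p) (u : B) : nat := dist (T1 u) (T2 u).

Lemma gap_sym T1 T2 u : gap T1 T2 u = gap T2 T1 u.
Proof. apply (dist_sym connE). Qed.

Lemma gap_self T u : gap T T u = 0.
Proof. apply (dist_refl connE). Qed.

Lemma gap_tri T1 T2 T3 u : gap T1 T3 u <= gap T1 T2 u + gap T2 T3 u.
Proof. apply (dist_tri connE). Qed.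

Lemma gap_lipschitz T1 T2 u v : gap T1 T2 u <= gap T1 T2 v + 2 * dist u v.
Proof.
unfold gap. pose proof (dist_tri connE (T1 u) (T1 v) (T2 u)).
pose proof (dist_tri connE (T1 v) (T2 v) (T2 u)).
rewrite !sec_dist, (dist_sym connB v u) in *. lia.
Qed.

Lemma sec_close (T1 T2 : bundle_section p) u v n : dist (T1 u) (T2 v) <= n ->
  dist u v <= n /\ gap T1 T2 u <= 2 * n.
Proof.
intros H. pose proof (proj_lipschitz (T1 u) (T2 v)) as H1. rewrite !sec_proj in H1.
split; [lia|]. unfold gap. pose proof (dist_tri connE (T1 u) (T2 v) (T2 u)).
rewrite sec_dist, (dist_sym connB v u) in *. lia.
Qed.

Variable tight : bundle_section p -> Prop.
Variable d : nat.
Hypothesis hypB : delta_hyperbolic (INR d) B.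
Hypothesis hypF : forall v, delta_hyperbolic (INR d) (fiber p v).
Hypothesis full : full_sections tight.
Hypothesis robust : robust_sections tight.
Variable kap : nat.
Hypothesis retraction : forall (v v' : B) (x y z : fiber p v) (x' y' z' : fiber p v'),
  adj (in_total x) (in_total x') -> adj (in_total y) (in_total y') ->
  adj (in_total z) (in_total z') ->
  forall c c', geodesic x y c -> geodesic x' y' c' ->
  forall q q', closest_point_projection (on_geodesic x y c) z q ->
    closest_point_projection (on_geodesic x' y' c') z' q' ->
    dist (in_total q) (in_total q') <= kap.
Variable s0 : nat.
(** Flaring with the function [lambda] eliminated: as it tends to infinity, a bound [M] on the gap
    at the far end bounds the length. *)
Hypothesis flare : forall D M, exists T, forall T1 T2, tight T1 -> tight T2 ->
  forall u v c, geodesic u v c -> gap T1 T2 v <= D ->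
  (forall i, i < dist u v -> s0 <= gap T1 T2 (c i)) ->
  gap T1 T2 u <= M -> dist u v <= T.

Lemma flare_index (D M : nat) : exists T, forall T1 T2, tight T1 -> tight T2 ->
  forall x y c, geodesic x y c -> forall i j, i <= j -> j <= dist x y ->
  (gap T1 T2 (c i) <= D -> gap T1 T2 (c j) <= M ->
   (forall l, i < l <= j -> s0 <= gap T1 T2 (c l)) -> j - i <= T) /\
  (gap T1 T2 (c j) <= D -> gap T1 T2 (c i) <= M ->
   (forall l, i <= l < j -> s0 <= gap T1 T2 (c l)) -> j - i <= T).
Proof.
destruct (flare D M) as [T HT]. exists T. intros T1 T2 HS1 HS2 x y c Hc i j Hij Hj.
pose proof (geodesic_sub Hc Hij Hj) as Hs.
assert (Ed : dist (c i) (c j) = j - i) by (apply Hc; auto).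
split; intros Hi Hm Hl.
- pose proof (geodesic_rev connB Hs) as Hr. rewrite Ed in Hr.
  rewrite <- Ed, (dist_sym connB).
  apply (HT T1 T2 HS1 HS2 _ _ _ Hr); auto.
  intros l. rewrite (dist_sym connB), Ed. intros. apply Hl. lia.
- rewrite <- Ed. apply (HT T1 T2 HS1 HS2 _ _ _ Hs); auto.
  rewrite Ed. intros l Hll. apply Hl. lia.
Qed.

(* The margin [L1] at the end where the gap is at most [D1] does not depend on [D2]: this
   is why nearest point projections contract. *)
Lemma flare_middle : exists s, s0 <= s /\ forall D1, exists L1, forall D2, exists L2,
  forall T1 T2 v v' w, tight T1 -> tight T2 -> btw v w v' ->
  gap T1 T2 v <= D1 -> gap T1 T2 v' <= D2 -> L1 <= dist w v -> L2 <= dist w v' ->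
  gap T1 T2 w <= s.
Proof.
destruct (flare_index s0 (s0 + 2)) as [T HT].
exists (s0 + 2 + 2 * T). split; [lia|]. intros D1.
destruct (flare_index D1 (s0 + 2)) as [U1 HU1]. exists (S U1). intros D2.
destruct (flare_index D2 (s0 + 2)) as [U2 HU2]. destruct (flare_index D1 D2) as [U3 HU3].
exists (S (U2 + U3)).
intros T1 T2 v v' w HS1 HS2 Hw Hv Hv' Hd1 Hd2.
destruct (geodesic_through connB Hw) as [c [Hc Ew]]. pose proof Hc as [C0 [Cn Cd]].
set (n := dist v v') in *. set (k := dist v w) in *.
assert (Hk : k <= n) by (unfold btw in Hw; lia).
rewrite (dist_sym connB w v) in Hd1. fold k in Hd1.
assert (Hk2 : dist w v' = n - k) by (unfold btw in Hw; lia). rewrite Hk2 in Hd2.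
set (P := fun i => gap T1 T2 (c i) < s0).
assert (step : forall i j, i <= j -> j <= n ->
  gap T1 T2 (c i) <= gap T1 T2 (c j) + 2 * (j - i) /\
  gap T1 T2 (c j) <= gap T1 T2 (c i) + 2 * (j - i)).
{ intros i j Hi Hj. pose proof (gap_lipschitz T1 T2 (c i) (c j)).
  pose proof (gap_lipschitz T1 T2 (c j) (c i)). rewrite (dist_sym connB (c j)) in *.
  rewrite (Cd i j Hi Hj) in *. lia. }
rewrite <- Ew.
destruct (classic (P k)) as [Hpk|Hpk]; [unfold P in Hpk; lia|].
(* Let [l] and [r] be the nearest indices on either side of [k] where the gap is below [s0]. If both
   exist, flaring bounds [r - l] and hence the gap at [k]. If one is missing, flaring applies up to
   that end of the geodesic, and [L1] or [L2] is too large for that. *)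
assert (HL : (exists l, l < k /\ P l /\ forall j, l < j <= k -> ~ P j) \/
             (forall j, j <= k -> ~ P j)).
{ destruct (classic (exists l, l <= k /\ P l)) as [[l [Hl Pl]]|Hn].
  - left. destruct (last_before Hl Pl Hpk) as [i [? [? ?]]]. exists i; repeat split; auto; lia.
  - right. intros j Hj Pj; eauto. }
assert (HR : (exists r, k < r <= n /\ P r /\ forall j, k <= j < r -> ~ P j) \/
             (forall j, k <= j <= n -> ~ P j)).
{ destruct (classic (exists r, k <= r <= n /\ P r)) as [[r [Hr Pr]]|Hn].
  - left. destruct (first_after (proj1 Hr) Hpk Pr) as [i [? [? ?]]].
    exists i; repeat split; auto; lia.
  - right. intros j Hj Pj; eauto. }
unfold P in *.
destruct HL as [[l [Hl [Pl Nl]]]|Nl]; destruct HR as [[r [Hr [Pr Nr]]]|Nr].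
- destruct (HT T1 T2 HS1 HS2 v v' c Hc l (r - 1) ltac:(lia) ltac:(fold n; lia)) as [H _].
  pose proof (step (r - 1) r ltac:(lia) ltac:(lia)). pose proof (step l k ltac:(lia) ltac:(lia)).
  enough (r - 1 - l <= T) by lia. apply H; try lia.
  intros j Hj. destruct (le_lt_dec j k); [specialize (Nl j)|specialize (Nr j)]; lia.
- exfalso.
  destruct (HU2 T1 T2 HS1 HS2 v v' c Hc (l + 1) n ltac:(lia) ltac:(fold n; lia)) as [_ H].
  pose proof (step l (l + 1) ltac:(lia) ltac:(lia)).
  enough (n - (l + 1) <= U2) by lia. apply H; try lia; [rewrite Cn; lia|].
  intros j Hj. destruct (le_lt_dec j k); [specialize (Nl j)|specialize (Nr j)]; lia.
- exfalso.
  destruct (HU1 T1 T2 HS1 HS2 v v' c Hc 0 (r - 1) ltac:(lia) ltac:(fold n; lia)) as [H _].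
  pose proof (step (r - 1) r ltac:(lia) ltac:(lia)).
  enough (r - 1 - 0 <= U1) by lia. apply H; try lia; [rewrite C0; lia|].
  intros j Hj. destruct (le_lt_dec j k); [specialize (Nl j)|specialize (Nr j)]; lia.
- exfalso.
  destruct (HU3 T1 T2 HS1 HS2 v v' c Hc 0 n ltac:(lia) ltac:(fold n; lia)) as [H _].
  enough (n - 0 <= U3) by lia. apply H; [rewrite C0; lia|rewrite Cn; lia|].
  intros j Hj. destruct (le_lt_dec j k); [specialize (Nl j)|specialize (Nr j)]; lia.
Qed.

Variable s : nat.
Hypothesis s0_le : s0 <= s.
Hypothesis flare_mid : forall D1, exists L1, forall D2, exists L2,
  forall T1 T2 v v' w, tight T1 -> tight T2 -> btw v w v' ->
  gap T1 T2 v <= D1 -> gap T1 T2 v' <= D2 -> L1 <= dist w v -> L2 <= dist w v' ->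
  gap T1 T2 w <= s.

(** In the middle of the geodesic the gap is at most [s]; near its ends it is bounded because gaps
    are 2-Lipschitz. *)
Lemma flare_quasiconvex (D : nat) : exists D', forall T1 T2 v v' w, tight T1 -> tight T2 ->
  btw v w v' -> gap T1 T2 v <= D -> gap T1 T2 v' <= D -> gap T1 T2 w <= D'.
Proof.
destruct (flare_mid D) as [L1 H]. destruct (H D) as [L2 H2].
exists (s + D + 2 * L1 + 2 * L2). intros T1 T2 v v' w HS1 HS2 Hw Hv Hv'.
destruct (le_lt_dec L1 (dist w v)).
- destruct (le_lt_dec L2 (dist w v')).
  + enough (gap T1 T2 w <= s) by lia. apply (H2 T1 T2 v v' w); auto.
  + pose proof (gap_lipschitz T1 T2 w v'). lia.
- pose proof (gap_lipschitz T1 T2 w v). lia.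
Qed.

(** Two sections that are nowhere close flare along every geodesic of the base, so the places where
    they are moderately close form a bounded set. *)
Lemma flare_far (D : nat) : exists L, forall T1 T2, tight T1 -> tight T2 ->
  (forall u, s0 <= gap T1 T2 u) ->
  forall u v, gap T1 T2 u <= D -> gap T1 T2 v <= D -> dist u v <= L.
Proof.
destruct (flare D D) as [T HT]. exists T. intros T1 T2 HS1 HS2 Hf u v Hu Hv.
destruct (geodesic_exists connB u v) as [c Hc]. apply (HT T1 T2 HS1 HS2 u v c Hc); auto.
Qed.

(** A nearest point of the region where the sections are [D]-close; a relation, because nearest
    points are not unique. *)
Definition foot (D : nat) (T1 T2 : bundle_section p) (a u : B) : Prop :=
  gap T1 T2 u <= D /\ forall v, gap T1 T2 v <= D -> dist a u <= dist a v.

Lemma foot_exists D T1 T2 a : (exists u, gap T1 T2 u <= D) -> exists u, foot D T1 T2 a u.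
Proof. intros H. destruct (nearest_exists a H) as [u [Hu Hn]]. exists u; split; auto. Qed.

Lemma foot_sym D T1 T2 a u : foot D T1 T2 a u -> foot D T2 T1 a u.
Proof.
intros [H1 H2]. split; [now rewrite gap_sym|]. intros v Hv. apply H2. now rewrite gap_sym.
Qed.

(** Before reaching the foot a geodesic stays outside the region of [D]-closeness, so flaring
    applies along all of it. *)
Lemma foot_gap_bound (D n : nat) : s <= D -> exists C, forall T1 T2 a u, tight T1 -> tight T2 ->
  foot D T1 T2 a u -> gap T1 T2 a <= n -> dist a u <= C.
Proof.
intros HD. destruct (flare D n) as [T HT]. exists T. intros T1 T2 a u HS1 HS2 [Hu Hm] Hn.
destruct (geodesic_exists connB a u) as [c Hc]. apply (HT T1 T2 HS1 HS2 a u c Hc); auto.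
intros i Hi. destruct (le_lt_dec s0 (gap T1 T2 (c i))); auto. exfalso.
specialize (Hm (c i) ltac:(lia)).
destruct (geodesic_btw Hc (i := i)); lia.
Qed.

(** If [v] is far from [u], the point [x] at distance [L] from [u] towards [v] is again in the
    region of [D]-closeness, even when [D2] exceeds [D]. It cannot be near the side from [a] to [u],
    for it would be nearer to [a] than the foot. *)
Lemma foot_near_geodesic (D D2 : nat) : s <= D -> exists C, forall T1 T2 a u v, tight T1 -> tight T2 ->
  foot D T1 T2 a u -> gap T1 T2 v <= D2 -> exists t, btw a t v /\ dist t u <= C.
Proof.
intros HD. destruct (flare_mid D) as [L1 H]. destruct (H D2) as [L2 H2]. clear H.
set (L := Nat.max L1 (2 * d + 1)). exists (L + L2 + d).
intros T1 T2 a u v HS1 HS2 [Hu Hm] Hv.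
destruct (le_lt_dec (L + L2) (dist u v)) as [Hl|Hl].
- destruct (@btw_at B connB u v L ltac:(lia)) as [x [Hx Ex]].
  assert (Hxs : gap T1 T2 x <= D).
  { specialize (H2 T1 T2 u v x HS1 HS2 Hx Hu Hv). unfold btw in Hx.
    rewrite (dist_sym connB x u) in H2. lia. }
  destruct (slim_btw connB hypB a Hx) as [t [[Ht|Ht] Hd]].
  + exfalso. specialize (Hm x Hxs). pose proof (dist_tri connB a t x).
    pose proof (dist_tri connB u t x). unfold btw in Ht.
    rewrite (dist_sym connB t x), (dist_sym connB a t), (dist_sym connB a u) in *. lia.
  + exists t; split; auto. pose proof (dist_tri connB t x u).
    rewrite (dist_sym connB t x), (dist_sym connB x u) in *. lia.
- exists v; split; [apply (btw_right connB)|]. rewrite (dist_sym connB); lia.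
Qed.

Variable K : nat.

(* [C] is chosen before [n]. On the way from [a] to [v], a point near [u] is far from [a],
   hence [Tx] and [Ty] are close there; if [v] were much further, [T] and [Ty] would
   already be close before [v]. *)
Lemma foot_contraction (D : nat) : s <= D -> exists C, forall n, exists R,
  forall T Tx Ty a a' u v, tight T -> tight Tx -> tight Ty ->
  (forall w, gap T Tx w <= K * gap T Ty w + K) ->
  dist a a' <= n -> gap Tx Ty a <= n -> R <= gap T Tx a ->
  foot D T Tx a u -> foot D T Ty a' v -> dist u v <= C.
Proof.
intros HD. set (D2 := K * D + K).
destruct (foot_near_geodesic D2 HD) as [C1 HC1].
set (D4 := D2 + D). destruct (flare_mid D4) as [L1 HL1].
set (D6 := s + (D + 2 * C1)). destruct (flare_mid D6) as [L3 HL3].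
destruct (HL3 D) as [L4 HL4]. clear HL3. set (M := Nat.max L4 (2 * d + 1)).
exists (C1 + L1 + L3 + M). intros n. destruct (HL1 n) as [L2 HL2]. clear HL1.
(* Gaps change at most twice as fast as the base point, so this threshold puts [t] farther than
   [L2 + n + d] from [a]: flaring can be used at [t], and the short side from [a] to [a'] does not
   come near [w]. *)
exists (D + 2 * (L2 + C1 + n + d + 1)).
intros T Tx Ty a a' u v HS HSx HSy Hb Ha Hxy HR Hu Hv.
destruct (le_lt_dec (dist u v) (C1 + L1 + L3 + M)) as [|Hlt]; auto. exfalso.
pose proof (proj1 Hv) as Hvy.
assert (Hvx : gap T Tx v <= D2) by (specialize (Hb v); unfold D2; nia).
destruct (HC1 T Tx a u v HS HSx Hu Hvx) as [t [Ht Htu]].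
pose proof (gap_lipschitz T Tx a u) as Hau. pose proof (proj1 Hu) as Hu0.
pose proof (dist_tri connB a t u) as A1. pose proof (dist_tri connB u t v) as A2.
rewrite (dist_sym connB u t) in A2.
assert (Htxy : gap Tx Ty t <= s).
{ apply (HL2 Tx Ty v a t); auto.
  - now apply (btw_sym connB).
  - pose proof (gap_tri Tx T Ty v) as H. rewrite (gap_sym Tx T) in H. unfold D4; lia.
  - lia.
  - rewrite (dist_sym connB t a). lia. }
assert (Hty : gap T Ty t <= D6).
{ pose proof (gap_tri T Tx Ty t). pose proof (gap_lipschitz T Tx t u). unfold D6; lia. }
destruct (@btw_at B connB v t M) as [w [Hw Ew]].
{ rewrite (dist_sym connB v t); lia. }
apply (btw_sym connB) in Hw.
assert (Hwy : gap T Ty w <= D).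
{ enough (gap T Ty w <= s) by lia. apply (HL4 T Ty t v w); auto.
  - unfold btw in Hw. rewrite (dist_sym connB v w) in Ew.
    rewrite (dist_sym connB w t). lia.
  - rewrite (dist_sym connB w v); lia. }
assert (Hwa : btw a w v /\ btw a t w).
{ unfold btw in *. pose proof (dist_tri connB a w v). pose proof (dist_tri connB a t w). lia. }
destruct Hwa as [Hwa Htw].
destruct (slim_btw connB hypB a' Hwa) as [r [[Hr|Hr] Hd]].
- pose proof (dist_tri connB a r w). rewrite (dist_sym connB r w) in *.
  unfold btw in *. lia.
- pose proof (proj2 Hv w Hwy). pose proof (dist_tri connB a' r w).
  pose proof (dist_tri connB w r v). rewrite (dist_sym connB r w) in *.
  rewrite (dist_sym connB v w) in *. unfold btw in *. lia.
Qed.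

(** If the feet were far apart, the middle of the geodesic joining them would be close to the
    geodesic from [a] to [v0], where [T1] and [T2] are [M]-close. Then [T] and [T2] would be
    moderately close at two distant places, against [flare_far]. Thus whatever lies beyond the first
    far section [T2] sees a single foot. *)
Lemma foot_gate (D M : nat) : s <= D -> exists C, forall T T1 T2 a v0 u1 u2,
  tight T -> tight T1 -> tight T2 -> (forall u, s0 <= gap T T2 u) ->
  foot D T T1 a u1 -> foot D T T1 v0 u2 ->
  (forall t, btw a t v0 -> dist a u1 <= dist t a + 2 * d -> gap T1 T2 t <= M) ->
  dist u1 u2 <= C.
Proof.
intros HD. destruct (flare_mid D) as [L1 H]. destruct (H D) as [L2 HL2]. clear H.
destruct (flare_far (D + M + 4 * d)) as [L3 HL3].
set (L := L1 + L2 + 4 * d + 1). exists (2 * L + L3).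
intros T T1 T2 a v0 u1 u2 HS HS1 HS2 Hf Hu1 Hu2 HM.
destruct (le_lt_dec (dist u1 u2) (2 * L)) as [|Hlt]; [lia|].
assert (key : forall x, btw u1 x u2 -> L <= dist u1 x -> L <= dist x u2 ->
  gap T T2 x <= D + M + 4 * d).
{ intros x Hx X1 X2.
  assert (Hxs : gap T T1 x <= D).
  { enough (gap T T1 x <= s) by lia. apply (HL2 T T1 u1 u2 x); auto.
    - apply Hu1.
    - apply Hu2.
    - rewrite (dist_sym connB); unfold L in *; lia.
    - unfold L in *; lia. }
  pose proof (proj2 Hu1 x Hxs) as N1. pose proof (proj2 Hu2 x Hxs) as N2.
  destruct (slim_btw connB hypB a Hx) as [r [[Hr|Hr] Hd]].
  { exfalso. pose proof (dist_tri connB a r x). pose proof (dist_tri connB u1 r x).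
    unfold btw in Hr. rewrite (dist_sym connB r x), (dist_sym connB u1 a),
      (dist_sym connB r a) in *. unfold L in *. lia. }
  destruct (slim_btw connB hypB v0 Hr) as [t [[Ht|Ht] Hd']].
  - pose proof (dist_tri connB x r t) as Hxt.
    pose proof (dist_tri connB a t x) as Hat. rewrite (dist_sym connB t x) in Hat.
    rewrite (dist_sym connB a t) in Hat.
    specialize (HM t Ht ltac:(lia)).
    pose proof (gap_tri T T1 T2 x). pose proof (gap_lipschitz T1 T2 x t). lia.
  - exfalso. pose proof (dist_tri connB x r t). pose proof (dist_tri connB v0 t x).
    pose proof (dist_tri connB x t u2). unfold btw in Ht.
    rewrite (dist_sym connB t x) in *. unfold L in *. lia. }
destruct (@btw_at B connB u1 u2 L) as [x1 [Hx1 E1]]; [lia|].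
destruct (@btw_at B connB u1 u2 (dist u1 u2 - L)) as [x2 [Hx2 E2]]; [lia|].
pose proof (key x1 Hx1) as K1. pose proof (key x2 Hx2) as K2.
unfold btw in Hx1, Hx2.
pose proof (HL3 T T2 HS HS2 Hf x1 x2 ltac:(lia) ltac:(lia)).
pose proof (dist_tri connB u1 x1 u2). pose proof (dist_tri connB x1 x2 u2). lia.
Qed.

Hypothesis K_large : kap + 4 * d + 7 <= K.
Let K_pos : 1 <= K.
Proof. lia. Qed.

(** * Chains of sections *)

(** The second clause is all that is kept of the order on the geodesics of the fibers: two sections
    close in [E] are also close to every section between them. *)
Definition chain (N : nat) (T : nat -> bundle_section p) (v0 : B) : Prop :=
  (forall i, i <= N -> tight (T i)) /\
  (forall i j l u, i <= j -> j <= l -> l <= N ->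
     gap (T i) (T j) u <= K * gap (T i) (T l) u + K /\
     gap (T j) (T l) u <= K * gap (T i) (T l) u + K) /\
  (forall i, i < N -> gap (T i) (T (S i)) v0 <= 1).

Lemma chain_rev N T v0 : chain N T v0 -> chain N (fun i => T (N - i)) v0.
Proof.
intros [H1 [H2 H3]]. split; [|split].
- intros i Hi. apply H1; lia.
- intros i j l u Hi Hj Hl. destruct (H2 (N - l) (N - j) (N - i) u) as [A1 A2]; try lia.
  rewrite (gap_sym (T (N - i)) (T (N - j))), (gap_sym (T (N - j)) (T (N - l))),
    (gap_sym (T (N - i)) (T (N - l))). auto.
- intros i Hi. rewrite gap_sym. replace (N - i) with (S (N - S i)) by lia. apply H3; lia.
Qed.

(** Up to the last section [e] that comes [D0]-close to the section [b], the map is the foot; beyond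
    [e] it is the constant [g], the foot of [v0] on the section [e]. Steps below [e] are contracted
    by [foot_contraction]. A step across [e] is first moved to the section [e] over the same base
    point, and there [foot_gate] identifies the foot with [g]. *)
Lemma chain_shadow_up (D0 : nat) : s <= D0 ->
  exists C (R : nat -> nat) (C2 : nat -> nat), forall N T v0, chain N T v0 ->
  forall b, b <= N -> exists pi : nat -> B -> B,
  (forall n i j a a', b <= i <= N -> b <= j <= N -> dist (T i a) (T j a') <= n ->
     R n <= gap (T b) (T i) a -> dist (pi i a) (pi j a') <= C) /\
  (forall n i a, b <= i <= N -> gap (T b) (T i) a <= n -> dist (pi i a) a <= C2 n) /\
  (forall i a, b <= i <= N -> (exists u, gap (T b) (T i) u <= D0) ->
     foot (K * D0 + K) (T b) (T i) a (pi i a)).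
Proof.
intros HD0. set (D := K * D0 + K). assert (HD : s <= D) by (unfold D; nia).
destruct (foot_contraction HD) as [CW HW].
destruct (bound_function HW) as [RW HRW]. clear HW.
destruct (bound_function (fun n => @foot_gap_bound D n HD)) as [G HG].
destruct (bound_function (fun M => @foot_gate D M HD)) as [Cg HCg].
destruct (bound_function flare_quasiconvex) as [Q HQ].
destruct (flare_mid 1) as [L1 HL1]. destruct (bound_function HL1) as [L2 HL2]. clear HL1.
set (n1 := fun n => K * (2 * n) + K). set (n2 := fun n => K * n1 n + K).
set (R0 := fun n => RW (2 * n) + RW (n1 n) + K * (D + 2 * (L2 (n2 n) + 2 * d)) + K + 1).
(* [Mb] bounds the gap of the last near and the first far section on the way to [v0]: it is at most
   [s] away from the ends, and at most [1 + 2 * L1] near [v0], where they are adjacent. *)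
set (Mb := s + 1 + 2 * L1). set (m := fun n => 2 * (K * n + K)).
exists (CW + Cg Mb), (fun n => R0 n + 4 * n),
  (fun n => G n + G (K * n + K) + Cg (Q (m n + 1))).
intros N T v0 [HT [Hb Hv0]] b HbN.
destruct (@last_upto (fun i => exists u, gap (T b) (T i) u <= D0) b N HbN) as [e [He [[ue Hue] Hlast]]].
{ exists v0. rewrite gap_self; lia. }
(* Where the section [e] is [D0]-close to [b], all sections between are [K * D0 + K]-close; hence
   the enlarged constant [D]. *)
assert (ne : forall i, b <= i <= e -> exists u, gap (T b) (T i) u <= D).
{ intros i Hi. exists ue. destruct (Hb b i e ue) as [H _]; try lia. unfold D; nia. }
set (ft := fun i a => epsilon (inhabits a) (foot D (T b) (T i) a)).
assert (Hft : forall i a, b <= i <= e -> foot D (T b) (T i) a (ft i a)).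
{ intros i a Hi. apply epsilon_spec, foot_exists, ne; auto. }
set (g := ft e v0).
assert (Hfar : forall i u, e < i <= N -> s0 <= gap (T b) (T i) u).
{ intros i u Hi. destruct (le_lt_dec (gap (T b) (T i) u) D0); [|lia].
  exfalso; apply (Hlast i Hi); eauto. }
set (pi := fun i a => if le_lt_dec i e then ft i a else g).
assert (pin : forall i a, i <= e -> pi i a = ft i a) by (intros; unfold pi; destruct le_lt_dec; [auto|lia]).
assert (pif : forall i a, e < i -> pi i a = g) by (intros; unfold pi; destruct le_lt_dec; [lia|auto]).
assert (ord : forall n i j a a', b <= i -> i <= j -> j <= N -> dist (T i a) (T j a') <= n ->
  R0 n <= gap (T b) (T i) a -> dist (pi i a) (pi j a') <= CW + Cg Mb).
{ intros n i j a a' Hbi Hij Hj Hn HR.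
  destruct (sec_close Hn) as [Haa Hg].
  destruct (le_lt_dec j e) as [Hje|Hje].
  - rewrite !pin by lia. enough (dist (ft i a) (ft j a') <= CW) by lia.
    apply (HRW (2 * n) (T b) (T i) (T j) a a'); try apply HT; try lia.
    + intros w. destruct (Hb b i j w) as [H _]; lia.
    + unfold R0 in HR; lia.
    + apply Hft; lia.
    + apply Hft; lia.
  - rewrite (pif j) by lia. destruct (le_lt_dec i e) as [Hie|Hie].
    + rewrite pin by lia.
      destruct (Hb i e j a) as [X1 X2]; try lia.
      assert (Y1 : gap (T i) (T e) a <= n1 n) by (unfold n1; nia).
      assert (Y2 : gap (T e) (T j) a <= n1 n) by (unfold n1; nia).
      destruct (Hb e (S e) j a) as [X3 _]; try lia.
      assert (Y3 : gap (T e) (T (S e)) a <= n2 n) by (unfold n2; nia).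
      assert (Z1 : dist (ft i a) (ft e a) <= CW).
      { apply (HRW (n1 n) (T b) (T i) (T e) a a); try apply HT; try lia.
        - intros w. destruct (Hb b i e w) as [H _]; lia.
        - rewrite (dist_refl connB); lia.
        - unfold R0 in HR; lia.
        - apply Hft; lia.
        - apply Hft; lia. }
      assert (Z2 : dist (ft e a) g <= Cg Mb).
      { apply (HCg Mb (T b) (T e) (T (S e)) a v0); try apply HT; try lia.
        - intros u; apply Hfar; lia.
        - apply Hft; lia.
        - apply Hft; lia.
        - intros t Ht Hta. destruct (le_lt_dec L1 (dist t v0)) as [Ht1|Ht1].
          + enough (gap (T e) (T (S e)) t <= s) by (unfold Mb; lia).
            apply (HL2 (n2 n) (T e) (T (S e)) v0 a t); try apply HT; try lia.
            * apply (btw_sym connB); auto.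
            * apply Hv0; lia.
            * destruct (le_lt_dec (L2 (n2 n)) (dist t a)) as [|Hlt]; auto. exfalso.
              destruct (Hft e a ltac:(lia)) as [F1 _].
              pose proof (gap_lipschitz (T b) (T e) a (ft e a)).
              destruct (Hb b i e a) as [X4 _]; try lia.
              assert (gap (T b) (T e) a <= D + 2 * (L2 (n2 n) + 2 * d)) by lia.
              assert (K * gap (T b) (T e) a <= K * (D + 2 * (L2 (n2 n) + 2 * d)))
                by (apply Nat.mul_le_mono_l; auto).
              unfold R0 in HR. lia.
          + pose proof (gap_lipschitz (T e) (T (S e)) t v0). specialize (Hv0 e ltac:(lia)).
            unfold Mb; lia. }
      pose proof (dist_tri connB (ft i a) (ft e a) g). lia.
    + rewrite pif by lia. rewrite (dist_refl connB); lia. }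
exists pi. split; [|split].
- intros n i j a a' Hi Hj Hn HR. destruct (le_lt_dec i j).
  + apply (ord n); auto; lia.
  + rewrite (dist_sym connB). rewrite (dist_sym connE) in Hn. apply (ord n); auto; try lia.
    destruct (sec_close Hn) as [H1 H2].
    pose proof (gap_lipschitz (T b) (T i) a a') as H3.
    pose proof (gap_tri (T b) (T j) (T i) a') as H4.
    rewrite (dist_sym connB a a') in H3. lia.
- intros n i a Hi Hn. destruct (le_lt_dec i e).
  + rewrite pin by auto. rewrite (dist_sym connB).
    enough (dist a (ft i a) <= G n) by lia.
    apply (HG n (T b) (T i)); try apply HT; try lia. apply Hft; lia.
  + rewrite pif by auto. rewrite (dist_sym connB).
    destruct (Hb b e i a) as [X1 _]; try lia. destruct (Hb b (S e) i a) as [X2 _]; try lia.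
    assert (Z1 : dist a (ft e a) <= G (K * n + K)).
    { apply (HG (K * n + K) (T b) (T e)); try apply HT; try lia; [apply Hft; lia|nia]. }
    assert (Y : gap (T e) (T (S e)) a <= m n + 1).
    { pose proof (gap_tri (T e) (T b) (T (S e)) a) as H. rewrite (gap_sym (T e) (T b)) in H.
      unfold m; nia. }
    assert (Z2 : dist (ft e a) g <= Cg (Q (m n + 1))).
    { apply (HCg _ (T b) (T e) (T (S e)) a v0); try apply HT; try lia.
      - intros u; apply Hfar; lia.
      - apply Hft; lia.
      - apply Hft; lia.
      - intros t Ht _. apply (HQ (m n + 1) (T e) (T (S e)) a v0); try apply HT; auto; try lia.
        specialize (Hv0 e ltac:(lia)). lia. }
    pose proof (dist_tri connB a (ft e a) g). lia.
- intros i a Hi [u Hu]. destruct (le_lt_dec i e).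
  + rewrite pin by auto. apply Hft; lia.
  + exfalso. apply (Hlast i); [lia|eauto].
Qed.

(** By [height_near] this is the distance to the image of [T] up to a factor 2, but the comparison
    point is given by the base. *)
Definition height (T : bundle_section p) (z : E) : nat := dist z (T (p z)).

Lemma height_sec (T T' : bundle_section p) (a : B) : height T (T' a) = gap T T' a.
Proof. unfold height. rewrite sec_proj. apply gap_sym. Qed.

Lemma height_lipschitz T z z' : height T z <= height T z' + 2 * dist z z'.
Proof.
unfold height. pose proof (dist_tri connE z z' (T (p z))).
pose proof (dist_tri connE z' (T (p z')) (T (p z))).
pose proof (proj_lipschitz z' z). rewrite sec_dist, (dist_sym connE z' z) in *. lia.
Qed.

Lemma height_near (T : bundle_section p) z u r : dist z (T u) <= r -> height T z <= 2 * r /\ dist (p z) u <= r.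
Proof.
intros H. pose proof (proj_lipschitz z (T u)) as H1. rewrite sec_proj in H1.
split; [|lia]. unfold height. pose proof (dist_tri connE z (T u) (T (p z))).
rewrite sec_dist, (dist_sym connB u) in *. lia.
Qed.

Definition on_chain (N : nat) (T : nat -> bundle_section p) (z : E) : Prop :=
  exists i, i <= N /\ T i (p z) = z.

Lemma on_chain_sec N (T : nat -> bundle_section p) i a : i <= N -> on_chain N T (T i a).
Proof. intros; exists i. now rewrite sec_proj. Qed.

Lemma on_chain_rev N T z : on_chain N T z -> on_chain N (fun i => T (N - i)) z.
Proof. intros [i [Hi E1]]. exists (N - i). split; [lia|]. now replace (N - (N - i)) with i by lia. Qed.

(* The map [pi] is a coarse projection of the chain to its [b]-th section; the point is
   that [C] does not depend on the length [n] of the step. *)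
Lemma chain_shadow (D0 : nat) : s <= D0 ->
  exists C (R : nat -> nat) (C2 : nat -> nat) (C4 : nat -> nat),
  forall N T v0, chain N T v0 -> forall b, b <= N -> exists pi : E -> B,
  (forall n z z', on_chain N T z -> on_chain N T z' -> dist z z' <= n ->
     R n <= height (T b) z -> dist (pi z) (pi z') <= C) /\
  (forall n z, on_chain N T z -> height (T b) z <= n -> dist (pi z) (p z) <= C2 n) /\
  (forall n z z', on_chain N T z -> on_chain N T z' -> dist z z' <= n ->
     dist (pi z) (pi z') <= C4 n) /\
  (forall i a, i <= N -> (exists u, gap (T b) (T i) u <= D0) ->
     exists u, foot (K * D0 + K) (T b) (T i) a u /\ dist (pi (T i a)) u <= C4 0).
Proof.
intros HD0. destruct (chain_shadow_up HD0) as [C [R [C2 Hup]]].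
set (R1 := fun n => R n + K * (2 * n) + K + 1).
set (C4 := fun n => C + C2 (R1 n) + n + C2 (R1 n + 4 * n)).
exists C, R1, C2, C4. intros N T v0 Hc b HbN.
destruct (Hup N T v0 Hc b HbN) as [pu [U1 [U2 U3]]].
destruct (Hup N _ v0 (chain_rev Hc) (N - b) ltac:(lia)) as [pd [W1 [W2 W3]]].
replace (N - (N - b)) with b in * by lia.
destruct Hc as [HT [Hb _]].
(* The two halves need no compatibility far from the section [b]: a short step from one side of it
   to the other happens near it, by betweenness. *)
set (pi := fun i a => if le_lt_dec b i then pu i a else pd (N - i) a).
assert (P1 : forall n i j a a', i <= N -> j <= N -> dist (T i a) (T j a') <= n ->
  R1 n <= gap (T b) (T i) a -> dist (pi i a) (pi j a') <= C).
{ intros n i j a a' Hi Hj Hn HR. unfold pi. destruct (sec_close Hn) as [_ Hg].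
  destruct (le_lt_dec b i), (le_lt_dec b j).
  - apply (U1 n); auto; try lia. unfold R1 in HR; lia.
  - exfalso. destruct (Hb j b i a) as [_ H]; try lia. rewrite (gap_sym (T j) (T i)) in H.
    unfold R1 in HR; nia.
  - exfalso. destruct (Hb i b j a) as [H _]; try lia. rewrite (gap_sym (T i) (T b)) in H.
    unfold R1 in HR; nia.
  - apply (W1 n); try lia; replace (N - (N - i)) with i by lia;
      [replace (N - (N - j)) with j by lia; auto|]. unfold R1 in HR; lia. }
assert (P2 : forall n i a, i <= N -> gap (T b) (T i) a <= n -> dist (pi i a) a <= C2 n).
{ intros n i a Hi Hn. unfold pi. destruct (le_lt_dec b i).
  - apply U2; auto; lia.
  - apply W2; [lia|]. now replace (N - (N - i)) with i by lia. }
assert (P3 : forall i a, i <= N -> (exists u, gap (T b) (T i) u <= D0) ->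
  foot (K * D0 + K) (T b) (T i) a (pi i a)).
{ intros i a Hi Hu. unfold pi. destruct (le_lt_dec b i).
  - apply U3; auto; lia.
  - specialize (W3 (N - i) a ltac:(lia)). replace (N - (N - i)) with i in W3 by lia. auto. }
assert (P4 : forall n i j a a', i <= N -> j <= N -> dist (T i a) (T j a') <= n ->
  dist (pi i a) (pi j a') <= C4 n).
{ intros n i j a a' Hi Hj Hn. destruct (sec_close Hn) as [Haa Hg].
  destruct (le_lt_dec (R1 n) (gap (T b) (T i) a)) as [H|H].
  - specialize (P1 n i j a a' Hi Hj Hn H). unfold C4; lia.
  - pose proof (P2 (R1 n) i a Hi ltac:(lia)).
    pose proof (gap_lipschitz (T b) (T j) a' a). pose proof (gap_tri (T b) (T i) (T j) a).
    rewrite (dist_sym connB a' a) in *.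
    pose proof (P2 (R1 n + 4 * n) j a' Hj ltac:(lia)).
    pose proof (dist_tri connB (pi i a) a (pi j a')). pose proof (dist_tri connB a a' (pi j a')).
    rewrite (dist_sym connB a' (pi j a')) in *. unfold C4; lia. }
(* Sections of the chain may meet, so a level has to be chosen for each point. *)
set (lev := fun z => epsilon (inhabits 0) (fun i => i <= N /\ T i (p z) = z)).
assert (Hlev : forall z, on_chain N T z -> lev z <= N /\ T (lev z) (p z) = z).
{ intros z Hz. apply (epsilon_spec (inhabits 0) (fun i => i <= N /\ T i (p z) = z)), Hz. }
assert (Hht : forall z, on_chain N T z -> height (T b) z = gap (T b) (T (lev z)) (p z)).
{ intros z Hz. destruct (Hlev z Hz) as [_ Ez]. rewrite <- Ez at 1. apply height_sec. }
exists (fun z => pi (lev z) (p z)). split; [|split; [|split]].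
- intros n z z' Hz Hz' Hn HR. destruct (Hlev z Hz) as [Lz Ez], (Hlev z' Hz') as [Lz' Ez'].
  apply (P1 n); auto; [rewrite Ez, Ez'; auto|]. rewrite <- Hht; auto.
- intros n z Hz Hn. apply P2; [apply Hlev; auto|rewrite <- Hht; auto].
- intros n z z' Hz Hz' Hn. destruct (Hlev z Hz) as [Lz Ez], (Hlev z' Hz') as [Lz' Ez'].
  apply P4; auto. rewrite Ez, Ez'; auto.
- intros i a Hi Hu. exists (pi i a). split; auto. rewrite sec_proj.
  destruct (Hlev (T i a) (on_chain_sec T a Hi)) as [L1 E1]. rewrite sec_proj in E1.
  apply P4; auto. rewrite E1, (dist_refl connE); auto.
Qed.

(** * Quasi-geodesics in chains *)

(** Cutting the excursion into blocks of [q] steps, each of which moves the shadow by at most [C],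
    gives speed [C / q]. In the applications [C] is known before [q], so the speed can be made as
    small as needed. *)
Lemma shadow_excursion (C q k M : nat) (R : nat) (a : nat -> E) (T : bundle_section p)
  (pi : E -> B) (P : E -> Prop) : 1 <= q -> steps k M a -> (forall l, l <= M -> P (a l)) ->
  (forall z z', P z -> P z' -> dist z z' <= k * q -> R <= height T z -> dist (pi z) (pi z') <= C) ->
  forall i j, i <= j -> j <= M -> (forall l, i <= l < j -> R <= height T (a l)) ->
  q * dist (pi (a i)) (pi (a j)) <= C * (j - i) + C * q.
Proof.
intros Hq Hs HP Hpi i j. remember (j - i) as n eqn:En. revert i j En.
induction n as [n IH] using lt_wf_ind. intros i j En Hij Hj HR.
destruct (Nat.eq_dec i j) as [->|Hne]; [rewrite (dist_refl connB); lia|].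
destruct (le_lt_dec (j - i) q) as [Hl|Hl].
- assert (dist (pi (a i)) (pi (a j)) <= C).
  { apply Hpi; [apply HP; lia|apply HP; lia| |apply HR; lia].
    pose proof (steps_dist connE Hs Hij Hj). nia. }
  nia.
- assert (A1 : dist (pi (a i)) (pi (a (i + q))) <= C).
  { apply Hpi; [apply HP; lia|apply HP; lia| |apply HR; lia].
    pose proof (steps_dist connE Hs (i := i) (j := i + q) ltac:(lia) ltac:(lia)) as H.
    replace (i + q - i) with q in H by lia. auto. }
  assert (A2 : q * dist (pi (a (i + q))) (pi (a j)) <= C * (n - q) + C * q).
  { apply (IH (n - q)); try lia. intros l Hll; apply HR; lia. }
  pose proof (dist_tri connB (pi (a i)) (pi (a (i + q))) (pi (a j))).
  assert (C * (n - q) + C * q = C * n) by nia. nia.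
Qed.

Lemma morse_section (k r : nat) : exists C, forall N T v0, chain N T v0 ->
  forall b, b <= N -> forall M a, (forall l, l <= M -> on_chain N T (a l)) -> qgeo k M a ->
  forall l0 l l1, l0 <= l -> l <= l1 -> l1 <= M ->
  height (T b) (a l0) <= r -> height (T b) (a l1) <= r -> height (T b) (a l) <= C.
Proof.
destruct (chain_shadow (le_n s)) as [C [R [C2 [C4 H]]]].
(* The excursion begins and ends near the section, so its ends are about as far apart as their
   shadows. This [q] makes the shadow slower than [1 / (2 * k)] per step, which a [k]-quasi-geodesic
   can sustain only for a bounded time. *)
set (q := 2 * k * C + 1). set (r1 := r + R (k * q)).
set (A := 2 * (r1 + 2 * k) + 2 * C2 (r1 + 2 * k)).
exists (r1 + 2 * k + 2 * k * (2 * k * A + 2 * k * C + 2 * k)).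
intros N T v0 Hc b HbN M a Ha [Hs Hq] l0 l l1 Hl0 Hl1 HlM H0 H1.
destruct (H N T v0 Hc b HbN) as [pi [P1 [P2 _]]]. clear H.
destruct (le_lt_dec (height (T b) (a l)) r1) as [|Hlt]; [lia|].
destruct (@last_before (fun i => height (T b) (a i) <= r1) l0 l) as [i [Hi [Hir Hin]]];
  try lia.
destruct (@first_after (fun i => height (T b) (a i) <= r1) l l1) as [j [Hj [Hjr Hjn]]];
  try lia.
cbv beta in *.
assert (Hout : forall m, S i <= m <= j - 1 -> r1 < height (T b) (a m)).
{ intros m Hm. destruct (le_lt_dec m l); [specialize (Hin m)|specialize (Hjn m)]; lia. }
assert (Hht : forall m m', m < M -> m' = S m -> height (T b) (a m') <= height (T b) (a m) + 2 * k /\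
  height (T b) (a m) <= height (T b) (a m') + 2 * k).
{ intros m m' Hm ->. pose proof (height_lipschitz (T b) (a m) (a (S m))).
  pose proof (height_lipschitz (T b) (a (S m)) (a m)).
  rewrite (dist_sym connE (a (S m)) (a m)) in *. specialize (Hs m Hm). lia. }
pose proof (Hht i (S i) ltac:(lia) eq_refl) as Hi1.
pose proof (Hht (j - 1) j ltac:(lia) ltac:(lia)) as Hj1.
set (m := j - 1 - S i).
assert (Hx : q * dist (pi (a (S i))) (pi (a (j - 1))) <= C * m + C * q).
{ apply (@shadow_excursion C q k M (R (k * q)) a (T b) pi (on_chain N T)); auto; try lia.
  - intros z z' Hz Hz' Hd HR. apply (P1 (k * q)); auto.
  - intros x Hx. specialize (Hout x ltac:(lia)). unfold r1 in Hout; lia. }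
pose proof (P2 (r1 + 2 * k) (a (S i)) (Ha (S i) ltac:(lia)) ltac:(lia)) as X1.
pose proof (P2 (r1 + 2 * k) (a (j - 1)) (Ha (j - 1) ltac:(lia)) ltac:(lia)) as X2.
set (x := dist (pi (a (S i))) (pi (a (j - 1)))) in *.
assert (HA : dist (a (S i)) (a (j - 1)) <= A + x).
{ pose proof (dist_tri connE (a (S i)) (T b (p (a (S i)))) (a (j - 1))) as Y1.
  pose proof (dist_tri connE (T b (p (a (S i)))) (T b (p (a (j - 1)))) (a (j - 1))) as Y2.
  rewrite sec_dist in Y2.
  rewrite (dist_sym connE (T b (p (a (j - 1)))) (a (j - 1))) in Y2.
  fold (height (T b) (a (S i))) in Y1. fold (height (T b) (a (j - 1))) in Y2.
  pose proof (dist_tri connB (p (a (S i))) (pi (a (S i))) (p (a (j - 1)))) as Y3.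
  pose proof (dist_tri connB (pi (a (S i))) (pi (a (j - 1))) (p (a (j - 1)))) as Y4.
  rewrite (dist_sym connB (p (a (S i))) (pi (a (S i)))) in Y3.
  fold x in Y4. unfold A; lia. }
assert (Hm : m <= 2 * k * A + 2 * k * C + 2 * k).
{ specialize (Hq (S i) (j - 1) ltac:(lia) ltac:(lia)). fold m in Hq.
  assert (E1 : k * dist (a (S i)) (a (j - 1)) <= k * (A + x)) by (apply Nat.mul_le_mono_l; auto).
  assert (E2 : q * (2 * k * x) <= q * (m + 2 * k * C)).
  { assert (2 * k * (q * x) <= 2 * k * (C * m + C * q)) by (apply Nat.mul_le_mono_l; auto).
    assert (q * m = 2 * k * C * m + m) by (unfold q; ring).
    replace (q * (2 * k * x)) with (2 * k * (q * x)) by ring.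
    replace (q * (m + 2 * k * C)) with (q * m + 2 * k * C * q) by ring. nia. }
  apply Nat.mul_le_mono_pos_l in E2; [|unfold q; lia]. nia. }
pose proof (steps_dist connE Hs (i := S i) (j := l) ltac:(lia) ltac:(lia)) as Z1.
pose proof (height_lipschitz (T b) (a l) (a (S i))) as Z2.
rewrite (dist_sym connE (a l) (a (S i))) in Z2.
assert (k * (l - S i) <= k * (2 * k * A + 2 * k * C + 2 * k)) by (apply Nat.mul_le_mono_l; lia).
lia.
Qed.

(** Near a section, distances in [E] and in the base agree up to a constant, since sections are
    isometric embeddings. *)
Lemma proj_qgeo (k c M : nat) (a : nat -> E) (T : bundle_section p) : qgeo k M a ->
  (forall l, l <= M -> height T (a l) <= c) -> qgeo (k + 2 * k * c) M (fun l => p (a l)).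
Proof.
intros [Hs Hq] Hc. split.
- intros i Hi. pose proof (proj_lipschitz (a i) (a (S i))). specialize (Hs i Hi). lia.
- intros i j Hi Hj. specialize (Hq i j Hi Hj).
  pose proof (dist_tri connE (a i) (T (p (a i))) (a j)) as Y1.
  pose proof (dist_tri connE (T (p (a i))) (T (p (a j))) (a j)) as Y2.
  rewrite sec_dist in Y2. rewrite (dist_sym connE (T (p (a j))) (a j)) in Y2.
  fold (height T (a i)) in Y1. fold (height T (a j)) in Y2.
  pose proof (Hc i ltac:(lia)). pose proof (Hc j ltac:(lia)).
  assert (k * dist (a i) (a j) <= k * (2 * c + dist (p (a i)) (p (a j)))).
  { apply Nat.mul_le_mono_l; lia. }
  nia.
Qed.

(** Between two visits to the section the path stays near it by [morse_section], so its projection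
    is a quasi-geodesic of the hyperbolic base. *)
Lemma section_segment (k r : nat) : exists C, forall N T v0, chain N T v0 ->
  forall b, b <= N -> forall M a, (forall l, l <= M -> on_chain N T (a l)) -> qgeo k M a ->
  forall l0 l1 w w', l0 <= l1 -> l1 <= M ->
  dist (a l0) (T b w) <= r -> dist (a l1) (T b w') <= r ->
  (forall l, l0 <= l <= l1 -> exists t, btw w t w' /\ dist (a l) (T b t) <= C) /\
  (forall t, btw w t w' -> exists l, l0 <= l <= l1 /\ dist (a l) (T b t) <= C).
Proof.
destruct (morse_section k (2 * r)) as [C1 H1].
destruct (morse_ends connB hypB (k + 2 * k * C1) r) as [C2 H2].
exists (C1 + C2). intros N T v0 Hc b HbN M a Ha Hq l0 l1 w w' Hl HM Hw Hw'.
destruct (height_near Hw) as [X1 X2]. destruct (height_near Hw') as [X3 X4].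
assert (Hh : forall l, l0 <= l <= l1 -> height (T b) (a l) <= C1).
{ intros l Hll. apply (H1 N T v0 Hc b HbN M a Ha Hq l0 l l1); lia. }
assert (HqB : qgeo (k + 2 * k * C1) (l1 - l0) (fun l => p (a (l0 + l)))).
{ apply (@proj_qgeo k C1 (l1 - l0) (fun l => a (l0 + l)) (T b)).
  - apply (qgeo_sub Hq); auto.
  - intros l Hll. apply Hh; lia. }
destruct (H2 _ _ w w' HqB) as [Y1 Y2].
- rewrite Nat.add_0_r, (dist_sym connB); lia.
- replace (l0 + (l1 - l0)) with l1 by lia; lia.
- split.
  + intros l Hll. destruct (Y2 (l - l0) ltac:(lia)) as [t [Ht Hd]]. exists t; split; auto.
    replace (l0 + (l - l0)) with l in Hd by lia. specialize (Hh l Hll).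
    pose proof (dist_tri connE (a l) (T b (p (a l))) (T b t)). rewrite sec_dist in *.
    unfold height in Hh. lia.
  + intros t Ht. destruct (Y1 t Ht) as [l [Hll Hd]]. exists (l0 + l); split; [lia|].
    specialize (Hh (l0 + l) ltac:(lia)).
    pose proof (dist_tri connE (a (l0 + l)) (T b (p (a (l0 + l)))) (T b t)).
    rewrite sec_dist, (dist_sym connB _ t) in *. unfold height in Hh. lia.
Qed.

(* Between its last visit of [T i] and its first visit of [T b] the path is far from both
   sections, so that its projections to both hardly move: this part is short. *)
Lemma morse_pair (D0 k r : nat) : s <= D0 -> exists C, forall N T v0, chain N T v0 ->
  forall b i, b <= N -> i <= N -> (exists u, gap (T b) (T i) u <= D0) ->
  forall M a, (forall l, l <= M -> on_chain N T (a l)) -> qgeo k M a ->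
  forall x u, dist (a 0) (T i x) <= r -> height (T b) (a M) <= r ->
  foot (K * D0 + K) (T b) (T i) x u ->
  exists l, l <= M /\ dist (a l) (T b u) <= C.
Proof.
intros HD0. set (D := K * D0 + K). assert (HD : s <= D) by (unfold D; nia).
destruct (chain_shadow HD0) as [C [R [C2 [C4 Hsh]]]].
(* The length of the excursion is compared with [x2 + 3 * x1], four shadow displacements, whence the
   factor 8 in place of 2. *)
set (q := 8 * k * C + 1). set (rho := 2 * r + R (k * q)).
set (A := C4 rho + C4 0 + C2 rho + C4 k).
set (J0 := 2 * k * (2 * rho + D + 4 * A) + 2 * k + 8 * k * C).
set (J := 3 * (C * J0 + C + A)).
destruct (morse_section k rho) as [C1 H1].
destruct (morse_ends connB hypB (k + 2 * k * C1) (r + J)) as [C5 H5].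
destruct (foot_near_geodesic D HD) as [C6 H6].
exists (C1 + C5 + C6 + D).
intros N T v0 Hc b i Hb Hi [u0 Hu0] M a Ha Hq x u Hx HM Hu.
destruct (Hsh N T v0 Hc b Hb) as [pb [B1 [B2 [B3 B4]]]].
destruct (Hsh N T v0 Hc i Hi) as [pi [I1 [I2 [I3 I4]]]]. clear Hsh.
destruct (height_near Hx) as [X1 X2].
pose proof (fun j Hj => proj1 Hc j Hj) as HT. pose proof Hq as [Hs Hq2].
destruct (@last_upto (fun l => height (T i) (a l) <= rho) 0 M) as [e0 [He0 [He0r He0n]]];
  [lia|cbv beta; unfold rho; lia|].
destruct (@first_from (fun l => height (T b) (a l) <= rho) e0 M) as [e [He [Her Hen]]];
  [lia|cbv beta; unfold rho; lia|]. cbv beta in *.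
set (m := e - e0). set (y := p (a e0)). set (w := p (a e)).
assert (Hpb : exists x1, q * x1 <= C * m + C * q /\ dist (pb (a e0)) (pb (a e)) <= x1 + C4 k).
{ destruct (Nat.eq_dec e0 e) as [<-|Hne].
  { exists 0. rewrite (dist_refl connB); lia. }
  exists (dist (pb (a e0)) (pb (a (e - 1)))). split.
  - assert (q * dist (pb (a e0)) (pb (a (e - 1))) <= C * (e - 1 - e0) + C * q).
    { apply (@shadow_excursion C q k M (R (k * q)) a (T b) pb (on_chain N T));
        auto; try lia; try (unfold q; lia).
      - intros z z' Hz Hz' Hd HR. apply (B1 (k * q)); auto.
      - intros l Hl. specialize (Hen l ltac:(lia)). unfold rho in Hen; lia. }
    assert (C * (e - 1 - e0) <= C * m) by (apply Nat.mul_le_mono_l; lia). lia.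
  - pose proof (dist_tri connB (pb (a e0)) (pb (a (e - 1))) (pb (a e))).
    enough (dist (pb (a (e - 1))) (pb (a e)) <= C4 k) by lia.
    apply B3; [apply Ha; lia|apply Ha; lia|].
    replace e with (S (e - 1)) at 2 by lia. apply Hs; lia. }
assert (Hpi : exists x1, q * x1 <= C * m + C * q /\ dist (pi (a e0)) (pi (a e)) <= x1 + C4 k).
{ destruct (Nat.eq_dec e0 e) as [<-|Hne].
  { exists 0. rewrite (dist_refl connB); lia. }
  exists (dist (pi (a (S e0))) (pi (a e))). split.
  - assert (q * dist (pi (a (S e0))) (pi (a e)) <= C * (e - S e0) + C * q).
    { apply (@shadow_excursion C q k M (R (k * q)) a (T i) pi (on_chain N T));
        auto; try lia; try (unfold q; lia).
      - intros z z' Hz Hz' Hd HR. apply (I1 (k * q)); auto.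
      - intros l Hl. specialize (He0n l ltac:(lia)). unfold rho in He0n; lia. }
    assert (C * (e - S e0) <= C * m) by (apply Nat.mul_le_mono_l; lia). lia.
  - pose proof (dist_tri connB (pi (a e0)) (pi (a (S e0))) (pi (a e))).
    enough (dist (pi (a e0)) (pi (a (S e0))) <= C4 k) by lia.
    apply I3; [apply Ha; lia|apply Ha; lia|]. apply Hs; lia. }
destruct Hpb as [x1 [Hx1 Hpb]]. destruct Hpi as [x2 [Hx2 Hpi]].
destruct (B4 i y Hi ltac:(eauto)) as [u' [Hu' Eu']]. fold D in Hu'.
destruct (I4 b w Hb) as [w' [Hw' Ew']].
{ exists u0; now rewrite gap_sym. }
fold D in Hw'. apply foot_sym in Hw'.
pose proof (B3 rho (a e0) (T i y) (Ha e0 ltac:(lia)) (on_chain_sec T y Hi) He0r) as Y1.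
pose proof (I3 rho (a e) (T b w) (Ha e ltac:(lia)) (on_chain_sec T w Hb) Her) as Y2.
pose proof (B2 rho (a e) (Ha e ltac:(lia)) Her) as Y3. fold w in Y3.
pose proof (I2 rho (a e0) (Ha e0 ltac:(lia)) He0r) as Y4. fold y in Y4.
assert (U1 : dist u' w <= x1 + A).
{ pose proof (dist_tri connB u' (pb (T i y)) w). pose proof (dist_tri connB (pb (T i y)) (pb (a e0)) w).
  pose proof (dist_tri connB (pb (a e0)) (pb (a e)) w).
  rewrite (dist_sym connB u' (pb (T i y))), (dist_sym connB (pb (T i y)) (pb (a e0))) in *.
  unfold A. lia. }
assert (U2 : dist w' y <= x2 + A).
{ pose proof (dist_tri connB w' (pi (T b w)) y). pose proof (dist_tri connB (pi (T b w)) (pi (a e)) y).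
  pose proof (dist_tri connB (pi (a e)) (pi (a e0)) y).
  rewrite (dist_sym connB w' (pi (T b w))), (dist_sym connB (pi (T b w)) (pi (a e))),
    (dist_sym connB (pi (a e)) (pi (a e0))) in *.
  unfold A. lia. }
(* As [w'] is a nearest point to [w], it is no farther from [w] than [u'] is; this closes the loop
   from [y] to [u']. *)
assert (U3 : dist y u' <= x2 + 2 * x1 + 3 * A).
{ pose proof (proj2 Hw' u' (proj1 Hu')). pose proof (dist_tri connB y w' u').
  pose proof (dist_tri connB w' w u'). rewrite (dist_sym connB y w'), (dist_sym connB w' w),
    (dist_sym connB w u') in *. lia. }
assert (U4 : dist (a e0) (a e) <= 2 * rho + D + 4 * A + (x2 + 3 * x1)).
{ pose proof (dist_tri connE (a e0) (T i y) (a e)). pose proof (dist_tri connE (T i y) (T i u') (a e)).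
  pose proof (dist_tri connE (T i u') (T b u') (a e)). pose proof (dist_tri connE (T b u') (T b w) (a e)).
  rewrite !sec_dist in *. pose proof (proj1 Hu') as G. rewrite gap_sym in G. unfold gap in G.
  rewrite (dist_sym connE (T b w) (a e)) in *.
  unfold height in He0r, Her. fold y in He0r. fold w in Her. lia. }
assert (Hm : m <= J0).
{ specialize (Hq2 e0 e ltac:(lia) ltac:(lia)). fold m in Hq2.
  assert (E1 : k * dist (a e0) (a e) <= k * (2 * rho + D + 4 * A + (x2 + 3 * x1)))
    by (apply Nat.mul_le_mono_l; auto).
  assert (E2 : q * (2 * k * (x2 + 3 * x1)) <= q * (m + 8 * k * C)).
  { assert (Z1 : 2 * k * (q * x2 + 3 * (q * x1)) <= 2 * k * (4 * (C * m + C * q)))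
      by (apply Nat.mul_le_mono_l; lia).
    assert (Z2 : q * m = 8 * k * C * m + m) by (unfold q; ring).
    replace (q * (2 * k * (x2 + 3 * x1))) with (2 * k * (q * x2 + 3 * (q * x1))) by ring.
    replace (q * (m + 8 * k * C)) with (q * m + 8 * k * C * q) by ring. nia. }
  apply Nat.mul_le_mono_pos_l in E2; [|unfold q; lia]. unfold J0. nia. }
assert (Hsmall : forall z, q * z <= C * m + C * q -> z <= C * J0 + C).
{ intros z Hz. assert (C * m <= C * J0) by (apply Nat.mul_le_mono_l; auto).
  assert (1 <= q) by (unfold q; lia).
  assert (1 * (C * J0) <= q * (C * J0)) by (apply Nat.mul_le_mono_r; auto).
  apply (Nat.mul_le_mono_pos_l _ _ q); [lia|].
  replace (q * (C * J0 + C)) with (q * (C * J0) + C * q) by ring. lia. }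
pose proof (Hsmall x1 Hx1). pose proof (Hsmall x2 Hx2).
assert (U5 : dist y u' <= J) by (unfold J; lia).
assert (Hh : forall l, l <= e0 -> height (T i) (a l) <= C1).
{ intros l Hl. apply (H1 N T v0 Hc i Hi M a Ha Hq 0 l e0); unfold rho; lia. }
assert (HqB : qgeo (k + 2 * k * C1) e0 (fun l => p (a l))).
{ apply (@proj_qgeo k C1 e0 a (T i)); auto. split; [intros l Hl; apply Hs; lia|].
  intros l l' Hl Hl'; apply Hq2; lia. }
destruct (H5 _ _ x u' HqB) as [Z1 _].
{ rewrite (dist_sym connB); lia. }
{ fold y; lia. }
destruct (H6 (T b) (T i) x u u' (HT b Hb) (HT i Hi) Hu (proj1 Hu')) as [t [Ht Htu]].
destruct (Z1 t Ht) as [l [Hl Hd]]. exists l. split; [lia|].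
specialize (Hh l Hl).
pose proof (dist_tri connE (a l) (T i (p (a l))) (T b u)).
pose proof (dist_tri connE (T i (p (a l))) (T i u) (T b u)). rewrite sec_dist in *.
pose proof (proj1 Hu) as G. fold D in G. rewrite gap_sym in G. unfold gap in G.
pose proof (dist_tri connB (p (a l)) t u). rewrite (dist_sym connB (p (a l)) t) in *.
unfold height in Hh. lia.
Qed.

Lemma chain_between N T v0 i j l n u : chain N T v0 -> i <= j -> j <= l -> l <= N ->
  gap (T i) (T l) u <= n ->
  gap (T i) (T j) u <= K * n + K /\ gap (T j) (T l) u <= K * n + K.
Proof.
intros [_ [H _]] Hi Hj Hl Hn. destruct (H i j l u Hi Hj Hl). nia.
Qed.

(** At the last time on a level at least [j'] the next short step leads to a level at most [j], and
    betweenness makes the point close to both sections. If there is no next step, the path ends near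
    the section [b], and betweenness is used with [b]. *)
Lemma chain_crossing (k r : nat) : exists C, forall N T v0, chain N T v0 ->
  forall b j j' i, b <= j -> j <= j' -> j' <= S j -> j' <= i -> i <= N ->
  forall M a, (forall l, l <= M -> on_chain N T (a l)) -> steps k M a ->
  forall l0 l1, l0 <= l1 -> l1 <= M ->
  T i (p (a l0)) = a l0 -> height (T b) (a l1) <= r ->
  exists l, l0 <= l <= l1 /\ height (T j) (a l) <= C /\ height (T j') (a l) <= C.
Proof.
exists (K * (2 * k) + K * r + K).
intros N T v0 Hc b j j' i Hbj Hjj Hj1 Hji Hi M a Ha Hs l0 l1 Hl HM E0 H1.
set (P := fun l => exists i', j' <= i' /\ i' <= N /\ T i' (p (a l)) = a l).
destruct (@last_upto P l0 l1 Hl) as [l [Hl0 [[i1 [Hi1 [Hi1N E1]]] Hn]]].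
{ exists i; auto. }
destruct (Nat.eq_dec l l1) as [->|Hne].
- exists l1. split; [lia|]. rewrite <- E1 in H1 |- *. rewrite !height_sec in *.
  destruct (@chain_between N T v0 b j i1 (r) (p (a l1)) Hc); try lia.
  destruct (@chain_between N T v0 b j' i1 (r) (p (a l1)) Hc); try lia.
- exists l. split; [lia|]. destruct (Ha (S l) ltac:(lia)) as [i2 [Hi2 E2]].
  assert (Hi2j : i2 <= j).
  { destruct (le_lt_dec j' i2); [|lia]. exfalso. apply (Hn (S l)); [lia|]. exists i2; auto. }
  pose proof (Hs l ltac:(lia)) as Hd. rewrite <- E1, <- E2 in Hd.
  destruct (sec_close Hd) as [_ Hg]. rewrite gap_sym in Hg.
  rewrite <- E1, !height_sec.
  destruct (@chain_between N T v0 i2 j i1 (2 * k) (p (a l)) Hc); try lia.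
  destruct (@chain_between N T v0 i2 j' i1 (2 * k) (p (a l)) Hc); try lia.
Qed.

(** The point [q] is chosen before the path. If the sections [b] and [i] come close, it is the foot
    of [x]. Otherwise let [e] be the last section up to [i] close to [b]: the path crosses between
    [e] and [S e] over some [y], and by [foot_gate] the foot of [y] is near that of [v0], whatever
    [y] is. *)
Lemma section_gate_up (k r : nat) : exists C, forall N T v0, chain N T v0 ->
  forall b i x, b <= i -> i <= N -> exists q : B,
  forall M a, (forall l, l <= M -> on_chain N T (a l)) -> qgeo k M a ->
  a 0 = T i x -> height (T b) (a M) <= r ->
  exists l, l <= M /\ dist (a l) (T b q) <= C.
Proof.
destruct (chain_crossing k r) as [c Hcr].
destruct (flare_quasiconvex (2 * c + 1)) as [Q HQ].
assert (HD : s <= K * s + K) by nia.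
destruct (foot_gate Q HD) as [Cg Hg].
destruct (morse_pair k (r + c) (le_n s)) as [C HC].
exists (C + Cg). intros N T v0 Hc b i x Hbi HiN. pose proof Hc as [HT [_ Hv0]].
destruct (@last_upto (fun j => exists u, gap (T b) (T j) u <= s) b i Hbi) as [e [He [[ue Hue] Hn]]].
{ exists x. rewrite gap_self; lia. }
assert (Hex : forall a, exists u, foot (K * s + K) (T b) (T e) a u).
{ intros a. apply foot_exists. exists ue. nia. }
destruct (Nat.eq_dec e i) as [->|Hne].
- destruct (Hex x) as [q Hq]. exists q. intros M a Ha Hqg E0 EM.
  destruct (HC N T v0 Hc b i ltac:(lia) HiN ltac:(eauto) M a Ha Hqg x q) as [l [Hl Hd]];
    auto; try lia.
  { rewrite E0, (dist_refl connE); lia. }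
  exists l; split; auto; lia.
- destruct (Hex v0) as [g Hgg]. exists g. intros M a Ha Hqg E0 EM.
  destruct (Hcr N T v0 Hc b e (S e) i) with (M := M) (a := a) (l0 := 0) (l1 := M)
    as [l [Hl [L1 L2]]]; auto; try lia; [apply Hqg|rewrite E0, sec_proj; auto|].
  set (y := p (a l)). destruct (Hex y) as [w Hw].
  assert (Hy : gap (T e) (T (S e)) y <= 2 * c + 1).
  { unfold height in L1, L2. fold y in L1, L2. unfold gap.
    pose proof (dist_tri connE (T e y) (a l) (T (S e) y)).
    rewrite (dist_sym connE (T e y) (a l)) in *. lia. }
  assert (Hwg : dist w g <= Cg).
  { apply (Hg (T b) (T e) (T (S e)) y v0); try apply HT; try lia; auto.
    - intros u. destruct (le_lt_dec (gap (T b) (T (S e)) u) s); [|lia].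
      exfalso. apply (Hn (S e)); [lia|eauto].
    - intros t Ht _. apply (HQ (T e) (T (S e)) y v0); try apply HT; auto; try lia.
      specialize (Hv0 e ltac:(lia)). lia. }
  destruct (HC N T v0 Hc b e ltac:(lia) ltac:(lia) ltac:(eauto) (M - l) (fun j => a (l + j)))
    with (x := y) (u := w) as [l' [Hl' Hd]]; auto.
  + intros j Hj; apply Ha; lia.
  + apply (qgeo_sub Hqg); lia.
  + rewrite Nat.add_0_r. unfold height in L1. fold y in L1. lia.
  + replace (l + (M - l)) with M by lia; lia.
  + exists (l + l'). split; [lia|].
    pose proof (dist_tri connE (a (l + l')) (T b w) (T b g)). rewrite sec_dist in *. lia.
Qed.

Lemma section_gate (k r : nat) : exists C, forall N T v0, chain N T v0 ->
  forall b i x, b <= N -> i <= N -> exists q : B,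
  forall M a, (forall l, l <= M -> on_chain N T (a l)) -> qgeo k M a ->
  forall l0 l1, l0 <= l1 -> l1 <= M ->
  (a l0 = T i x /\ height (T b) (a l1) <= r) \/ (a l1 = T i x /\ height (T b) (a l0) <= r) ->
  exists l, l0 <= l <= l1 /\ dist (a l) (T b q) <= C.
Proof.
destruct (section_gate_up k r) as [C H]. exists C. intros N T v0 Hc b i x Hb Hi.
assert (H' : exists q : B, forall M a, (forall l, l <= M -> on_chain N T (a l)) -> qgeo k M a ->
  a 0 = T i x -> height (T b) (a M) <= r -> exists l, l <= M /\ dist (a l) (T b q) <= C).
{ destruct (le_lt_dec b i) as [Hbi|Hbi].
  - apply (H N T v0 Hc b i x); auto.
  - destruct (H N _ v0 (chain_rev Hc) (N - b) (N - i) x) as [q Hq]; try lia.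
    replace (N - (N - b)) with b in Hq by lia. replace (N - (N - i)) with i in Hq by lia.
    exists q. intros M a Ha. apply Hq. intros l Hl. apply on_chain_rev; auto. }
destruct H' as [q Hq]. exists q.
assert (Hq2 : forall M a, (forall l, l <= M -> on_chain N T (a l)) -> qgeo k M a ->
  forall l0 l1, l0 <= l1 -> l1 <= M -> a l0 = T i x -> height (T b) (a l1) <= r ->
  exists l, l0 <= l <= l1 /\ dist (a l) (T b q) <= C).
{ intros M a Ha Hqg l0 l1 Hl HM E0 E1.
  destruct (Hq (l1 - l0) (fun l => a (l0 + l))) as [l [Hl' Hd]].
  - intros l Hl'; apply Ha; lia.
  - apply (qgeo_sub Hqg); auto.
  - rewrite Nat.add_0_r; auto.
  - replace (l0 + (l1 - l0)) with l1 by lia; auto.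
  - exists (l0 + l); split; [lia|auto]. }
intros M a Ha Hqg l0 l1 Hl HM [[E0 E1]|[E1 E0]]; [apply (Hq2 M a); auto|].
destruct (Hq2 M (fun l => a (M - l))) with (l0 := M - l1) (l1 := M - l0) as [l [Hl' Hd]];
  try lia.
- intros l Hl'; apply Ha; lia.
- apply (qgeo_rev connE); auto.
- replace (M - (M - l1)) with l1 by lia; auto.
- replace (M - (M - l0)) with l0 by lia; auto.
- exists (M - l); split; [lia|auto].
Qed.

Lemma chain_crosses N T v0 k : chain N T v0 -> forall b i i', i <= b -> b <= i' -> i' <= N ->
  forall M a, (forall l, l <= M -> on_chain N T (a l)) -> steps k M a ->
  forall l0 l1, l0 <= l1 -> l1 <= M -> T i (p (a l0)) = a l0 -> T i' (p (a l1)) = a l1 ->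
  exists l, l0 <= l <= l1 /\ height (T b) (a l) <= K * (2 * k) + K.
Proof.
intros Hc b i i' Hib Hbi Hi M a Ha Hs l0 l1 Hl HM E0 E1.
set (P := fun l => exists j, j <= b /\ T j (p (a l)) = a l).
destruct (@last_upto P l0 l1 Hl) as [l [Hl0 [[j [Hj Ej]] Hn]]].
{ exists i; auto. }
exists l. split; [lia|]. destruct (Nat.eq_dec l l1) as [->|Hne].
- assert (Hg : gap (T j) (T i') (p (a l1)) <= 2 * k).
  { unfold gap. rewrite Ej, E1, (dist_refl connE); lia. }
  rewrite <- Ej, height_sec, gap_sym.
  destruct (@chain_between N T v0 j b i' (2 * k) (p (a l1)) Hc); auto.
- destruct (Ha (S l) ltac:(lia)) as [j' [Hj' Ej']].
  assert (b <= j').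
  { destruct (le_lt_dec j' b); [|lia]. exfalso. apply (Hn (S l)); [lia|]. exists j'; auto. }
  pose proof (Hs l ltac:(lia)) as Hd. rewrite <- Ej, <- Ej' in Hd.
  destruct (sec_close Hd) as [_ Hg].
  rewrite <- Ej, height_sec, gap_sym.
  destruct (@chain_between N T v0 j b j' (2 * k) (p (a l)) Hc); auto.
Qed.

(** Both paths enter and leave the section of the given point by the same gates, which depend only
    on the common ends, and between the gates both follow the same geodesic of that section. *)
Lemma chain_bigon_up (k : nat) : exists C, forall N T v0, chain N T v0 ->
  forall i i', i <= i' -> i' <= N -> forall M a P c,
  (forall l, l <= M -> on_chain N T (a l)) -> (forall l, l <= P -> on_chain N T (c l)) ->
  qgeo k M a -> qgeo k P c -> a 0 = c 0 -> a M = c P ->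
  T i (p (a 0)) = a 0 -> T i' (p (a M)) = a M ->
  forall l, l <= M -> nearp C P c (a l).
Proof.
set (c0 := K * (2 * k) + K).
destruct (morse_section k c0) as [C1 H1].
destruct (section_gate k (c0 + C1)) as [C2 H2].
destruct (section_segment k C2) as [C3 H3].
exists (2 * C3). intros N T v0 Hc i i' Hii Hi M a P c Ha Hcc Hqa Hqc E0 E1 Ei Ei' l Hl.
(* A point on a level outside the range of the ends belongs to an excursion beyond the section of
   one end, and [morse_section] keeps it near that section. *)
assert (Hb : exists b, i <= b /\ b <= i' /\ height (T b) (a l) <= C1).
{ destruct (Ha l Hl) as [j [Hj Ej]]. destruct (le_lt_dec i j) as [Hij|Hij].
  - destruct (le_lt_dec j i') as [Hji|Hji].
    + exists j; repeat split; auto. rewrite <- Ej, height_sec, gap_self; lia.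
    + exists i'; repeat split; auto.
      destruct (@chain_crosses N T v0 k Hc i' i j ltac:(lia) ltac:(lia) Hj M a Ha (proj1 Hqa) 0 l)
        as [l' [Hl' Hd]]; auto; try lia.
      apply (H1 N T v0 Hc i' Hi M a Ha Hqa l' l M); auto; try lia.
      rewrite <- Ei', height_sec, gap_self; lia.
  - exists i; repeat split; auto; try lia.
    destruct (@chain_crosses N T v0 k Hc i j i' ltac:(lia) ltac:(lia) Hi M a Ha (proj1 Hqa) l M)
      as [l' [Hl' Hd]]; auto; try lia.
    apply (H1 N T v0 Hc i ltac:(lia) M a Ha Hqa 0 l l'); auto; try lia.
    rewrite <- Ei, height_sec, gap_self; lia. }
destruct Hb as [b [Hib [Hbi Hh]]].
rewrite E0 in Ei. rewrite E1 in Ei'.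
destruct (@chain_crosses N T v0 k Hc b i i' Hib Hbi Hi P c Hcc (proj1 Hqc) 0 P)
  as [lc [Hlc Hhc]]; auto; try lia. fold c0 in Hhc.
destruct (H2 N T v0 Hc b i (p (c 0)) ltac:(lia) ltac:(lia)) as [qx Hqx].
destruct (H2 N T v0 Hc b i' (p (c P)) ltac:(lia) ltac:(lia)) as [qy Hqy].
destruct (Hqx M a Ha Hqa 0 l) as [lx [Hlx Dx]]; try lia.
{ left; split; [congruence|lia]. }
destruct (Hqy M a Ha Hqa l M) as [ly [Hly Dy]]; try lia.
{ right; split; [congruence|lia]. }
destruct (Hqx P c Hcc Hqc 0 lc) as [jx [Hjx Ex]]; try lia.
{ left; split; [congruence|lia]. }
destruct (Hqy P c Hcc Hqc lc P) as [jy [Hjy Ey]]; try lia.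
{ right; split; [congruence|lia]. }
destruct (H3 N T v0 Hc b ltac:(lia) M a Ha Hqa lx ly qx qy) as [S1 _]; try lia.
destruct (H3 N T v0 Hc b ltac:(lia) P c Hcc Hqc jx jy qx qy) as [_ S2]; try lia.
destruct (S1 l ltac:(lia)) as [t [Ht Dt]]. destruct (S2 t Ht) as [j [Hj Dj]].
exists j. split; [lia|]. pose proof (dist_tri connE (a l) (T b t) (c j)).
rewrite (dist_sym connE (T b t) (c j)) in *. lia.
Qed.

Lemma chain_bigon (k : nat) : exists C, forall N T v0, chain N T v0 ->
  forall M a P c,
  (forall l, l <= M -> on_chain N T (a l)) -> (forall l, l <= P -> on_chain N T (c l)) ->
  qgeo k M a -> qgeo k P c -> a 0 = c 0 -> a M = c P ->
  forall l, l <= M -> nearp C P c (a l).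
Proof.
destruct (chain_bigon_up k) as [C H]. exists C.
intros N T v0 Hc M a P c Ha Hcc Hqa Hqc E0 E1 l Hl.
destruct (Ha 0 ltac:(lia)) as [i [Hi Ei]]. destruct (Ha M ltac:(lia)) as [i' [Hi' Ei']].
destruct (le_lt_dec i i').
- apply (H N T v0 Hc i i') with (M := M); auto.
- apply (H N _ v0 (chain_rev Hc) (N - i) (N - i')) with (M := M); auto; try lia.
  + intros m Hm; apply on_chain_rev; auto.
  + intros m Hm; apply on_chain_rev; auto.
  + now replace (N - (N - i)) with i by lia.
  + now replace (N - (N - i')) with i' by lia.
Qed.

Lemma on_chain_extend N T M a x y : (forall l, l <= M -> on_chain N T (a l)) ->
  on_chain N T x -> on_chain N T y ->
  forall l, l <= M + 2 -> on_chain N T (extend M x y a l).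
Proof.
intros Ha Hx Hy [|l] Hl; [exact Hx|]. unfold extend. destruct (le_lt_dec l M); auto.
Qed.

Lemma chain_bigon_coarse (k r : nat) : exists C, forall N T v0, chain N T v0 ->
  forall M a P c x y,
  (forall l, l <= M -> on_chain N T (a l)) -> (forall l, l <= P -> on_chain N T (c l)) ->
  qgeo k M a -> qgeo k P c -> on_chain N T x -> on_chain N T y ->
  dist x (a 0) <= r -> dist (a M) y <= r -> dist x (c 0) <= r -> dist (c P) y <= r ->
  forall l, l <= M -> nearp C P c (a l).
Proof.
destruct (chain_bigon (k + 2 * k * r + 2 + 2 * r)) as [C H]. exists (C + r).
intros N T v0 Hc M a P c x y Ha Hcc Hqa Hqc Hx Hy D1 D2 D3 D4 l Hl.
pose proof (extend_shadow connE D3 D4) as Hsh.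
destruct (H N T v0 Hc (M + 2) (extend M x y a) (P + 2) (extend P x y c)) with (l := S l)
  as [j [Hj Hd]]; try lia.
- apply on_chain_extend; auto.
- apply on_chain_extend; auto.
- apply (qgeo_shadow connE Hqa), (extend_shadow connE D1 D2).
- apply (qgeo_shadow connE Hqc), Hsh.
- reflexivity.
- now rewrite !extend_end.
- rewrite extend_mid in Hd by auto. exists (Nat.min (j - 1) P). split; [lia|].
  specialize (Hsh j Hj).
  pose proof (dist_tri connE (a l) (extend P x y c j) (c (Nat.min (j - 1) P))). lia.
Qed.

(* The sides of the triangle all cross the section through the middle vertex [y]:
   they are compared to the triangle with vertices [qx], [p y], [qz] in that section. *)
Lemma chain_triangle_mid (k : nat) : exists C, forall N T v0, chain N T v0 ->
  forall i j l, i <= j -> j <= l -> l <= N ->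
  forall M a P c Q g,
  (forall m, m <= M -> on_chain N T (a m)) -> (forall m, m <= P -> on_chain N T (c m)) ->
  (forall m, m <= Q -> on_chain N T (g m)) -> qgeo k M a -> qgeo k P c -> qgeo k Q g ->
  a 0 = g 0 -> a M = c 0 -> c P = g Q ->
  T i (p (g 0)) = g 0 -> T j (p (c 0)) = c 0 -> T l (p (g Q)) = g Q ->
  (forall m, m <= M -> nearp C P c (a m) \/ nearp C Q g (a m)) /\
  (forall m, m <= Q -> nearp C M a (g m) \/ nearp C P c (g m)).
Proof.
set (c0 := K * (2 * k) + K).
destruct (section_gate k c0) as [C2 H2].
destruct (section_segment k C2) as [C3 H3].
destruct (chain_bigon_coarse k C2) as [C4 H4].
exists (C4 + 2 * C3 + d).
intros N T v0 Hc i j l Hij Hjl Hl M a P c Q g Ha Hcc Hg Hqa Hqc Hqg E0 E1 E2 Ei Ej El.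
destruct (H2 N T v0 Hc j i (p (g 0)) ltac:(lia) ltac:(lia)) as [qx Hqx].
destruct (H2 N T v0 Hc j l (p (g Q)) ltac:(lia) ltac:(lia)) as [qz Hqz]. clear H2.
destruct (@chain_crosses N T v0 k Hc j i l Hij Hjl Hl Q g Hg (proj1 Hqg) 0 Q)
  as [lc [Hlc Hhc]]; auto; try lia. fold c0 in Hhc.
assert (Hy0 : height (T j) (c 0) <= c0) by (rewrite <- Ej, height_sec, gap_self; lia).
destruct (Hqx M a Ha Hqa 0 M) as [lx [Hlx Dx]]; try lia.
{ left; split; [congruence|]. rewrite E1; auto. }
destruct (Hqx Q g Hg Hqg 0 lc) as [g1 [Hg1 Dg1]]; try lia.
{ left; split; [congruence|auto]. }
destruct (Hqz Q g Hg Hqg lc Q) as [g2 [Hg2 Dg2]]; try lia.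
{ right; split; [congruence|auto]. }
destruct (Hqz P c Hcc Hqc 0 P) as [lz [Hlz Dz]]; try lia.
{ right; split; [congruence|auto]. }
set (y := p (c 0)) in *.
assert (Hj : j <= N) by lia.
assert (Dy : dist (a M) (T j y) <= C2) by (rewrite E1, Ej, (dist_refl connE); lia).
assert (Dy' : dist (c 0) (T j y) <= C2) by (rewrite Ej, (dist_refl connE); lia).
destruct (H3 N T v0 Hc j Hj M a Ha Hqa lx M qx y) as [A1 A2]; try lia.
destruct (H3 N T v0 Hc j Hj P c Hcc Hqc 0 lz y qz) as [B1 B2]; try lia.
destruct (H3 N T v0 Hc j Hj Q g Hg Hqg g1 g2 qx qz) as [G1 G2]; try lia. clear H3.
assert (Hnear : forall R e z t t' u, dist z (T j t) <= C3 -> dist t t' <= d -> u <= R ->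
  dist (e u) (T j t') <= C3 -> nearp (C4 + 2 * C3 + d) R e z).
{ intros R e z t t' u X1 X2 X3 X4. exists u; split; auto.
  pose proof (dist_tri connE z (T j t) (e u)). pose proof (dist_tri connE (T j t) (T j t') (e u)).
  rewrite sec_dist, (dist_sym connE (T j t') (e u)) in *. lia. }
assert (Hx0 : on_chain N T (g 0)) by (apply Hg; lia).
assert (Hz0 : on_chain N T (g Q)) by (apply Hg; lia).
split; intros m Hm.
- destruct (le_lt_dec m lx) as [Hml|Hml].
  + right. destruct (H4 N T v0 Hc lx a g1 g (g 0) (T j qx)) with (l := m) as [u [Hu Du]]; auto.
    * intros; apply Ha; lia.
    * intros; apply Hg; lia.
    * split; [intros u Hu; apply Hqa; lia|intros u u' Hu Hu'; apply Hqa; lia].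
    * split; [intros u Hu; apply Hqg; lia|intros u u' Hu Hu'; apply Hqg; lia].
    * apply on_chain_sec; auto.
    * rewrite E0, (dist_refl connE); lia.
    * rewrite (dist_refl connE); lia.
    * exists u; split; lia.
  + destruct (A1 m ltac:(lia)) as [t [Ht Dt]].
    destruct (slim_btw connB hypB qz Ht) as [t' [[Ht'|Ht'] Dt']].
    * right. destruct (G2 t' Ht') as [u [Hu Du]]. apply (Hnear Q g _ t t' u); auto; lia.
    * left. apply (btw_sym connB) in Ht'. destruct (B2 t' Ht') as [u [Hu Du]].
      apply (Hnear P c _ t t' u); auto; lia.
- destruct (le_lt_dec m g1) as [Hml|Hml]; [|destruct (le_lt_dec m g2) as [Hml2|Hml2]].
  + left. destruct (H4 N T v0 Hc g1 g lx a (g 0) (T j qx)) with (l := m) as [u [Hu Du]]; auto.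
    * intros; apply Hg; lia.
    * intros; apply Ha; lia.
    * split; [intros u Hu; apply Hqg; lia|intros u u' Hu Hu'; apply Hqg; lia].
    * split; [intros u Hu; apply Hqa; lia|intros u u' Hu Hu'; apply Hqa; lia].
    * apply on_chain_sec; auto.
    * rewrite (dist_refl connE); lia.
    * rewrite E0, (dist_refl connE); lia.
    * exists u; split; lia.
  + destruct (G1 m ltac:(lia)) as [t [Ht Dt]].
    destruct (slim_btw connB hypB y Ht) as [t' [[Ht'|Ht'] Dt']].
    * left. destruct (A2 t' Ht') as [u [Hu Du]]. apply (Hnear M a _ t t' u); auto; lia.
    * right. destruct (B2 t' Ht') as [u [Hu Du]]. apply (Hnear P c _ t t' u); auto; lia.
  + right. destruct (H4 N T v0 Hc (Q - g2) (fun u => g (g2 + u)) (P - lz) (fun u => c (lz + u))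
      (T j qz) (g Q)) with (l := m - g2) as [u [Hu Du]]; auto; try lia.
    * intros; apply Hg; lia.
    * intros; apply Hcc; lia.
    * apply (qgeo_sub Hqg); lia.
    * apply (qgeo_sub Hqc); lia.
    * apply on_chain_sec; auto.
    * rewrite Nat.add_0_r, (dist_sym connE); auto.
    * replace (g2 + (Q - g2)) with Q by lia. rewrite (dist_refl connE); lia.
    * rewrite Nat.add_0_r, (dist_sym connE); auto.
    * replace (lz + (P - lz)) with P by lia. rewrite E2, (dist_refl connE); lia.
    * replace (g2 + (m - g2)) with m in Du by lia. exists (lz + u); split; lia.
Qed.

Lemma chain_triangle (k : nat) : exists C, forall N T v0, chain N T v0 ->
  forall M a P c Q g,
  (forall m, m <= M -> on_chain N T (a m)) -> (forall m, m <= P -> on_chain N T (c m)) ->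
  (forall m, m <= Q -> on_chain N T (g m)) -> qgeo k M a -> qgeo k P c -> qgeo k Q g ->
  a 0 = c 0 -> c P = g 0 -> g Q = a M ->
  forall m, m <= M -> nearp C P c (a m) \/ nearp C Q g (a m).
Proof.
destruct (chain_triangle_mid k) as [C H]. exists C.
assert (Hup : forall N T v0, chain N T v0 -> forall i j l, i <= j -> j <= N -> l <= N ->
  forall M a P c Q g,
  (forall m, m <= M -> on_chain N T (a m)) -> (forall m, m <= P -> on_chain N T (c m)) ->
  (forall m, m <= Q -> on_chain N T (g m)) -> qgeo k M a -> qgeo k P c -> qgeo k Q g ->
  a 0 = c 0 -> c P = g 0 -> g Q = a M ->
  T i (p (a 0)) = a 0 -> T j (p (a M)) = a M -> T l (p (g 0)) = g 0 ->
  forall m, m <= M -> nearp C P c (a m) \/ nearp C Q g (a m)).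
{ intros N T v0 Hc i j l Hij Hj Hl M a P c Q g Ha Hcc Hg Hqa Hqc Hqg E0 E1 E2 Ei Ej El m Hm.
  pose proof (qgeo_rev connE Hqa) as Ra. pose proof (qgeo_rev connE Hqg) as Rg.
  (* The corner on the middle level decides which side is the long one in [chain_triangle_mid]. *)
  destruct (le_lt_dec j l) as [Hjl|Hjl]; [|destruct (le_lt_dec i l) as [Hil|Hil]].
  - destruct (H N T v0 Hc i j l Hij Hjl Hl M a Q (fun u => g (Q - u)) P c) as [K1 _];
      auto; try (intros; apply Hg; lia);
      rewrite ?Nat.sub_0_r, ?Nat.sub_diag; auto; try congruence.
    destruct (K1 m Hm) as [K2|K2]; auto. right; apply nearp_reverse; auto.
  - destruct (H N T v0 Hc i l j Hil ltac:(lia) Hj P c Q g M a) as [_ K1]; auto; congruence.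
  - pose proof (chain_rev Hc) as Hr.
    assert (X : forall z, on_chain N T z -> on_chain N (fun i => T (N - i)) z)
      by (intros; apply on_chain_rev; auto).
    destruct (H N _ v0 Hr (N - j) (N - i) (N - l) ltac:(lia) ltac:(lia) ltac:(lia)
      M (fun u => a (M - u)) P c Q (fun u => g (Q - u))) as [K1 _];
      auto; try (intros; apply X; first [apply Hg|apply Ha]; lia);
      rewrite ?Nat.sub_0_r, ?Nat.sub_diag; auto; try congruence.
    { replace (N - (N - j)) with j by lia. congruence. }
    { replace (N - (N - i)) with i by lia. congruence. }
    { replace (N - (N - l)) with l by lia. congruence. }
    destruct (K1 (M - m) ltac:(lia)) as [K2|K2]; replace (M - (M - m)) with m in K2 by lia; auto.
    right; apply nearp_reverse; auto. }
intros N T v0 Hc M a P c Q g Ha Hcc Hg Hqa Hqc Hqg E0 E1 E2 m Hm.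
destruct (Ha 0 ltac:(lia)) as [i [Hi Ei]]. destruct (Ha M ltac:(lia)) as [j [Hj Ej]].
destruct (Hg 0 ltac:(lia)) as [l [Hl El]].
destruct (le_lt_dec i j) as [Hij|Hij].
- apply (Hup N T v0 Hc i j l) with (M := M); auto.
- apply (Hup N _ v0 (chain_rev Hc) (N - i) (N - j) (N - l)) with (M := M); auto; try lia;
    try (intros; apply on_chain_rev; auto).
  + now replace (N - (N - i)) with i by lia.
  + now replace (N - (N - j)) with j by lia.
  + now replace (N - (N - l)) with l by lia.
Qed.

(** * Ladders *)

Lemma fiber_eq (v : B) (x y : fiber p v) : in_total x = in_total y -> x = y.
Proof.
destruct x as [x Hx], y as [y Hy]. unfold in_total; simpl. intros ->.
f_equal. apply proof_irrelevance.
Qed.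

Lemma fiber_proj (v : B) (x : fiber p v) : p (in_total x) = v.
Proof. exact (proj2_sig x). Qed.

Definition ladder (T1 T2 : bundle_section p) (c : forall u, nat -> fiber p u) : Prop :=
  tight T1 /\ tight T2 /\ forall u, geodesic (sec_fiber T1 u) (sec_fiber T2 u) (c u).

Definition rung (T1 T2 : bundle_section p) (u : B) : nat :=
  dist (sec_fiber T1 u) (sec_fiber T2 u).

Definition on_ladder (T1 T2 : bundle_section p) (c : forall u, nat -> fiber p u) (z : E) : Prop :=
  exists i, i <= rung T1 T2 (p z) /\ in_total (c (p z) i) = z.

Section Ladder.

Variables (T1 T2 : bundle_section p) (c : forall u, nat -> fiber p u).
Hypothesis lad : ladder T1 T2 c.

Notation len := (rung T1 T2).
Notation pt u i := (in_total (c u i)).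

Lemma rung_dist u i j : i <= j -> j <= len u -> dist (c u i) (c u j) = j - i.
Proof. intros Hi Hj. apply (proj2 (proj2 lad) u); auto. Qed.

Lemma rung_dist_abs u i j : i <= len u -> j <= len u -> dist (c u i) (c u j) = (j - i) + (i - j).
Proof.
intros Hi Hj. destruct (le_lt_dec i j).
- rewrite rung_dist; lia.
- rewrite (dist_sym (@connF u)), rung_dist; lia.
Qed.

Lemma rung_inj u i j : i <= len u -> j <= len u -> c u i = c u j -> i = j.
Proof.
intros Hi Hj Heq. pose proof (rung_dist_abs Hi Hj) as H.
rewrite Heq, (dist_refl (@connF u)) in H. lia.
Qed.

(** A tight section inside the ladder, encoded by its positions on the rungs, which can be compared
    pointwise. *)
Definition level (h : B -> nat) : Prop :=
  (forall u, h u <= len u) /\ exists T, tight T /\ forall u, T u = pt u (h u).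

Definition seg (h1 h2 : B -> nat) (u : B) (y : fiber p u) : Prop :=
  exists i, h1 u <= i /\ i <= h2 u /\ c u i = y.

Definition is_proj (h1 h2 : B -> nat) (u : B) (z q : fiber p u) : Prop :=
  seg h1 h2 q /\ forall y, seg h1 h2 y -> dist z q <= dist z y + 1.

Lemma level_geodesic h1 h2 u : level h1 -> level h2 -> h1 u <= h2 u ->
  geodesic (c u (h1 u)) (c u (h2 u)) (fun j => c u (h1 u + j)).
Proof.
intros [H1 _] [H2 _] Hle. apply (geodesic_sub (proj2 (proj2 lad) u)); auto.
Qed.

Lemma seg_on_geodesic h1 h2 u y : level h1 -> level h2 -> h1 u <= h2 u ->
  (seg h1 h2 y <-> on_geodesic (c u (h1 u)) (c u (h2 u)) (fun j => c u (h1 u + j)) y).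
Proof.
intros [H1 _] [H2 _] Hle. unfold on_geodesic. rewrite rung_dist by auto. split.
- intros [i [Hi [Hi2 <-]]]. exists (i - h1 u). split; [lia|]. f_equal; lia.
- intros [i [Hi <-]]. exists (h1 u + i). repeat split; lia.
Qed.

Lemma is_proj_step h1 h2 : level h1 -> level h2 -> (forall u, h1 u <= h2 u) ->
  forall v v' (z q : fiber p v) (z' q' : fiber p v'),
  adj (in_total z) (in_total z') \/ in_total z = in_total z' ->
  is_proj h1 h2 z q -> is_proj h1 h2 z' q' -> dist (in_total q) (in_total q') <= K.
Proof.
intros L1 L2 Hle v v' z q z' q' Hz Hq Hq'.
assert (Hv : v = v' \/ adj v v' /\ adj (in_total z) (in_total z')).
{ destruct Hz as [Ha|He].
  - destruct (bundle_simplicial bun Ha) as [Hp|Hp]; rewrite !fiber_proj in Hp; auto.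
  - left. apply (f_equal p) in He. rewrite !fiber_proj in He; auto. }
destruct Hv as [<-|[Hv Ha]].
- pose proof (fiber_dist q q'). enough (dist q q' <= 4 * d + 7) by lia.
  apply (@projection_lipschitz _ (@connF v) d (@hypF v) (@seg h1 h2 v) z z').
  + destruct Hz as [Ha|He].
    * apply (dist_adj (@connF v)). exact Ha.
    * apply fiber_eq in He. rewrite He, (dist_refl (@connF v)). lia.
  + apply Hq.
  + apply Hq'.
  + destruct Hq as [[i [Hi1 [Hi2 <-]]] _], Hq' as [[j [Hj1 [Hj2 <-]]] _].
    pose proof (proj1 L2 v). rewrite rung_dist_abs by lia. intros m Hm.
    destruct (le_lt_dec i j).
    * exists (c v (i + m)). unfold btw. rewrite !rung_dist_abs by lia.
      split; [exists (i + m); repeat split; lia|lia].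
    * exists (c v (i - m)). unfold btw. rewrite !rung_dist_abs by lia.
      split; [exists (i - m); repeat split; lia|lia].
- enough (dist (in_total q) (in_total q') <= kap) by lia.
  pose proof L1 as [B1 [S1 [HS1 E1]]]. pose proof L2 as [B2 [S2 [HS2 E2]]].
  apply (@retraction v v' (c v (h1 v)) (c v (h2 v)) z (c v' (h1 v')) (c v' (h2 v')) z')
    with (c := fun j => c v (h1 v + j)) (c' := fun j => c v' (h1 v' + j)).
  + rewrite <- !E1. now apply sec_adj.
  + rewrite <- !E2. now apply sec_adj.
  + exact Ha.
  + apply level_geodesic; auto.
  + apply level_geodesic; auto.
  + destruct Hq as [Hs Hq]. apply nearest_projection.
    * apply seg_on_geodesic; auto.
    * intros y Hy. apply Hq. apply seg_on_geodesic; auto.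
  + destruct Hq' as [Hs Hq']. apply nearest_projection.
    * apply seg_on_geodesic; auto.
    * intros y Hy. apply Hq'. apply seg_on_geodesic; auto.
Qed.

Lemma nearest_in_seg h1 h2 u (z : fiber p u) : h1 u <= h2 u ->
  exists q, seg h1 h2 q /\ forall y, seg h1 h2 y -> dist z q <= dist z y.
Proof.
intros H. apply nearest_exists. exists (c u (h1 u)), (h1 u); auto.
Qed.

Lemma is_proj_exists h1 h2 u (z : fiber p u) : h1 u <= h2 u -> exists q, is_proj h1 h2 z q.
Proof.
intros H. destruct (nearest_in_seg z H) as [q [Hq Hn]]. exists q; split; auto.
intros y Hy; specialize (Hn y Hy); lia.
Qed.

Lemma is_proj_dist h1 h2 : level h1 -> level h2 -> (forall u, h1 u <= h2 u) ->
  forall v v' (z q : fiber p v) (z' q' : fiber p v'),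
  is_proj h1 h2 z q -> is_proj h1 h2 z' q' ->
  dist (in_total q) (in_total q') <= K * dist (in_total z) (in_total z') + K.
Proof.
intros L1 L2 Hle.
assert (H : forall n x y, walk n x y -> forall v v' (z q : fiber p v) (z' q' : fiber p v'),
  in_total z = x -> in_total z' = y -> is_proj h1 h2 z q -> is_proj h1 h2 z' q' ->
  dist (in_total q) (in_total q') <= K * n + K).
{ induction 1 as [x|n x y w Ha W IH]; intros v v' z q z' q' <- E2 Hq Hq'.
  - enough (dist (in_total q) (in_total q') <= K) by lia.
    apply (is_proj_step L1 L2 Hle (z := z) (z' := z')); auto.
  - set (y' := exist _ y eq_refl : fiber p (p y)).
    destruct (@is_proj_exists h1 h2 (p y) y' (Hle _)) as [r Hr].
    assert (dist (in_total q) (in_total r) <= K).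
    { apply (is_proj_step L1 L2 Hle (z := z) (z' := y')); auto. }
    assert (dist (in_total r) (in_total q') <= K * n + K) by (apply (IH _ _ y' r z' q'); auto).
    pose proof (dist_tri connE (in_total q) (in_total r) (in_total q')). nia. }
intros v v' z q z' q' Hq Hq'.
apply (H _ _ _ (dist_walk connE (in_total z) (in_total z')) v v' z q z' q'); auto.
Qed.

(** For points of the ladder this is the projection to the subladder between [h1] and [h2]. *)
Definition clamp (h1 h2 : B -> nat) (u : B) (i : nat) : nat := Nat.max (h1 u) (Nat.min i (h2 u)).

Lemma clamp_is_proj h1 h2 u i : (forall u, h1 u <= h2 u) -> (forall u, h2 u <= len u) ->
  i <= len u -> is_proj h1 h2 (c u i) (c u (clamp h1 h2 u i)).
Proof.
intros Hle H2 Hi. specialize (Hle u). specialize (H2 u). split.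
- exists (clamp h1 h2 u i). unfold clamp. repeat split; lia.
- intros y [j [Hj1 [Hj2 <-]]]. unfold clamp. rewrite !rung_dist_abs; lia.
Qed.

Lemma clamp_dist h1 h2 : level h1 -> level h2 -> (forall u, h1 u <= h2 u) ->
  forall u u' i i', i <= len u -> i' <= len u' ->
  dist (pt u (clamp h1 h2 u i)) (pt u' (clamp h1 h2 u' i')) <=
  K * dist (pt u i) (pt u' i') + K.
Proof.
intros L1 L2 Hle u u' i i' Hi Hi'. pose proof (proj1 L2).
apply (is_proj_dist L1 L2 Hle); apply clamp_is_proj; auto.
Qed.

Lemma level_zero : level (fun _ => 0).
Proof.
split; [intros; lia|]. exists T1. split; [apply lad|]. intros u.
destruct (proj2 (proj2 lad) u) as [H0 _]. rewrite H0. reflexivity.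
Qed.

Lemma level_len : level len.
Proof.
split; [auto|]. exists T2. split; [apply lad|]. intros u.
destruct (proj2 (proj2 lad) u) as [_ [Hn _]]. unfold rung. rewrite Hn. reflexivity.
Qed.

Lemma level_insert h1 h2 : level h1 -> level h2 -> (forall u, h1 u <= h2 u) ->
  forall v i, h1 v <= i -> i <= h2 v ->
  exists h, level h /\ (forall u, h1 u <= h u <= h2 u) /\ h v = i.
Proof.
intros L1 L2 Hle v i Hi1 Hi2.
pose proof L1 as [B1 [S1 [HS1 E1]]]. pose proof L2 as [B2 [S2 [HS2 E2]]].
assert (F1 : forall u, sec_fiber S1 u = c u (h1 u)) by (intros; apply fiber_eq, E1).
assert (F2 : forall u, sec_fiber S2 u = c u (h2 u)) by (intros; apply fiber_eq, E2).
destruct (@robust S1 S2 HS1 HS2 (fun u j => c u (h1 u + j))) with (v := v) (x := c v i)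
  as [Sx [HSx [Ex Hx]]].
- intros u. rewrite F1, F2. apply level_geodesic; auto.
- rewrite F1, F2. apply (seg_on_geodesic (c v i) L1 L2 (Hle v)). exists i; auto.
- assert (Hseg : forall u, exists j, h1 u <= j /\ j <= h2 u /\ c u j = sec_fiber Sx u).
  { intros u. specialize (Hx u). rewrite F1, F2 in Hx.
    apply (seg_on_geodesic _ L1 L2 (Hle u)) in Hx. exact Hx. }
  set (h := fun u => epsilon (inhabits 0) (fun j => h1 u <= j /\ j <= h2 u /\ c u j = sec_fiber Sx u)).
  assert (Hh : forall u, h1 u <= h u /\ h u <= h2 u /\ c u (h u) = sec_fiber Sx u).
  { intros u. apply (epsilon_spec (inhabits 0) _ (Hseg u)). }
  exists h. split; [split|split].
  + intros u. destruct (Hh u) as [_ [H _]]. specialize (B2 u). lia.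
  + exists Sx. split; auto. intros u. destruct (Hh u) as [_ [_ H]]. rewrite H. reflexivity.
  + intros u. destruct (Hh u) as [? [? _]]. lia.
  + destruct (Hh v) as [_ [H3 H4]]. specialize (B2 v).
    apply (@rung_inj v); try lia. rewrite H4. apply fiber_eq. exact Ex.
Qed.

(** Each new point lies between two consecutive levels over its base point. Robustness, applied to
    the subladder between them, inserts a level there without disturbing the order over any other
    vertex. *)
Lemma levels_through (F : list (B * nat)) : (forall u i, In (u, i) F -> i <= len u) ->
  exists N (H : nat -> B -> nat), (forall j, j <= N -> level (H j)) /\
  (forall i j u, i <= j -> j <= N -> H i u <= H j u) /\
  (forall u, H 0 u = 0) /\ (forall u, H N u = len u) /\
  forall u i, In (u, i) F -> exists j, j <= N /\ H j u = i.
Proof.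
induction F as [|[v i] F IH]; intros HF.
- exists 1, (fun j u => if Nat.eq_dec j 0 then 0 else len u). repeat split.
  + destruct Nat.eq_dec; intros; lia.
  + destruct Nat.eq_dec; [apply level_zero|apply level_len].
  + intros i' j u Hi Hj. destruct (Nat.eq_dec i' 0), (Nat.eq_dec j 0); lia.
  + intros u i' [].
- destruct IH as [N [H [HL [Hm [H0 [HN HF']]]]]]; [intros; apply HF; simpl; auto|].
  assert (Hi : i <= len v) by (apply HF; simpl; auto).
  destruct (@last_upto (fun j => H j v <= i) 0 N) as [j [Hj [Hji Hn]]]; [lia|rewrite H0; lia|].
  destruct (Nat.eq_dec j N) as [->|Hne].
  + exists N, H. repeat split; auto; try (intros; apply HL; auto).
    intros u i' [Heq|Hin]; auto. injection Heq as <- <-. exists N. split; auto.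
    rewrite HN in *. lia.
  + specialize (Hn (S j) ltac:(lia)).
    destruct (@level_insert (H j) (H (S j))) with (v := v) (i := i) as [h [Lh [Hh Ehv]]];
      try lia; try (apply HL; lia); [intros u; apply Hm; lia|].
    set (H' := fun l => if le_lt_dec l j then H l else if Nat.eq_dec l (S j) then h else H (l - 1)).
    exists (S N), H'. split; [|split; [|split; [|split]]].
    * intros l Hl. unfold H'. destruct le_lt_dec; [apply HL; lia|].
      destruct Nat.eq_dec; [auto|apply HL; lia].
    * intros l l' u Hl Hl'. specialize (Hh u). unfold H'.
      pose proof (Hm l j u) as X1. pose proof (Hm (S j) (l' - 1) u) as X2.
      destruct (le_lt_dec l j), (le_lt_dec l' j); try lia.
      -- apply Hm; lia.
      -- destruct (Nat.eq_dec l' (S j)); lia.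
      -- destruct (Nat.eq_dec l (S j)), (Nat.eq_dec l' (S j)); try lia. apply Hm; lia.
    * intros u. unfold H'. destruct le_lt_dec; [auto|lia].
    * intros u. unfold H'. destruct le_lt_dec; [lia|]. destruct Nat.eq_dec; [lia|].
      rewrite <- HN. f_equal; lia.
    * intros u i' [Heq|Hin].
      -- injection Heq as <- <-. exists (S j). split; [lia|]. unfold H'.
         destruct le_lt_dec; [lia|]. destruct Nat.eq_dec; [auto|lia].
      -- destruct (HF' u i' Hin) as [l [Hl El]].
         destruct (le_lt_dec l j).
         ++ exists l. split; [lia|]. unfold H'. destruct le_lt_dec; [auto|lia].
         ++ exists (S l). split; [lia|]. unfold H'. destruct le_lt_dec; [lia|].
            destruct Nat.eq_dec; [lia|]. rewrite <- El. f_equal; lia.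
Qed.

(** Besides the points of [F], levels are taken through every point of the rung over [v0], which
    makes consecutive sections adjacent there. *)
Lemma ladder_chain (v0 : B) (F : list E) : (forall z, In z F -> on_ladder T1 T2 c z) ->
  exists N T, chain N T v0 /\ forall z, In z F -> on_chain N T z.
Proof.
intros HF.
set (ix := fun z => epsilon (inhabits 0) (fun i => i <= len (p z) /\ pt (p z) i = z)).
assert (Hix : forall z, In z F -> ix z <= len (p z) /\ pt (p z) (ix z) = z).
{ intros z Hz. apply (epsilon_spec (inhabits 0) _ (HF z Hz)). }
destruct (@levels_through (map (fun z => (p z, ix z)) F ++ map (fun i => (v0, i)) (seq 0 (S (len v0)))))
  as [N [H [HL [Hm [H0 [HN Hc]]]]]].
{ intros u i Hin. apply in_app_or in Hin. destruct Hin as [Hin|Hin]; apply in_map_iff in Hin.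
  - destruct Hin as [z [Heq Hz]]. injection Heq as <- <-. apply Hix; auto.
  - destruct Hin as [j [Heq Hj]]. injection Heq as <- <-. apply in_seq in Hj. lia. }
set (T := fun j => epsilon (inhabits T1) (fun T => tight T /\ forall u, T u = pt u (H j u))).
assert (HT : forall j, j <= N -> tight (T j) /\ forall u, T j u = pt u (H j u)).
{ intros j Hj. apply (epsilon_spec (inhabits T1) _ (proj2 (HL j Hj))). }
assert (Hl : forall j u, j <= N -> H j u <= len u) by (intros; apply HL; auto).
exists N, T. split; [split; [|split]|].
- intros i Hi; apply HT; auto.
- intros i j l u Hi Hj Hlt. unfold gap.
  rewrite !(proj2 (HT i ltac:(lia))), !(proj2 (HT j ltac:(lia))), !(proj2 (HT l ltac:(lia))).
  pose proof (Hm i j u Hi ltac:(lia)). pose proof (Hm j l u Hj ltac:(lia)).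
  split.
  (* Clamping between [H i] and [H j] fixes [H i] and sends [H l] to [H j], so betweenness is the
     Lipschitz bound of a projection. *)
  + pose proof (@clamp_dist (H i) (H j) (HL i ltac:(lia)) (HL j ltac:(lia))
      (fun u => Hm i j u Hi ltac:(lia)) u u (H i u) (H l u) (Hl i u ltac:(lia)) (Hl l u Hlt)) as X.
    unfold clamp in X. replace (Nat.max (H i u) (Nat.min (H i u) (H j u))) with (H i u) in X by lia.
    replace (Nat.max (H i u) (Nat.min (H l u) (H j u))) with (H j u) in X by lia. exact X.
  + pose proof (@clamp_dist (H j) (H l) (HL j ltac:(lia)) (HL l ltac:(lia))
      (fun u => Hm j l u Hj ltac:(lia)) u u (H i u) (H l u) (Hl i u ltac:(lia)) (Hl l u Hlt)) as X.
    unfold clamp in X. replace (Nat.max (H j u) (Nat.min (H i u) (H l u))) with (H j u) in X by lia.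
    replace (Nat.max (H j u) (Nat.min (H l u) (H l u))) with (H l u) in X by lia. exact X.
- intros i Hi. unfold gap.
  rewrite !(proj2 (HT i ltac:(lia))), !(proj2 (HT (S i) ltac:(lia))).
  pose proof (Hm i (S i) v0 ltac:(lia) ltac:(lia)). pose proof (Hl (S i) v0 Hi).
  assert (H (S i) v0 <= H i v0 + 1).
  { destruct (le_lt_dec (H (S i) v0) (H i v0 + 1)); auto. exfalso.
    destruct (Hc v0 (S (H i v0))) as [j [Hj Ej]].
    { apply in_or_app. right. apply in_map_iff. exists (S (H i v0)). split; auto.
      apply in_seq. lia. }
    destruct (le_lt_dec j i); [pose proof (Hm j i v0)|pose proof (Hm (S i) j v0)]; lia. }
  pose proof (fiber_dist (c v0 (H i v0)) (c v0 (H (S i) v0))) as X.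
  rewrite rung_dist in X; lia.
- intros z Hz. destruct (Hix z Hz) as [_ Ez].
  destruct (Hc (p z) (ix z)) as [j [Hj Ej]].
  { apply in_or_app. left. apply in_map_iff. exists z; auto. }
  exists j. split; auto. rewrite (proj2 (HT j Hj)), Ej. exact Ez.
Qed.

End Ladder.

Definition near_ladder (k : nat) T1 T2 c (z : E) : Prop :=
  exists y, on_ladder T1 T2 c y /\ dist z y <= k.

(** The paths are moved onto the ladder and extended so that their ends agree exactly; the finitely
    many points obtained lie on one chain. *)
Lemma ladder_triangle (k : nat) : exists C, forall T1 T2 c, ladder T1 T2 c ->
  forall M a P b Q g,
  (forall m, m <= M -> near_ladder k T1 T2 c (a m)) ->
  (forall m, m <= P -> near_ladder k T1 T2 c (b m)) ->
  (forall m, m <= Q -> near_ladder k T1 T2 c (g m)) ->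
  qgeo k M a -> qgeo k P b -> qgeo k Q g ->
  dist (a 0) (b 0) <= k -> dist (b P) (g 0) <= k -> dist (g Q) (a M) <= k ->
  forall m, m <= M -> nearp C P b (a m) \/ nearp C Q g (a m).
Proof.
set (r := 2 * k). destruct (chain_triangle (k + 2 * k * r + 2 + 2 * r)) as [C H].
exists (2 * r + C). intros T1 T2 c Hl M a P b Q g Na Nb Ng Qa Qb Qg D1 D2 D3 m Hm.
set (rho := fun z => epsilon (inhabits z) (fun y => on_ladder T1 T2 c y /\ dist z y <= k)).
assert (Hrho : forall z, near_ladder k T1 T2 c z -> on_ladder T1 T2 c (rho z) /\ dist z (rho z) <= k).
{ intros z Hz. apply (epsilon_spec (inhabits z) _ Hz). }
pose proof (Hrho _ (Na 0 ltac:(lia))) as [X1 X2].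
pose proof (Hrho _ (Nb P ltac:(lia))) as [Y1 Y2].
pose proof (Hrho _ (Na M ltac:(lia))) as [Z1 Z2].
set (x := rho (a 0)) in *. set (w := rho (b P)) in *. set (y := rho (a M)) in *.
set (a' := extend M x y (fun i => rho (a i))). set (b' := extend P x w (fun i => rho (b i))).
set (g' := extend Q w y (fun i => rho (g i))).
assert (Sa : forall i, i <= M + 2 -> dist (a' i) (a (Nat.min (i - 1) M)) <= r).
{ apply extend_shadow_of; auto.
  - intros i Hi. rewrite (dist_sym connE). destruct (Hrho _ (Na i Hi)). unfold r; lia.
  - rewrite (dist_sym connE). unfold r; lia.
  - unfold r; lia. }
assert (Sb : forall i, i <= P + 2 -> dist (b' i) (b (Nat.min (i - 1) P)) <= r).
{ apply extend_shadow_of; auto.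
  - intros i Hi. rewrite (dist_sym connE). destruct (Hrho _ (Nb i Hi)). unfold r; lia.
  - pose proof (dist_tri connE x (a 0) (b 0)). rewrite (dist_sym connE x (a 0)) in *.
    unfold r; lia.
  - unfold r; lia. }
assert (Sg : forall i, i <= Q + 2 -> dist (g' i) (g (Nat.min (i - 1) Q)) <= r).
{ apply extend_shadow_of; auto.
  - intros i Hi. rewrite (dist_sym connE). destruct (Hrho _ (Ng i Hi)). unfold r; lia.
  - pose proof (dist_tri connE w (b P) (g 0)). rewrite (dist_sym connE w (b P)) in *.
    unfold r; lia.
  - pose proof (dist_tri connE (g Q) (a M) y). unfold r; lia. }
set (F := map a' (seq 0 (M + 3)) ++ map b' (seq 0 (P + 3)) ++ map g' (seq 0 (Q + 3))).
assert (Hext : forall n x0 y0 (f : nat -> E), on_ladder T1 T2 c x0 -> on_ladder T1 T2 c y0 ->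
  (forall i, i <= n -> on_ladder T1 T2 c (f i)) ->
  forall i, i <= n + 2 -> on_ladder T1 T2 c (extend n x0 y0 f i)).
{ intros n x0 y0 f Hx Hy Hf [|i] Hi; [exact Hx|]. unfold extend.
  destruct (le_lt_dec i n); auto. }
destruct (ladder_chain Hl (p x) (F := F)) as [N [T [Hc HF]]].
{ intros z Hz. unfold F in Hz. rewrite !in_app_iff, !in_map_iff in Hz.
  destruct Hz as [[i [<- Hi]]|[[i [<- Hi]]|[i [<- Hi]]]]; apply in_seq in Hi.
  - apply Hext; auto; [|lia]. intros j Hj; apply Hrho; auto.
  - apply Hext; auto; [|lia]. intros j Hj; apply Hrho; auto.
  - apply Hext; auto; [|lia]. intros j Hj; apply Hrho; auto. }
assert (Ia : forall i, i <= M + 2 -> In (a' i) F).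
{ intros i Hi. unfold F. rewrite !in_app_iff, !in_map_iff. left. exists i. split; auto.
  apply in_seq; lia. }
assert (Ib : forall i, i <= P + 2 -> In (b' i) F).
{ intros i Hi. unfold F. rewrite !in_app_iff, !in_map_iff. right; left. exists i. split; auto.
  apply in_seq; lia. }
assert (Ig : forall i, i <= Q + 2 -> In (g' i) F).
{ intros i Hi. unfold F. rewrite !in_app_iff, !in_map_iff. right; right. exists i. split; auto.
  apply in_seq; lia. }
pose proof (qgeo_shadow connE Qa Sa) as Ra. pose proof (qgeo_shadow connE Qb Sb) as Rb.
pose proof (qgeo_shadow connE Qg Sg) as Rg.
assert (Hfin : forall n (f f' : nat -> E) (z : E), (forall i, i <= n + 2 -> dist (f' i) (f (Nat.min (i - 1) n)) <= r) ->
  nearp C (n + 2) f' z -> nearp (r + C) n f z).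
{ intros n f f' z Hf [i [Hi Hd]]. exists (Nat.min (i - 1) n). split; [lia|].
  specialize (Hf i Hi). pose proof (dist_tri connE z (f' i) (f (Nat.min (i - 1) n))). lia. }
assert (Ham : dist (a m) (a' (S m)) <= r).
{ specialize (Sa (S m) ltac:(lia)). replace (Nat.min (S m - 1) M) with m in Sa by lia.
  rewrite (dist_sym connE). auto. }
assert (Hw : forall n (f : nat -> E), nearp (r + C) n f (a' (S m)) -> nearp (2 * r + C) n f (a m)).
{ intros n f [i [Hi Hd]]. exists i. split; auto.
  pose proof (dist_tri connE (a m) (a' (S m)) (f i)). lia. }
destruct (H N T (p x) Hc (M + 2) a' (P + 2) b' (Q + 2) g') with (m := S m) as [K1|K1]; auto; try lia.
- unfold b', g'. rewrite extend_end. reflexivity.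
- unfold g', a'. now rewrite !extend_end.
- left. apply Hw, (Hfin P b b'); auto.
- right. apply Hw, (Hfin Q g g'); auto.
Qed.

Lemma on_ladder_pt T1 T2 (c : forall u, nat -> fiber p u) u i : i <= rung T1 T2 u ->
  on_ladder T1 T2 c (in_total (c u i)).
Proof. intros Hi. exists i. rewrite fiber_proj. auto. Qed.

Lemma on_ladder_left T1 T2 c u : ladder T1 T2 c -> on_ladder T1 T2 c (T1 u).
Proof.
intros [_ [_ H]]. destruct (H u) as [H0 _]. change (T1 u) with (in_total (sec_fiber T1 u)).
rewrite <- H0. apply on_ladder_pt; lia.
Qed.

Lemma on_ladder_right T1 T2 c u : ladder T1 T2 c -> on_ladder T1 T2 c (T2 u).
Proof.
intros [_ [_ H]]. destruct (H u) as [_ [H1 _]]. change (T2 u) with (in_total (sec_fiber T2 u)).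
rewrite <- H1. apply on_ladder_pt. unfold rung; lia.
Qed.

Lemma ladder_exists T1 T2 : tight T1 -> tight T2 -> exists c, ladder T1 T2 c.
Proof.
intros H1 H2.
exists (fun u => epsilon (inhabits (fun _ => sec_fiber T1 u)) (geodesic (sec_fiber T1 u) (sec_fiber T2 u))).
split; [auto|split; [auto|]]. intros u.
apply (epsilon_spec (inhabits (fun _ => sec_fiber T1 u)) _ (geodesic_exists (@connF u) _ _)).
Qed.

Lemma rung_sym T1 T2 u : rung T1 T2 u = rung T2 T1 u.
Proof. apply (dist_sym (@connF u)). Qed.

Lemma ladder_rev T1 T2 c : ladder T1 T2 c ->
  ladder T2 T1 (fun u j => c u (rung T1 T2 u - j)).
Proof.
intros [H1 [H2 H3]]. split; [auto|split; [auto|]]. intros u.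
apply (geodesic_rev (@connF u) (H3 u)).
Qed.

Lemma on_ladder_rev T1 T2 (c : forall u, nat -> fiber p u) z : on_ladder T1 T2 c z ->
  on_ladder T2 T1 (fun u j => c u (rung T1 T2 u - j)) z.
Proof.
intros [i [Hi Ei]]. exists (rung T1 T2 (p z) - i). rewrite (rung_sym T2 T1). split; [lia|].
replace (rung T1 T2 (p z) - (rung T1 T2 (p z) - i)) with i by lia. auto.
Qed.

(** An exact nearest point is chosen in each fiber, without the slack of 1, so that points of the
    ladder are fixed. *)
Lemma ladder_retract T1 T2 c : ladder T1 T2 c -> exists rho : E -> E,
  (forall z, on_ladder T1 T2 c (rho z) /\ p (rho z) = p z) /\
  (forall z, on_ladder T1 T2 c z -> rho z = z) /\
  (forall z z', dist z z' <= 1 -> dist (rho z) (rho z') <= 2 * K).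
Proof.
intros Hl.
set (zf := fun z : E => exist _ z eq_refl : fiber p (p z)).
set (h1 := fun _ : B => 0). set (h2 := rung T1 T2).
set (Q := fun (z : E) (q : fiber p (p z)) =>
  seg c h1 h2 q /\ forall y, seg c h1 h2 y -> dist (zf z) q <= dist (zf z) y).
set (f := fun z => epsilon (inhabits (zf z)) (Q z)).
assert (Hf : forall z, Q z (f z)).
{ intros z. apply (epsilon_spec (inhabits (zf z)) (Q z)). apply nearest_in_seg. unfold h1; lia. }
exists (fun z => in_total (f z)). split; [|split].
- intros z. split; [|apply fiber_proj]. destruct (Hf z) as [[i [_ [Hi <-]]] _].
  apply on_ladder_pt; auto.
- intros z [i [Hi Ei]]. destruct (Hf z) as [_ Hn].
  assert (Ez : c (p z) i = zf z) by (apply fiber_eq; exact Ei).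
  specialize (Hn (c (p z) i)). rewrite Ez, (dist_refl (@connF (p z))) in Hn.
  assert (Heq : zf z = f z).
  { apply (dist_eq0 (@connF (p z))). enough (dist (zf z) (f z) <= 0) by lia. apply Hn.
    exists i. repeat split; auto. unfold h1; lia. }
  rewrite <- Heq. reflexivity.
- intros z z' Hd.
  assert (Hp : forall z, is_proj c h1 h2 (zf z) (f z)).
  { intros y. destruct (Hf y) as [Hs Hn]. split; auto. intros t Ht. specialize (Hn t Ht). lia. }
  assert (Hle : forall u, h1 u <= h2 u) by (intros; unfold h1; lia).
  pose proof (is_proj_dist Hl (level_zero Hl) (level_len Hl) Hle (Hp z) (Hp z')) as X.
  change (in_total (zf z)) with z in X. change (in_total (zf z')) with z' in X. nia.
Qed.

(** * Tripods of ladders *)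

(** The sum of the bounds in the cases of [trunc_half] and [trunc_lipschitz], taken instead of their
    maximum. *)
Definition trunc_const (km n : nat) : nat := n + km * n + (K * n + K) + (K * (n + km * n) + K).

Section Truncation.

Variables (T1 T2 : bundle_section p) (c : forall u, nat -> fiber p u).
Hypothesis lad : ladder T1 T2 c.
Variables (km : nat) (hm : B -> nat).
Notation len := (rung T1 T2).
Notation pt u i := (in_total (c u i)).
Hypothesis hm_le : forall u, hm u <= len u.
Hypothesis hm_lip : forall u u', dist (pt u (hm u)) (pt u' (hm u')) <= km * dist u u'.

(* The tight section through [pt u' (hm u')] separates [pt u i] from [pt u' i'], unless it
   passes below [pt u i]; then [pt u i] lies between it and [pt u (hm u)]. *)
Lemma trunc_half (n : nat) u i u' i' : i <= hm u -> hm u' <= i' -> i' <= len u' ->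
  dist (pt u i) (pt u' i') <= n -> dist (pt u i) (pt u' (hm u')) <= trunc_const km n.
Proof.
intros Hi Hi' Hl' Hn.
assert (Huu : dist u u' <= n).
{ pose proof (proj_lipschitz (pt u i) (pt u' i')) as H. rewrite !fiber_proj in H. lia. }
destruct (level_insert lad (level_zero lad) (level_len lad) (fun w => Nat.le_0_l _)
  (Nat.le_0_l (hm u')) (hm_le u')) as [h [Lh [Hh Eh]]].
pose proof (proj1 Lh) as Hhl. pose proof (hm_le u).
destruct (le_lt_dec i (h u)) as [Hih|Hih].
- assert (Hil : i <= len u) by lia.
  pose proof (clamp_dist lad (level_zero lad) Lh (fun w => Nat.le_0_l _) Hil Hl') as X. unfold clamp in X.
  replace (Nat.max 0 (Nat.min i (h u))) with i in X by lia.
  replace (Nat.max 0 (Nat.min i' (h u'))) with (hm u') in X by lia.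
  unfold trunc_const. nia.
- assert (Hil : i <= len u) by lia.
  destruct (level_insert lad (level_zero lad) (level_len lad) (fun w => Nat.le_0_l _)
    (Nat.le_0_l i) Hil) as [h' [Lh' [Hh' Eh']]].
  pose proof (proj1 Lh' u).
  pose proof (clamp_dist lad Lh' (level_len lad) (proj1 Lh') (Hhl u) (hm_le u)) as X. unfold clamp in X.
  replace (Nat.max (h' u) (Nat.min (h u) (len u))) with i in X by lia.
  replace (Nat.max (h' u) (Nat.min (hm u) (len u))) with (hm u) in X by lia.
  assert (Y : dist (pt u (h u)) (pt u (hm u)) <= n + km * n).
  { destruct Lh as [_ [Sh [_ ESh]]].
    assert (Z : dist (pt u (h u)) (pt u' (hm u')) <= n).
    { rewrite <- Eh, <- !ESh, sec_dist; auto. }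
    pose proof (hm_lip u' u) as W. rewrite (dist_sym connB u' u) in W.
    pose proof (dist_tri connE (pt u (h u)) (pt u' (hm u')) (pt u (hm u))). nia. }
  pose proof (hm_lip u u') as W.
  pose proof (dist_tri connE (pt u i) (pt u (hm u)) (pt u' (hm u'))).
  unfold trunc_const. nia.
Qed.

(** The marks [hm] need not trace a tight section, so the bound for [clamp] does not apply to them.
    On one side of the marks either both points stay or both move to marks; points on opposite sides
    are the case of [trunc_half]. *)
Lemma trunc_lipschitz (n : nat) u i u' i' : i <= len u -> i' <= len u' ->
  dist (pt u i) (pt u' i') <= n ->
  dist (pt u (Nat.min i (hm u))) (pt u' (Nat.min i' (hm u'))) <= trunc_const km n.
Proof.
intros Hi Hi' Hn.
assert (Huu : dist u u' <= n).
{ pose proof (proj_lipschitz (pt u i) (pt u' i')) as H. rewrite !fiber_proj in H. lia. }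
destruct (le_lt_dec i (hm u)), (le_lt_dec i' (hm u')).
- rewrite !Nat.min_l by auto. unfold trunc_const; lia.
- rewrite Nat.min_l, Nat.min_r by lia. apply trunc_half with (i' := i'); auto; lia.
- rewrite Nat.min_r, Nat.min_l by lia. rewrite (dist_sym connE).
  apply trunc_half with (i' := i); auto; try lia. rewrite (dist_sym connE); auto.
- rewrite !Nat.min_r by lia. pose proof (hm_lip u u'). unfold trunc_const. nia.
Qed.

(** By the last clause a point of the leg that is near any point of [m] is already near the end of
    the leg. *)
Definition leg (k N : nat) (z : nat -> E) (m : B -> E) (x : E) (w : B) : Prop :=
  z 0 = x /\ dist (z N) (m w) <= k /\ qgeo k N z /\
  forall l w', l <= N -> N - l <= dist (z l) (m w') + k.

(** The part of the ladder below the marks is a coarse Lipschitz retract of [E]: retract to the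
    ladder, then truncate. A shortest path in it to the marks is a leg. Staying below the marks is
    what will keep the leg near a second ladder of the tripod. *)
Lemma leg_exists (e : nat) (m : B -> E) : (forall u, dist (m u) (pt u (hm u)) <= e) ->
  forall u0, exists N z w, leg (trunc_const km (2 * K) + e + 1) N z m (T1 u0) w /\
    forall l, l <= N -> exists u i, i <= hm u /\ z l = pt u i.
Proof.
intros Hm u0.
destruct (ladder_retract lad) as [rho [R1 [R2 R3]]].
set (A := fun z => exists i, i <= hm (p z) /\ pt (p z) i = z).
assert (HApt : forall u i, i <= hm u -> A (pt u i)).
{ intros u i Hi. exists i. rewrite fiber_proj. auto. }
set (ix := fun z => epsilon (inhabits 0) (fun i => i <= len (p z) /\ pt (p z) i = z)).
assert (Hix : forall z, on_ladder T1 T2 c z -> ix z <= len (p z) /\ pt (p z) (ix z) = z).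
{ intros z Hz. apply (epsilon_spec (inhabits 0) _ Hz). }
set (tau := fun z => pt (p (rho z)) (Nat.min (ix (rho z)) (hm (p (rho z))))).
destruct (@shortest_path E connE A (fun z => exists w, z = pt w (hm w)) tau
  (trunc_const km (2 * K)) (T1 u0)) as [N [z [Z0 [[w Zw] [ZA [Zs [Zd ZN]]]]]]].
- intros z. apply HApt. lia.
- intros z [i [Hi Ei]]. unfold tau.
  assert (Hz : on_ladder T1 T2 c z). { exists i. pose proof (hm_le (p z)). split; [lia|auto]. }
  rewrite (R2 z Hz). destruct (Hix z Hz) as [I1 I2].
  assert (ix z = i).
  { pose proof (hm_le (p z)). apply (rung_inj lad (u := p z)); try lia.
    apply fiber_eq. congruence. }
  rewrite Nat.min_l by lia. auto.
- intros z z' Hd. unfold tau.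
  destruct (Hix _ (proj1 (R1 z))) as [I1 I2], (Hix _ (proj1 (R1 z'))) as [J1 J2].
  apply trunc_lipschitz; auto. rewrite I2, J2. auto.
- destruct (proj2 (proj2 lad) u0) as [H0 _].
  change (T1 u0) with (in_total (sec_fiber T1 u0)). rewrite <- H0. apply HApt. lia.
- exists (pt u0 (hm u0)), u0; auto.
- intros z [w ->]. apply HApt; auto.
- exists N, z, w. split.
  + split; [auto|split; [|split]].
    * rewrite Zw, (dist_sym connE). specialize (Hm w). lia.
    * split.
      -- intros i Hi. specialize (Zs i Hi). lia.
      -- intros i j Hi Hj. specialize (Zd i j Hi Hj). nia.
    * intros l w' Hl. specialize (ZN l _ Hl (ex_intro _ w' eq_refl)). specialize (Hm w').
      pose proof (dist_tri connE (z l) (m w') (pt w' (hm w'))). lia.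
  + intros l Hl. destruct (ZA l Hl) as [i [Hi Ei]]. exists (p (z l)), i. auto.
Qed.

Lemma ladder_path_meets (k M : nat) (a : nat -> E) : steps k M a ->
  (forall l, l <= M -> on_ladder T1 T2 c (a l)) ->
  (exists u, a 0 = T1 u) -> (exists u, a M = T2 u) ->
  exists l w, l <= M /\ dist (a l) (pt w (hm w)) <= trunc_const km k.
Proof.
intros Hs Ha [u0 E0] [u1 E1].
set (P := fun l => exists u i, i <= hm u /\ a l = pt u i).
destruct (@last_upto P 0 M) as [l [Hl [[u [i [Hi Ei]]] Hn]]]; [lia| |].
{ exists u0, 0. split; [lia|]. destruct (proj2 (proj2 lad) u0) as [H0 _].
  rewrite E0, H0. reflexivity. }
destruct (Nat.eq_dec l M) as [->|Hne].
- exists M, u. split; auto. assert (Hu : u = u1).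
  { apply (f_equal p) in E1, Ei. rewrite sec_proj in E1. rewrite fiber_proj in Ei. congruence. }
  subst u1. assert (i = len u).
  { apply (rung_inj lad (u := u)); auto; [specialize (hm_le u); lia|].
    apply fiber_eq. destruct (proj2 (proj2 lad) u) as [_ [H1 _]]. unfold rung. rewrite H1.
    transitivity (a M); auto. }
  assert (hm u = i) by (specialize (hm_le u); lia).
  rewrite Ei. rewrite H0, (dist_refl connE). lia.
- destruct (Ha (S l) ltac:(lia)) as [i' [Hi' Ei']]. set (u' := p (a (S l))) in *.
  assert (hm u' < i').
  { destruct (le_lt_dec i' (hm u')); auto. exfalso. apply (Hn (S l)); [lia|].
    exists u', i'; auto. }
  exists l, u'. split; [lia|]. rewrite Ei.
  apply trunc_half with (i' := i'); auto; [lia|]. rewrite <- Ei, Ei'. apply Hs; lia.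
Qed.

End Truncation.

Definition coarse_section (k : nat) (m : B -> E) : Prop :=
  (forall u, p (m u) = u) /\ forall u u', dist (m u) (m u') <= k * dist u u'.

Lemma coarse_section_qgeo k m u v e : coarse_section k m -> geodesic u v e ->
  qgeo (k + 1) (dist u v) (fun i => m (e i)).
Proof.
intros [Hp Hm] [_ [_ Hd]]. split.
- intros i Hi. pose proof (Hm (e i) (e (S i))) as X.
  rewrite Hd in X by lia. replace (S i - i) with 1 in X by lia. lia.
- intros i j Hi Hj. pose proof (proj_lipschitz (m (e i)) (m (e j))) as X.
  rewrite !Hp, Hd in X by lia. nia.
Qed.

Lemma near_ladder_mono k k' T1 T2 c z : k <= k' ->
  near_ladder k T1 T2 c z -> near_ladder k' T1 T2 c z.
Proof. intros Hk [y [Hy Hd]]. exists y; split; auto; lia. Qed.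

(** The leg, the side up to its point near [m], and [m] along a geodesic of the base form a slim
    triangle. Points of the leg close to [m] are among its last [J] steps and are compared with the
    point [J] steps before the end. *)
Lemma leg_near_side (k : nat) : exists C, forall T1 T2 c, ladder T1 T2 c ->
  forall m, coarse_section k m -> (forall u, near_ladder k T1 T2 c (m u)) ->
  forall N z x w, leg k N z m x w -> (forall l, l <= N -> near_ladder k T1 T2 c (z l)) ->
  forall M b, qgeo k M b -> (forall l, l <= M -> near_ladder k T1 T2 c (b l)) -> b 0 = x ->
  forall j w0, j <= M -> dist (b j) (m w0) <= k ->
  forall l, l <= N -> nearp C M b (z l).
Proof.
destruct (ladder_triangle (k + 1)) as [C HC]. set (J := C + k + 1).
exists (C + k * J). intros T1 T2 c Hl m Hcs Hmn N z x w [Z0 [ZN [Zq Zf]]] Zn M b Bq Bn B0 j w0 Hj Hw.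
destruct (geodesic_exists connB w0 w) as [e He].
pose proof (coarse_section_qgeo Hcs He) as Mq. pose proof He as [E0 [En _]].
assert (near : forall l, l <= N -> nearp C j b (z l) \/ N - l < J).
{ intros l Hll.
  destruct (HC T1 T2 c Hl N z j b (dist w0 w) (fun i => m (e i))) with (m := l) as [X|[i [Hi X]]];
    auto.
  - intros i Hi. apply near_ladder_mono with (k := k); auto; lia.
  - intros i Hi. apply near_ladder_mono with (k := k); [lia|apply Bn; lia].
  - intros i Hi. apply near_ladder_mono with (k := k); auto; lia.
  - apply (qgeo_mono (k := k)); auto; lia.
  - apply (qgeo_mono (k := k)); [lia|]. destruct Bq as [Bs Bq].
    split; [intros i Hi; apply Bs; lia|intros i i' Hi Hi'; apply Bq; lia].
  - rewrite Z0, B0, (dist_refl connE); lia.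
  - rewrite E0. lia.
  - rewrite En, (dist_sym connE). lia.
  - right. specialize (Zf l (e i) Hll). unfold J; lia. }
intros l Hll. destruct (near l Hll) as [[i [Hi X]]|Hlt].
{ exists i; split; [lia|lia]. }
destruct (le_lt_dec J N) as [HJ|HJ].
- destruct (near (N - J) ltac:(lia)) as [[i [Hi X]]|]; [|lia].
  exists i. split; [lia|]. destruct Zq as [Zs _].
  pose proof (steps_dist connE Zs (i := N - J) (j := l) ltac:(lia) Hll) as Y.
  assert (k * (l - (N - J)) <= k * J) by (apply Nat.mul_le_mono_l; lia).
  pose proof (dist_tri connE (z l) (z (N - J)) (b i)).
  rewrite (dist_sym connE (z l) (z (N - J))) in *. lia.
- exists 0. split; [lia|]. destruct Zq as [Zs _].
  pose proof (steps_dist connE Zs (i := 0) (j := l) ltac:(lia) Hll) as Y.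
  assert (k * (l - 0) <= k * J) by (apply Nat.mul_le_mono_l; lia).
  rewrite B0, <- Z0, (dist_sym connE). lia.
Qed.

(** A bigon between [m] and a piece of the side, treated as a triangle whose third side is
    constant. *)
Lemma coarse_section_near_side (k : nat) : exists C, forall T1 T2 c, ladder T1 T2 c ->
  forall m, coarse_section k m -> (forall u, near_ladder k T1 T2 c (m u)) ->
  forall M b, qgeo k M b -> (forall l, l <= M -> near_ladder k T1 T2 c (b l)) ->
  forall w1 w2, nearp k M b (m w1) -> nearp k M b (m w2) ->
  forall t, btw w1 t w2 -> nearp C M b (m t).
Proof.
destruct (ladder_triangle (k + 1)) as [C HC]. exists C.
assert (ord : forall T1 T2 c, ladder T1 T2 c ->
  forall m, coarse_section k m -> (forall u, near_ladder k T1 T2 c (m u)) ->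
  forall M b, qgeo k M b -> (forall l, l <= M -> near_ladder k T1 T2 c (b l)) ->
  forall w1 w2 i j, i <= j -> j <= M -> dist (m w1) (b i) <= k -> dist (m w2) (b j) <= k ->
  forall t, btw w1 t w2 -> nearp C M b (m t)).
{ intros T1 T2 c Hl m Hcs Hmn M b Bq Bn w1 w2 i j Hij Hj D1 D2 t Ht.
  destruct (geodesic_through connB Ht) as [e [He Et]].
  pose proof (coarse_section_qgeo Hcs He) as Mq. pose proof He as [E0 [En _]].
  destruct (HC T1 T2 c Hl (dist w1 w2) (fun i => m (e i)) (j - i) (fun l => b (i + l)) 0 (fun _ => b j))
    with (m := dist w1 t) as [[l [Hll X]]|[l [Hll X]]].
  - intros l Hll. apply near_ladder_mono with (k := k); auto; lia.
  - intros l Hll. apply near_ladder_mono with (k := k); [lia|apply Bn; lia].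
  - intros l Hll. apply near_ladder_mono with (k := k); [lia|apply Bn; lia].
  - exact Mq.
  - apply (qgeo_mono (k := k)); [lia|]. apply (qgeo_sub Bq); auto.
  - split; [intros l Hll; lia|intros; lia].
  - rewrite E0, Nat.add_0_r. lia.
  - replace (i + (j - i)) with j by lia. rewrite (dist_refl connE); lia.
  - rewrite En, (dist_sym connE). lia.
  - unfold btw in Ht; lia.
  - rewrite Et in X. exists (i + l). split; [lia|auto].
  - rewrite Et in X. exists j. split; [lia|auto]. }
intros T1 T2 c Hl m Hcs Hmn M b Bq Bn w1 w2 [i [Hi D1]] [j [Hj D2]] t Ht.
destruct (le_lt_dec i j).
- apply (ord T1 T2 c Hl m Hcs Hmn M b Bq Bn w1 w2 i j); auto.
- apply (ord T1 T2 c Hl m Hcs Hmn M b Bq Bn w2 w1 j i); auto; try lia.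
  apply (btw_sym connB); auto.
Qed.

Lemma ladder_geodesic T1 T2 c x y : ladder T1 T2 c -> on_ladder T1 T2 c x -> on_ladder T1 T2 c y ->
  exists N a, a 0 = x /\ a N = y /\ (forall l, l <= N -> on_ladder T1 T2 c (a l)) /\
    qgeo (2 * K) N a.
Proof.
intros Hl Hx Hy. destruct (ladder_retract Hl) as [rho [R1 [R2 R3]]].
destruct (@shortest_path E connE (on_ladder T1 T2 c) (fun z => z = y) rho (2 * K) x)
  as [N [a [A0 [AN [AA [As [Ad _]]]]]]]; auto.
- intros z; apply R1.
- eauto.
- intros m ->; auto.
- exists N, a. split; [auto|split; [auto|split; [auto|split; [auto|]]]].
  intros i j Hi Hj. specialize (Ad i j Hi Hj). nia.
Qed.

Lemma lipschitz_of_adjacent (k : nat) (f : B -> E) :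
  (forall u u', adj u u' -> dist (f u) (f u') <= k) ->
  forall u u', dist (f u) (f u') <= k * dist u u'.
Proof.
intros H u u'. destruct (walk_path connB (dist_walk connB u u')) as [c [C0 [Cn Cs]]].
assert (Hs : steps k (dist u u') (fun i => f (c i))).
{ intros i Hi. destruct (dist_le1 connB (Cs i Hi)) as [Heq|Ha]; [|apply H; auto].
  rewrite Heq, (dist_refl connE); lia. }
pose proof (steps_dist connE Hs (Nat.le_0_l _) (le_n _)) as X.
cbv beta in X. rewrite C0, Cn, Nat.sub_0_r in X. exact X.
Qed.

Lemma near_ladder_of_fiber T1 T2 (c : forall u, nat -> fiber p u) k u (x : fiber p u) :
  nearp k (rung T1 T2 u) (c u) x -> near_ladder k T1 T2 c (in_total x).
Proof.
intros [i [Hi Hd]]. exists (in_total (c u i)). split; [apply on_ladder_pt; auto|].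
pose proof (fiber_dist x (c u i)). lia.
Qed.

Lemma near_ladder_of_on k T1 T2 c z : on_ladder T1 T2 c z -> near_ladder k T1 T2 c z.
Proof. intros Hz. exists z. rewrite (dist_refl connE). split; [auto|lia]. Qed.

(** The barycenter over [u] is a point of the first rung nearest to [Tz u] in the fiber; the
    fiberwise retraction makes these choices [kap]-Lipschitz over the base. *)
Lemma tripod_center Tx Ty Tz c1 c2 c3 : ladder Tx Ty c1 -> ladder Ty Tz c2 -> ladder Tz Tx c3 ->
  exists h1 h2 h3 : B -> nat,
  (forall u, h1 u <= rung Tx Ty u) /\ (forall u, h2 u <= rung Ty Tz u) /\
  (forall u, h3 u <= rung Tz Tx u) /\
  (forall u u', dist (in_total (c1 u (h1 u))) (in_total (c1 u' (h1 u'))) <= kap * dist u u') /\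
  forall u,
    dist (c1 u (h1 u)) (c2 u (h2 u)) <= 7 * d + 2 /\
    dist (c1 u (h1 u)) (c3 u (h3 u)) <= 7 * d + 2 /\
    (forall i, i <= h1 u -> nearp (7 * d + 2) (rung Tz Tx u) (c3 u) (c1 u i)) /\
    (forall i, i <= h2 u -> nearp (7 * d + 2) (rung Tx Ty u) (c1 u) (c2 u i)) /\
    (forall i, i <= h3 u -> nearp (7 * d + 2) (rung Ty Tz u) (c2 u) (c3 u i)).
Proof.
intros L1 L2 L3.
set (P := fun u h => h <= rung Tx Ty u /\ forall i, i <= rung Tx Ty u ->
  dist (sec_fiber Tz u) (c1 u h) <= dist (sec_fiber Tz u) (c1 u i)).
assert (HP : forall u, exists h, P u h).
{ intros u. destruct (nearest_exists (sec_fiber Tz u)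
    (A := fun y => exists i, i <= rung Tx Ty u /\ c1 u i = y)) as [y [[h [Hh <-]] Hn]].
  - exists (c1 u 0), 0. split; auto; lia.
  - exists h. split; auto. intros i Hi. apply Hn. eauto. }
set (h1 := fun u => epsilon (inhabits 0) (P u)).
assert (H1 : forall u, P u (h1 u)) by (intros u; apply (epsilon_spec (inhabits 0) _ (HP u))).
assert (HC := fun u => triangle_center (@connF u) (@hypF u) (proj2 (proj2 L1) u)
  (proj2 (proj2 L2) u) (proj2 (proj2 L3) u) (proj1 (H1 u)) (proj2 (H1 u))).
set (R := fun u (t : nat * nat) =>
  fst t <= rung Ty Tz u /\ snd t <= rung Tz Tx u /\
    dist (c1 u (h1 u)) (c2 u (fst t)) <= 7 * d + 2 /\
    dist (c1 u (h1 u)) (c3 u (snd t)) <= 7 * d + 2 /\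
    (forall i, i <= h1 u -> nearp (7 * d + 2) (rung Tz Tx u) (c3 u) (c1 u i)) /\
    (forall i, i <= fst t -> nearp (7 * d + 2) (rung Tx Ty u) (c1 u) (c2 u i)) /\
    (forall i, i <= snd t -> nearp (7 * d + 2) (rung Ty Tz u) (c2 u) (c3 u i))).
set (t := fun u => epsilon (inhabits (0, 0)) (R u)).
assert (Ht : forall u, R u (t u)).
{ intros u. apply (epsilon_spec (inhabits (0, 0)) (R u)).
  destruct (HC u) as [h2 [h3 HR]]. exists (h2, h3). exact HR. }
exists h1, (fun u => fst (t u)), (fun u => snd (t u)). repeat split; try (intros; apply Ht; auto).
- intros u; apply H1.
- apply lipschitz_of_adjacent. intros u u' Ha.
  apply (@retraction u u' (sec_fiber Tx u) (sec_fiber Ty u) (sec_fiber Tz u)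
    (sec_fiber Tx u') (sec_fiber Ty u') (sec_fiber Tz u')) with (c := c1 u) (c' := c1 u').
  + apply (sec_adj Tx Ha).
  + apply (sec_adj Ty Ha).
  + apply (sec_adj Tz Ha).
  + apply L1.
  + apply L1.
  + apply nearest_projection; [exists (h1 u); split; [apply H1|auto]|].
    intros y [i [Hi <-]]. pose proof (proj2 (H1 u) i Hi). lia.
  + apply nearest_projection; [exists (h1 u'); split; [apply H1|auto]|].
    intros y [i [Hi <-]]. pose proof (proj2 (H1 u') i Hi). lia.
Qed.

Lemma leg_mono k k' N z m x w : k <= k' -> leg k N z m x w -> leg k' N z m x w.
Proof.
intros Hk [H1 [H2 [H3 H4]]]. split; [auto|split; [lia|split]].
- apply (qgeo_mono Hk H3).
- intros l w' Hl. specialize (H4 l w' Hl). lia.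
Qed.

(* Each side of the tripod passes near the section [m] of barycenters of the fiberwise
   triangles; the legs are shortest paths from the corners to [m]. *)
Lemma tripod_slim (k : nat) : exists C, forall Tx Ty Tz c1 c2 c3,
  ladder Tx Ty c1 -> ladder Ty Tz c2 -> ladder Tz Tx c3 ->
  forall M a P b Q g, qgeo k M a -> qgeo k P b -> qgeo k Q g ->
  (forall l, l <= M -> on_ladder Tx Ty c1 (a l)) ->
  (forall l, l <= P -> on_ladder Ty Tz c2 (b l)) ->
  (forall l, l <= Q -> on_ladder Tz Tx c3 (g l)) ->
  forall u v w, a 0 = Tx u -> a M = Ty v -> b 0 = Ty v -> b P = Tz w -> g 0 = Tz w -> g Q = Tx u ->
  forall l, l <= M -> nearp C P b (a l) \/ nearp C Q g (a l).
Proof.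
set (cf := 7 * d + 2). set (km := kap + 2 * cf).
set (k1 := trunc_const km (2 * K) + cf + 1).
set (k2 := k + k1 + km + 2 * cf + trunc_const km k + 2 * K + 1).
destruct (leg_near_side k2) as [C2 HC2].
set (k3 := k2 + C2).
destruct (coarse_section_near_side k3) as [C3 HC3].
destruct (ladder_triangle k3) as [C1 HC1].
exists (2 * C1 + C2 + km * d + C3).
intros Tx Ty Tz c1 c2 c3 L1 L2 L3 M a P b Q g Qa Qb Qg Ha Hb Hg u v w Ea0 Ea1 Eb0 Eb1 Eg0 Eg1 l Hl.
destruct (tripod_center L1 L2 L3) as [h1 [h2 [h3 [B1 [B2 [B3 [Hlip Hc]]]]]]].
set (m := fun x => in_total (c1 x (h1 x))).
assert (M2 : forall x, dist (m x) (in_total (c2 x (h2 x))) <= cf).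
{ intros x. pose proof (fiber_dist (c1 x (h1 x)) (c2 x (h2 x))). pose proof (Hc x). unfold m, cf. lia. }
assert (M3 : forall x, dist (m x) (in_total (c3 x (h3 x))) <= cf).
{ intros x. pose proof (fiber_dist (c1 x (h1 x)) (c3 x (h3 x))). pose proof (Hc x). unfold m, cf. lia. }
assert (Madj : forall x x', adj x x' -> dist (m x) (m x') <= kap).
{ intros x x' Hx. specialize (Hlip x x'). pose proof (dist_adj connB Hx). unfold m. nia. }
assert (Lip1 : forall x x', dist (in_total (c1 x (h1 x))) (in_total (c1 x' (h1 x'))) <= km * dist x x').
{ intros x x'. specialize (Hlip x x'). unfold km. nia. }
assert (Lip2 : forall x x', dist (in_total (c2 x (h2 x))) (in_total (c2 x' (h2 x'))) <= km * dist x x').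
{ apply (lipschitz_of_adjacent (f := fun x => in_total (c2 x (h2 x)))). intros x x' Hx.
  specialize (Madj x x' Hx). pose proof (M2 x). pose proof (M2 x').
  pose proof (dist_tri connE (in_total (c2 x (h2 x))) (m x) (in_total (c2 x' (h2 x')))).
  pose proof (dist_tri connE (m x) (m x') (in_total (c2 x' (h2 x')))).
  rewrite (dist_sym connE (in_total (c2 x (h2 x))) (m x)) in *. unfold km. lia. }
assert (Lip3 : forall x x', dist (in_total (c3 x (h3 x))) (in_total (c3 x' (h3 x'))) <= km * dist x x').
{ apply (lipschitz_of_adjacent (f := fun x => in_total (c3 x (h3 x)))). intros x x' Hx.
  specialize (Madj x x' Hx). pose proof (M3 x). pose proof (M3 x').
  pose proof (dist_tri connE (in_total (c3 x (h3 x))) (m x) (in_total (c3 x' (h3 x')))).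
  pose proof (dist_tri connE (m x) (m x') (in_total (c3 x' (h3 x')))).
  rewrite (dist_sym connE (in_total (c3 x (h3 x))) (m x)) in *. unfold km. lia. }
assert (Hcs : forall k', km <= k' -> coarse_section k' m).
{ intros k' Hk. split; [intros; apply fiber_proj|]. intros x x'. specialize (Lip1 x x').
  fold (m x) (m x') in Lip1. assert (km * dist x x' <= k' * dist x x') by (apply Nat.mul_le_mono_r; auto). lia. }
assert (Mon1 : forall k' x, near_ladder k' Tx Ty c1 (m x)).
{ intros k' x. apply near_ladder_of_on. apply on_ladder_pt; auto. }
assert (Mon2 : forall k' x, cf <= k' -> near_ladder k' Ty Tz c2 (m x)).
{ intros k' x Hk. exists (in_total (c2 x (h2 x))). split; [apply on_ladder_pt; auto|].
  specialize (M2 x). lia. }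
assert (Mon3 : forall k' x, cf <= k' -> near_ladder k' Tz Tx c3 (m x)).
{ intros k' x Hk. exists (in_total (c3 x (h3 x))). split; [apply on_ladder_pt; auto|].
  specialize (M3 x). lia. }
destruct (@leg_exists Tx Ty c1 L1 km h1 B1 Lip1 cf m) with (u0 := u) as [Nx [zx [wx [Zx Ix]]]].
{ intros x. unfold m. rewrite (dist_refl connE). lia. }
destruct (@leg_exists Ty Tz c2 L2 km h2 B2 Lip2 cf m M2 v) as [Ny [zy [wy [Zy Iy]]]].
destruct (@leg_exists Tz Tx c3 L3 km h3 B3 Lip3 cf m M3 w) as [Nz [zz [wz [Zz Iz]]]].
fold k1 in Zx, Zy, Zz.
assert (Zx' : leg k2 Nx zx m (Tx u) wx) by (apply (leg_mono (k := k1)); auto; unfold k2; lia).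
assert (Zy' : leg k2 Ny zy m (Ty v) wy) by (apply (leg_mono (k := k1)); auto; unfold k2; lia).
assert (Zz' : leg k2 Nz zz m (Tz w) wz) by (apply (leg_mono (k := k1)); auto; unfold k2; lia).
assert (X1 : forall k' i, i <= Nx -> near_ladder k' Tx Ty c1 (zx i)).
{ intros k' i Hi. destruct (Ix i Hi) as [x [j [Hj ->]]]. apply near_ladder_of_on, on_ladder_pt.
  specialize (B1 x). lia. }
assert (X3 : forall k' i, cf <= k' -> i <= Nx -> near_ladder k' Tz Tx c3 (zx i)).
{ intros k' i Hk Hi. destruct (Ix i Hi) as [x [j [Hj ->]]].
  apply (near_ladder_mono Hk), near_ladder_of_fiber. apply Hc; auto. }
assert (Y2 : forall k' i, i <= Ny -> near_ladder k' Ty Tz c2 (zy i)).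
{ intros k' i Hi. destruct (Iy i Hi) as [x [j [Hj ->]]]. apply near_ladder_of_on, on_ladder_pt.
  specialize (B2 x). lia. }
assert (Y1 : forall k' i, cf <= k' -> i <= Ny -> near_ladder k' Tx Ty c1 (zy i)).
{ intros k' i Hk Hi. destruct (Iy i Hi) as [x [j [Hj ->]]].
  apply (near_ladder_mono Hk), near_ladder_of_fiber. apply Hc; auto. }
assert (Z3 : forall k' i, i <= Nz -> near_ladder k' Tz Tx c3 (zz i)).
{ intros k' i Hi. destruct (Iz i Hi) as [x [j [Hj ->]]]. apply near_ladder_of_on, on_ladder_pt.
  specialize (B3 x). lia. }
assert (Z2 : forall k' i, cf <= k' -> i <= Nz -> near_ladder k' Ty Tz c2 (zz i)).
{ intros k' i Hk Hi. destruct (Iz i Hi) as [x [j [Hj ->]]].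
  apply (near_ladder_mono Hk), near_ladder_of_fiber. apply Hc; auto. }
assert (Qa2 : qgeo k2 M a) by (apply (qgeo_mono (k := k)); auto; unfold k2; lia).
assert (Qb2 : qgeo k2 P b) by (apply (qgeo_mono (k := k)); auto; unfold k2; lia).
assert (Qg2 : qgeo k2 Q g) by (apply (qgeo_mono (k := k)); auto; unfold k2; lia).
destruct (@ladder_path_meets Ty Tz c2 L2 km h2 B2 Lip2 k P b) as [jb [wb [Hjb Db]]];
  eauto; [apply Qb|].
destruct (@ladder_path_meets Tz Tx c3 L3 km h3 B3 Lip3 k Q g) as [jg [wg [Hjg Dg]]];
  eauto; [apply Qg|].
assert (Db' : dist (b jb) (m wb) <= k2).
{ pose proof (dist_tri connE (b jb) (in_total (c2 wb (h2 wb))) (m wb)). specialize (M2 wb).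
  rewrite (dist_sym connE (in_total (c2 wb (h2 wb))) (m wb)) in *. unfold k2; lia. }
assert (Dg' : dist (g jg) (m wg) <= k2).
{ pose proof (dist_tri connE (g jg) (in_total (c3 wg (h3 wg))) (m wg)). specialize (M3 wg).
  rewrite (dist_sym connE (in_total (c3 wg (h3 wg))) (m wg)) in *. unfold k2; lia. }
assert (Hcf : cf <= k2) by (unfold k2; lia). assert (Hkm : km <= k2) by (unfold k2; lia).
assert (SX : forall i, i <= Nx -> nearp C2 Q g (zx i)).
{ intros i Hi. apply nearp_reverse.
  apply (HC2 Tz Tx c3 L3 m (Hcs k2 Hkm) (fun x => Mon3 k2 x Hcf) Nx zx (Tx u) wx Zx'
    (fun i Hi => X3 k2 i Hcf Hi) Q (fun j => g (Q - j)) (qgeo_rev connE Qg2)) with (j := Q - jg) (w0 := wg);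
    auto; try lia.
  - intros j Hj. apply near_ladder_of_on, Hg; lia.
  - rewrite Nat.sub_0_r; auto.
  - replace (Q - (Q - jg)) with jg by lia; auto. }
assert (SZg : forall i, i <= Nz -> nearp C2 Q g (zz i)).
{ intros i Hi.
  apply (HC2 Tz Tx c3 L3 m (Hcs k2 Hkm) (fun x => Mon3 k2 x Hcf) Nz zz (Tz w) wz Zz'
    (fun i Hi => Z3 k2 i Hi) Q g Qg2) with (j := jg) (w0 := wg); auto.
  intros j Hj. apply near_ladder_of_on, Hg; lia. }
assert (SY : forall i, i <= Ny -> nearp C2 P b (zy i)).
{ intros i Hi.
  apply (HC2 Ty Tz c2 L2 m (Hcs k2 Hkm) (fun x => Mon2 k2 x Hcf) Ny zy (Ty v) wy Zy'
    (fun i Hi => Y2 k2 i Hi) P b Qb2) with (j := jb) (w0 := wb); auto.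
  intros j Hj. apply near_ladder_of_on, Hb; lia. }
assert (SZb : forall i, i <= Nz -> nearp C2 P b (zz i)).
{ intros i Hi. apply nearp_reverse.
  apply (HC2 Ty Tz c2 L2 m (Hcs k2 Hkm) (fun x => Mon2 k2 x Hcf) Nz zz (Tz w) wz Zz'
    (fun i Hi => Z2 k2 i Hcf Hi) P (fun j => b (P - j)) (qgeo_rev connE Qb2)) with (j := P - jb) (w0 := wb);
    auto; try lia.
  - intros j Hj. apply near_ladder_of_on, Hb; lia.
  - rewrite Nat.sub_0_r; auto.
  - replace (P - (P - jb)) with jb by lia; auto. }
assert (Hend : forall N z x x' n f, leg k2 N z m x x' -> (forall i, i <= N -> nearp C2 n f (z i)) ->
  nearp k3 n f (m x')).
{ intros N z x x' n f [_ [Hz _]] Hn. destruct (Hn N (le_n _)) as [i [Hi Hd]]. exists i. split; auto.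
  pose proof (dist_tri connE (m x') (z N) (f i)). rewrite (dist_sym connE (m x') (z N)) in *.
  unfold k3; lia. }
assert (Hk3 : k2 <= k3) by (unfold k3; lia).
assert (Hkm3 : km <= k3) by lia. assert (Hcf3 : cf <= k3) by lia.
assert (Gm : forall t, btw wx t wz -> nearp C3 Q g (m t)).
{ apply (HC3 Tz Tx c3 L3 m (Hcs k3 Hkm3) (fun x => Mon3 k3 x Hcf3) Q g); eauto.
  - apply (qgeo_mono Hk3 Qg2).
  - intros j Hj. apply near_ladder_of_on, Hg; lia. }
assert (Bm : forall t, btw wz t wy -> nearp C3 P b (m t)).
{ apply (HC3 Ty Tz c2 L2 m (Hcs k3 Hkm3) (fun x => Mon2 k3 x Hcf3) P b); eauto.
  - apply (qgeo_mono Hk3 Qb2).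
  - intros j Hj. apply near_ladder_of_on, Hb; lia. }
(* The path [D] is a diagonal of the quadrilateral formed by [a], two legs and the piece of [m]
   between them; it gives two triangles in one ladder. *)
destruct (@ladder_geodesic Tx Ty c1 (m wx) (Ty v) L1) as [Nd [D [D0 [D1 [Dl Dq]]]]].
{ apply on_ladder_pt; auto. }
{ apply on_ladder_right; auto. }
assert (Dq3 : qgeo k3 Nd D) by (apply (qgeo_mono (k := 2 * K)); auto; unfold k3, k2; lia).
assert (Hcomb : forall C' n (f : nat -> E) (y z : E), dist y z <= 2 * C1 -> C' <= C2 + km * d + C3 -> nearp C' n f z ->
  nearp (2 * C1 + C2 + km * d + C3) n f y).
{ intros C' n f y z Hyz HC' [i [Hi Hd]]. exists i. split; auto.
  pose proof (dist_tri connE y z (f i)). lia. }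
pose proof Zx' as [Zx0 [ZxN [Zxq _]]]. pose proof Zy' as [Zy0 [ZyN [Zyq _]]].
destruct (HC1 Tx Ty c1 L1 M a Nx zx Nd D) with (m := l) as [[i [Hi Hd]]|[i [Hi Hd]]]; auto.
- intros j Hj. apply near_ladder_of_on, Ha; lia.
- intros j Hj. apply near_ladder_of_on, Dl; lia.
- apply (qgeo_mono Hk3 Qa2).
- apply (qgeo_mono Hk3 Zxq).
- rewrite Zx0, Ea0, (dist_refl connE); lia.
- rewrite D0; lia.
- rewrite D1, Ea1, (dist_refl connE); lia.
- right. apply (Hcomb C2 Q g _ (zx i)); auto; lia.
- destruct (geodesic_exists connB wx wy) as [e He]. pose proof He as [E0 [E1 _]].
  destruct (HC1 Tx Ty c1 L1 Nd D (dist wx wy) (fun j => m (e j)) Ny (fun j => zy (Ny - j)))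
    with (m := i) as [[j [Hj Hd']]|[j [Hj Hd']]]; auto.
  + intros j Hj. apply near_ladder_of_on, Dl; lia.
  + intros j Hj. apply Y1; lia.
  + apply (qgeo_mono (k := km + 1)); [unfold k3, k2; lia|].
    apply (coarse_section_qgeo (Hcs km (le_n _)) He).
  + apply (qgeo_rev connE), (qgeo_mono Hk3 Zyq).
  + rewrite D0, E0, (dist_refl connE); lia.
  + rewrite E1, Nat.sub_0_r, (dist_sym connE). lia.
  + rewrite Nat.sub_diag, Zy0, D1, (dist_refl connE); lia.
  + pose proof (dist_tri connE (a l) (D i) (m (e j))).
    destruct (geodesic_btw He Hj) as [_ Hbt].
    (* Slimness of the triangle [wx], [wy], [wz] in the base moves a point of [m] over one side to
       the other two, over which [m] follows [g] and [b]. *)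
    destruct (slim_btw connB hypB wz Hbt) as [t [Ht Hdt]].
    pose proof (Lip1 (e j) t) as Y. fold (m (e j)) (m t) in Y.
    assert (km * dist (e j) t <= km * d) by (apply Nat.mul_le_mono_l; auto).
    assert (Hext : forall n (f : nat -> E), nearp C3 n f (m t) -> nearp (km * d + C3) n f (m (e j))).
    { intros n f [i' [Hi' Hd'']]. exists i'. split; auto.
      pose proof (dist_tri connE (m (e j)) (m t) (f i')). lia. }
    destruct Ht as [Ht|Ht].
    * right. apply (Hcomb (km * d + C3) Q g _ (m (e j))); auto; lia.
    * left. apply (Hcomb (km * d + C3) P b _ (m (e j))); auto; lia.
  + left. pose proof (dist_tri connE (a l) (D i) (zy (Ny - j))).
    apply (Hcomb C2 P b _ (zy (Ny - j))); try lia. apply SY; lia.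
Qed.

(** * Independence of the ladder and the guessed geodesics *)

(** The path runs from one bounding section of its ladder to the other, as the sides of a tripod
    must. *)
Definition std_path T1 (u1 : B) T2 (u2 : B) (N : nat) (a : nat -> E) : Prop :=
  exists c, ladder T1 T2 c /\ (forall l, l <= N -> on_ladder T1 T2 c (a l)) /\
    qgeo (2 * K) N a /\ a 0 = T1 u1 /\ a N = T2 u2.

Lemma std_path_exists T1 u1 T2 u2 : tight T1 -> tight T2 -> exists N a, std_path T1 u1 T2 u2 N a.
Proof.
intros H1 H2. destruct (ladder_exists H1 H2) as [c Hc].
destruct (ladder_geodesic Hc (on_ladder_left u1 Hc) (on_ladder_right u2 Hc))
  as [N [a [A0 [AN [Al Aq]]]]].
exists N, a, c. auto.
Qed.

Lemma std_path_rev T1 u1 T2 u2 N a : std_path T1 u1 T2 u2 N a ->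
  std_path T2 u2 T1 u1 N (fun l => a (N - l)).
Proof.
intros [c [Hc [Hl [Hq [A0 AN]]]]]. eexists. split; [apply (ladder_rev Hc)|].
split; [|split; [apply (qgeo_rev connE Hq)|split]].
- intros l Hll. apply on_ladder_rev, Hl. lia.
- now rewrite Nat.sub_0_r.
- now rewrite Nat.sub_diag.
Qed.

Lemma nearp_trans C C' N (a : nat -> E) M (b : nat -> E) z :
  nearp C N a z -> (forall l, l <= N -> nearp C' M b (a l)) -> nearp (C + C') M b z.
Proof.
intros [i [Hi Hd]] H. destruct (H i Hi) as [j [Hj Hd']]. exists j. split; auto.
pose proof (dist_tri connE z (a i) (b j)). lia.
Qed.

Lemma std_path_slim : exists C, forall Tx u Ty v Tz w M a P b Q g,
  std_path Tx u Ty v M a -> std_path Ty v Tz w P b -> std_path Tz w Tx u Q g ->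
  forall l, l <= M -> nearp C P b (a l) \/ nearp C Q g (a l).
Proof.
destruct (tripod_slim (2 * K)) as [C H]. exists C.
intros Tx u Ty v Tz w M a P b Q g [c1 [L1 [Ha [Qa [Ea0 Ea1]]]]] [c2 [L2 [Hb [Qb [Eb0 Eb1]]]]]
  [c3 [L3 [Hg [Qg [Eg0 Eg1]]]]].
apply (H Tx Ty Tz c1 c2 c3 L1 L2 L3) with (u := u) (v := v) (w := w); auto.
Qed.

(* A degenerate tripod, two corners of which are the same point on two tight sections. *)
Lemma std_path_change_left : exists C, forall Tx u Ty v M a (Tx' : bundle_section p) P b,
  std_path Tx u Ty v M a -> Tx' u = Tx u -> std_path Tx' u Ty v P b ->
  forall l, l <= M -> nearp C P b (a l).
Proof.
destruct std_path_slim as [C H]. exists C.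
intros Tx u Ty v M a Tx' P b Ha Hu Hb l Hl.
assert (Hg : std_path Tx' u Tx u 0 (fun _ => Tx u)).
{ destruct Ha as [c [[Hx _] _]], Hb as [c' [[Hx' _] [_ [_ [Hb0 _]]]]].
  destruct (ladder_exists Hx' Hx) as [c0 Hc0]. exists c0. split; [auto|].
  split; [intros; apply on_ladder_right; auto|]. split; [|split; auto].
  split; [intros i Hi; lia|intros; lia]. }
destruct (H _ _ _ _ _ _ _ _ _ _ _ _ Ha (std_path_rev Hb) Hg l Hl) as [K1|[i [Hi Hd]]].
- apply nearp_reverse; auto.
- exists 0. split; [lia|]. destruct Hb as [c' [_ [_ [_ [Hb0 _]]]]]. rewrite Hb0, Hu. auto.
Qed.

Lemma std_path_change : exists C, forall Tx u Ty v M a (Tx' Ty' : bundle_section p) P b,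
  std_path Tx u Ty v M a -> Tx' u = Tx u -> Ty' v = Ty v -> std_path Tx' u Ty' v P b ->
  forall l, l <= M -> nearp C P b (a l).
Proof.
destruct std_path_change_left as [C H]. exists (C + C).
intros Tx u Ty v M a Tx' Ty' P b Ha Hu Hv Hb l Hl.
assert (HTx : tight Tx') by (destruct Hb as [c [[Hx _] _]]; auto).
assert (HTy : tight Ty) by (destruct Ha as [c [[_ [Hx _]] _]]; auto).
destruct (std_path_exists u v HTx HTy) as [R [e He]].
apply nearp_trans with (N := R) (a := e).
- apply (H _ _ _ _ _ _ _ _ _ Ha Hu He); auto.
- intros j Hj. apply nearp_reverse.
  pose proof (H _ _ _ _ _ _ _ _ _ (std_path_rev He) Hv (std_path_rev Hb) (R - j) ltac:(lia)) as X.
  cbv beta in X. replace (R - (R - j)) with j in X by lia. exact X.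
Qed.

(** The guessed geodesics: the ends may lie anywhere on the ladder, because the criterion asks for a
    family closed under subpaths, which standard paths are not. *)
Definition ladder_path (N : nat) (a : nat -> E) : Prop :=
  qgeo (2 * K) N a /\ exists T1 T2 c, ladder T1 T2 c /\ forall l, l <= N -> on_ladder T1 T2 c (a l).

(** Tight sections through the two ends bound a subladder. The given path may leave it, so a
    standard path of the subladder is taken and compared with the given one inside the larger
    ladder, by triangles with a constant side. *)
Lemma normalize_up : exists C, forall T1 T2 c, ladder T1 T2 c ->
  forall N a, (forall l, l <= N -> on_ladder T1 T2 c (a l)) -> qgeo (2 * K) N a ->
  forall h u v j, level T1 T2 c h -> a 0 = in_total (c u (h u)) -> a N = in_total (c v j) ->
  h v <= j -> j <= rung T1 T2 v ->
  exists Tx Ty M b, std_path Tx u Ty v M b /\ Tx u = a 0 /\ Ty v = a N /\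
    (forall l, l <= N -> nearp C M b (a l)) /\ (forall l, l <= M -> nearp C N a (b l)).
Proof.
destruct (ladder_triangle (2 * K)) as [C HC]. exists C.
intros T1 T2 c Hc N a Ha Qa h u v j Lh E0 EN Hj Hjl.
destruct (level_insert Hc Lh (level_len Hc) (proj1 Lh) Hj Hjl) as [h' [Lh' [Hhh Eh]]].
pose proof Lh as [Bh [Tx [Hx Ex]]]. pose proof Lh' as [Bh' [Ty [Hy Ey]]].
assert (F1 : forall w, sec_fiber Tx w = c w (h w)) by (intros; apply fiber_eq, Ex).
assert (F2 : forall w, sec_fiber Ty w = c w (h' w)) by (intros; apply fiber_eq, Ey).
set (c' := fun w i => c w (h w + i)).
assert (Hc' : ladder Tx Ty c').
{ split; [auto|split; [auto|]]. intros w. rewrite F1, F2.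
  apply (level_geodesic Hc Lh Lh'). apply Hhh. }
assert (Hr : forall w, rung Tx Ty w = h' w - h w).
{ intros w. unfold rung. rewrite F1, F2. apply (rung_dist Hc); auto. apply Hhh. }
assert (Hon : forall z, on_ladder Tx Ty c' z -> on_ladder T1 T2 c z).
{ intros z [i [Hi Ei]]. exists (h (p z) + i). split; auto. rewrite Hr in Hi.
  specialize (Bh' (p z)). specialize (Hhh (p z)). lia. }
destruct (ladder_geodesic Hc' (on_ladder_left u Hc') (on_ladder_right v Hc'))
  as [M [b [B0 [BM [Bl Bq]]]]].
assert (X0 : Tx u = a 0) by (rewrite Ex; auto).
assert (XN : Ty v = a N) by (rewrite Ey, Eh; auto).
exists Tx, Ty, M, b. split; [exists c'; auto|]. split; [auto|split; [auto|split]].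
- intros l Hl.
  destruct (HC T1 T2 c Hc N a M b 0 (fun _ => a N)) with (m := l) as [K1|[i [Hi Hd]]]; auto.
  + intros m Hm. apply near_ladder_of_on; auto.
  + intros m Hm. apply near_ladder_of_on; auto.
  + intros m Hm. apply near_ladder_of_on; auto.
  + split; [intros i Hi; lia|intros; lia].
  + rewrite B0, X0, (dist_refl connE). lia.
  + rewrite BM, XN, (dist_refl connE). lia.
  + rewrite (dist_refl connE). lia.
  + exists M. split; auto. rewrite BM, XN; auto.
- intros l Hl.
  destruct (HC T1 T2 c Hc M b N a 0 (fun _ => a N)) with (m := l) as [K1|[i [Hi Hd]]]; auto.
  + intros m Hm. apply near_ladder_of_on; auto.
  + intros m Hm. apply near_ladder_of_on; auto.
  + intros m Hm. apply near_ladder_of_on; auto.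
  + split; [intros i Hi; lia|intros; lia].
  + rewrite B0, X0, (dist_refl connE). lia.
  + rewrite (dist_refl connE). lia.
  + rewrite BM, XN, (dist_refl connE). lia.
  + exists N. split; auto.
Qed.

Lemma level_rev T1 T2 c h : level T1 T2 c h ->
  level T2 T1 (fun u j => c u (rung T1 T2 u - j)) (fun u => rung T1 T2 u - h u).
Proof.
intros [H1 [T [HT H2]]]. split.
- intros u. rewrite (rung_sym T2 T1). lia.
- exists T. split; auto. intros u. rewrite H2. do 2 f_equal. specialize (H1 u). lia.
Qed.

Lemma normalize : exists C, forall N a, ladder_path N a ->
  exists Tx Ty M b, std_path Tx (p (a 0)) Ty (p (a N)) M b /\ Tx (p (a 0)) = a 0 /\
    Ty (p (a N)) = a N /\
    (forall l, l <= N -> nearp C M b (a l)) /\ (forall l, l <= M -> nearp C N a (b l)).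
Proof.
destruct normalize_up as [C H]. exists C. intros N a [Qa [T1 [T2 [c [Hc Ha]]]]].
destruct (Ha 0 ltac:(lia)) as [i [Hi Ei]]. destruct (Ha N ltac:(lia)) as [j [Hj Ej]].
set (u := p (a 0)) in *. set (v := p (a N)) in *.
destruct (level_insert Hc (level_zero Hc) (level_len Hc) (fun w => Nat.le_0_l _)
  (Nat.le_0_l i) Hi) as [h [Lh [_ Eh]]].
destruct (le_lt_dec (h v) j) as [Hlt|Hlt].
- apply (H T1 T2 c Hc N a Ha Qa h u v j); auto. rewrite Eh; auto.
- apply (H T2 T1 _ (ladder_rev Hc) N a) with (h := fun w => rung T1 T2 w - h w)
    (j := rung T1 T2 v - j); auto.
  + intros l Hl. apply on_ladder_rev; auto.
  + apply level_rev; auto.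
  + rewrite Eh. replace (rung T1 T2 u - (rung T1 T2 u - i)) with i by lia. auto.
  + replace (rung T1 T2 v - (rung T1 T2 v - j)) with j by lia. auto.
  + lia.
  + rewrite (rung_sym T2 T1). lia.
Qed.

(** After normalization two sides may still use different tight sections through their common
    corner. The sections of the side [b], and that of [g] at the last corner, are kept;
    [std_path_change] adapts the other sides at the cost of [C2] each. *)
Lemma ladder_path_slim : exists C, forall N a M b P g,
  ladder_path N a -> ladder_path M b -> ladder_path P g ->
  a 0 = b 0 -> b M = g 0 -> g P = a N ->
  forall i, i <= N -> nearp C M b (a i) \/ nearp C P g (a i).
Proof.
destruct normalize as [C1 H1]. destruct std_path_change as [C2 H2].
destruct std_path_slim as [C3 H3].
exists (C1 + (C2 + (C3 + (C2 + C1)))).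
intros N a M b P g La Lb Lg E0 E1 E2 i Hi.
destruct (H1 N a La) as [Tx [Ty [Na [a1 [Sa [Xa [Ya [Na1 Na2]]]]]]]].
destruct (H1 M b Lb) as [Tx' [Tz [Nb [b1 [Sb [Xb [Yb [Nb1 Nb2]]]]]]]].
destruct (H1 P g Lg) as [Tz' [Ty' [Ng [g1 [Sg [Xg [Yg [Ng1 Ng2]]]]]]]].
rewrite <- E0 in *. rewrite <- E1 in *. rewrite E2 in *.
assert (T1 : tight Tx') by (destruct Sb as [c [[Hx _] _]]; auto).
assert (T2 : tight Tz) by (destruct Sb as [c [[_ [Hx _]] _]]; auto).
assert (T3 : tight Ty') by (destruct Sg as [c [[_ [Hx _]] _]]; auto).
destruct (std_path_exists (p (a 0)) (p (a N)) T1 T3) as [Na' [a2 Sa2]].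
destruct (std_path_exists (p (b M)) (p (a N)) T2 T3) as [Ng' [g2 Sg2]].
destruct (Na1 i Hi) as [i1 [Hi1 D1]].
destruct (H2 _ _ _ _ _ _ _ _ _ _ Sa (eq_trans Xb (eq_sym Xa)) (eq_trans Yg (eq_sym Ya)) Sa2 i1 Hi1)
  as [i2 [Hi2 D2]].
assert (X : forall n (f : nat -> E), nearp (C3 + (C2 + C1)) n f (a2 i2) ->
  nearp (C1 + (C2 + (C3 + (C2 + C1)))) n f (a i)).
{ intros n f [l [Hl Hd]]. exists l. split; auto.
  pose proof (dist_tri connE (a i) (a1 i1) (f l)). pose proof (dist_tri connE (a1 i1) (a2 i2) (f l)).
  lia. }
destruct (H3 _ _ _ _ _ _ _ _ _ _ _ _ Sa2 (std_path_rev Sg2) (std_path_rev Sb) i2 Hi2) as [Z|Z].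
- right. apply X. apply nearp_reverse in Z.
  apply (nearp_trans Z). intros l Hl.
  apply (nearp_trans (N := Ng) (a := g1)); auto.
  apply (H2 _ _ _ _ _ _ _ _ _ _ Sg2 (eq_trans Xg (eq_sym Yb)) eq_refl Sg l Hl).
- left. apply X. apply nearp_reverse in Z.
  apply nearp_mono with (C := C3 + C1); [lia|]. apply (nearp_trans Z); auto.
Qed.

(** By fullness any two points are joined by a ladder path. A point of a geodesic side is moved to
    the guessed path of that side, across the slim guessed triangle, and back to a geodesic side. *)
Theorem total_space_hyperbolic : hyperbolic E.
Proof.
destruct ladder_path_slim as [D HD].
assert (Lq : forall N a, ladder_path N a -> qgeo (2 * K) N a) by (intros N a H; apply H).
assert (Lsub : forall N a i j, ladder_path N a -> i <= j -> j <= N ->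
  ladder_path (j - i) (fun l => a (i + l))).
{ intros N a i j [Hq [T1 [T2 [c [Hc Ha]]]]] Hij Hj. split; [apply (qgeo_sub Hq); auto|].
  exists T1, T2, c. split; auto. intros l Hl; apply Ha; lia. }
assert (Lex : forall x y, exists N a, ladder_path N a /\ a 0 = x /\ a N = y).
{ intros x y. destruct (full x) as [Tx [Hx [u Eu]]]. destruct (full y) as [Ty [Hy [v Ev]]].
  destruct (std_path_exists u v Hx Hy) as [N [a [c [Hc [Ha [Hq [E0 E1]]]]]]].
  exists N, a. split; [split; [auto|exists Tx, Ty, c; auto]|]. split; congruence. }
destruct (guess_in_nbhd connE Lq Lsub Lex HD 1) as [C1 H1].
destruct (guess_nbhd_of connE Lq Lsub Lex HD 1) as [C2 H2].
exists (INR (C2 + D + C1)). split; [apply pos_INR|].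
intros x y z a b c Ha Hb Hc s1 [i [Hi <-]].
destruct (Lex x y) as [N1 [l1 [L1 [S1 T1]]]].
destruct (Lex x z) as [N2 [l2 [L2 [S2 T2]]]].
destruct (Lex z y) as [N3 [l3 [L3 [S3 T3]]]].
pose proof (geodesic_rev connE Hb) as Rb. pose proof (geodesic_rev connE Hc) as Rc.
pose proof Ha as [A0 [A1 _]]. pose proof Rb as [B0 [B1 _]]. pose proof Rc as [C0 [C3 _]].
destruct (H2 _ a N1 l1 (geodesic_qgeo Ha) L1 ltac:(congruence) ltac:(congruence) i Hi) as [j [Hj D1]].
assert (fin : forall n (f : nat -> E) k, nearp C1 n f k -> dist (a i) k <= C2 + D ->
  exists m, m <= n /\ dist (a i) (f m) <= C2 + D + C1).
{ intros n f k [m [Hm Hd]] Hk. exists m. split; auto.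
  pose proof (dist_tri connE (a i) k (f m)). lia. }
destruct (HD N1 l1 N2 l2 N3 l3 L1 L2 L3 ltac:(congruence) ltac:(congruence) ltac:(congruence) j Hj)
  as [[m [Hm D2]]|[m [Hm D2]]].
- pose proof (H1 _ _ N2 l2 (geodesic_qgeo Rc) L2 ltac:(congruence) ltac:(congruence) m Hm) as X.
  destruct (fin _ _ _ X) as [q [Hq D3]].
  { pose proof (dist_tri connE (a i) (l1 j) (l2 m)). lia. }
  eexists. split; [right; exists (dist z x - q); split; [|reflexivity]|apply le_INR; exact D3]. lia.
- pose proof (H1 _ _ N3 l3 (geodesic_qgeo Rb) L3 ltac:(congruence) ltac:(congruence) m Hm) as X.
  destruct (fin _ _ _ X) as [q [Hq D3]].
  { pose proof (dist_tri connE (a i) (l1 j) (l3 m)). lia. }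
  eexists. split; [left; exists (dist y z - q); split; [|reflexivity]|apply le_INR; exact D3]. lia.
Qed.

End Bundle.

(** * Passage from real to natural constants *)

Local Open Scope R_scope.

Lemma nat_above (x : R) : exists n, x <= INR n.
Proof. destruct (INR_unbounded x) as [n Hn]. exists n; lra. Qed.

Lemma delta_hyperbolic_mono (G : graph) (d d' : R) :
  d <= d' -> delta_hyperbolic d G -> delta_hyperbolic d' G.
Proof.
intros Hd H x y z a b c Ha Hb Hc t Ht.
destruct (H x y z a b c Ha Hb Hc t Ht) as [q [Hq Hdq]]. exists q; split; auto; lra.
Qed.

Lemma flaring_nat (E B : graph) (p : E -> B) (tight : bundle_section p -> Prop) :
  graph_bundle p -> flaring tight -> exists s0 : nat, forall D M : nat, exists T : nat,
  forall T1 T2, tight T1 -> tight T2 ->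
  forall u v c, geodesic u v c -> (gap T1 T2 v <= D)%nat ->
  (forall i, (i < dist u v)%nat -> (s0 <= gap T1 T2 (c i))%nat) ->
  (gap T1 T2 u <= M)%nat -> (dist u v <= T)%nat.
Proof.
intros bun [sigma [Hs H]]. destruct (nat_above sigma) as [s0 Hs0]. exists s0. intros D M.
(* Flaring is given only for bounds at least [sigma]; adding [s0] to [D] ensures this. *)
destruct (H (INR (D + s0))) as [lam [_ [Hlim Hlam]]].
{ rewrite plus_INR. pose proof (pos_INR D). lra. }
apply is_lim_spec in Hlim. destruct (Hlim (INR M)) as [x0 Hx0].
destruct (nat_above x0) as [T HT]. exists T. intros T1 T2 H1 H2 u v c Hc HD Hi HM.
destruct (le_lt_dec (dist u v) T) as [|Hlt]; auto. exfalso.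
pose proof Hc as [_ [Hn _]].
assert (X : lam (INR (dist v u)) <= INR (dist (T1 u) (T2 u))).
{ apply (Hlam T1 T2 H1 H2 u v c Hc).
  - apply le_INR. unfold gap in HD. lia.
  - intros w [i [Hiw <-]] Hne. apply Rle_trans with (INR s0); auto. apply le_INR, Hi.
    destruct (Nat.eq_dec i (dist u v)) as [->|]; [contradiction|lia]. }
rewrite (dist_sym (bundle_base_connected bun) v u) in X. apply lt_INR in Hlt. specialize (Hx0 (INR (dist u v)) ltac:(lra)).
apply le_INR in HM. unfold gap in HM. lra.
Qed.

Theorem theorem1p3 (E B : graph) (p : E -> B) (hp : graph_bundle p)
    (delta : R) (hdelta : 0 <= delta)
    (hB : delta_hyperbolic delta B)
    (hE : forall v : B, delta_hyperbolic delta (fiber p v))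
    (hS : exists S : bundle_section p -> Prop, externally_flaring S) :
  hyperbolic E.
Proof.
destruct hS as [tight [Hbun _ Hfull Hrob [kappa [_ Hret]] Hfl]].
destruct (nat_above delta) as [d Hd]. destruct (nat_above kappa) as [kap Hkap].
destruct (flaring_nat Hbun Hfl) as [s0 Hs0].
assert (hB' := delta_hyperbolic_mono Hd hB).
assert (hE' := fun v => delta_hyperbolic_mono Hd (hE v)).
destruct (flare_middle Hbun Hs0) as [s [Hs Hmid]].
apply (total_space_hyperbolic Hbun hB' hE' Hfull Hrob (kap := kap)) with
  (s0 := s0) (s := s) (K := (kap + 4 * d + 7)%nat); auto.
intros v v' x y z x' y' z' A1 A2 A3 c c' G1 G2 q q' P1 P2.
apply INR_le. apply Rle_trans with kappa; auto.
apply (Hret v v' x y z x' y' z' A1 A2 A3 c c' G1 G2 q q' P1 P2).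
Qed.
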